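(* Let $(W,S)$ be a finite Coxeter system of rank $n=|S|$ acting essentially as a reflection group on a real Euclidean space $(V,\langle\cdot,\cdot\rangle)$, let $c$ be a Coxeter element of $W$, and let $\pmb a$ be a point in the interior of the fundamental chamber $D$. Then: (i) The set $$\mathrm{Ass}^{\pmb a}_c(W):=\bigcap_{\rho\in\mathcal F_c^{(1)}}\mathscr H^{\pmb a}_\rho$$ is a simple polytope of dimension $n$ whose (outer) normal fan is the $c$-Cambrian fan $\mathcal F_c$. (ii) The vertex sets satisfy $$V(\mathrm{Ass}^{\pmb a}_c(W))\cap V(\mathrm{Perm}^{\pmb a}(W))=\{M(w)\mid w \text{ is a } c\text{-singleton}\}.$$
   Context: Coxeter notions: $\ell$ is the length function, $e$ the identity, $w_0$ the longest element. The (right) weak order: $u\le v$ iff $v=uv'$ with $\ell(v)=\ell(u)+\ell(v')$. A Coxeter element $c$ is a product of all elements of $S$, each once, in some order; fix a reduced expression of $c$. For $I\subseteq S$, $c_{(I)}$ is the subword of $c$ consisting of the letters in $I$. The $c$-sorting word of $w\in W$ is the reduced subword of the infinite word $ccc\cdots$ representing $w$ that is lexicographically first as a sequence of positions; it can be written $c_{(K_1)}c_{(K_2)}\cdots c_{(K_p)}$ with $p$ minimal (the $c$-factorization). $w$ is $c$-sortable if $K_1\supseteq K_2\supseteq\cdots\supseteq K_p$. The $c$-sortable elements form a sublattice of the weak order, and $\pi^c_\downarrow(w)$ denotes the maximal $c$-sortable element below $w$ in weak order. $w$ is a $c$-singleton if $(\pi^c_\downarrow)^{-1}(w)=\{w\}$.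 Geometry: $\Phi$ is a root system of $W$ with simple roots $\Delta=\{\alpha_s\}_{s\in S}$ forming a basis of $V$; the fundamental weights $\{v_s\}_{s\in S}$ form the basis dual to $\Delta$. The fundamental chamber is $D=\{v:\langle v,\alpha_s\rangle\ge0\ \forall s\}$, and $\rho_s=\mathbb R_{\ge0}v_s$. The Coxeter fan $\mathcal F$ consists of the chambers $w(D)$, $w\in W$, and their faces; its rays are the $w(\rho_s)$. The $c$-Cambrian fan $\mathcal F_c$ consists of the cones $C(w):=\bigcup_{w':\pi^c_\downarrow(w')=w}w'(D)$ for $c$-sortable $w$ together with all their faces; it is a complete simplicial fan coarsening $\mathcal F$, and $\mathcal F_c^{(1)}$ (its set of rays) is a subset of the rays of $\mathcal F$. For a ray $\rho=w(\rho_s)$ of $\mathcal F$ set $\mathscr H^{\pmb a}_\rho=\{v\in V:\langle v,w(v_s)\rangle\le\langle \pmb a,v_s\rangle\}$ (independent of the choice of $w$). $M(w):=w(\pmb a)$, and the permutahedron is $\mathrm{Perm}^{\pmb a}(W)=\mathrm{conv}\{M(w):w\in W\}=\bigcap_{\rho}\mathscr H^{\pmb a}_\rho$ over all rays $\rho$ of $\mathcal F$. $V(P)$ denotes the vertex set of a polytope $P$. *)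

(* Defs.v *)
From HB Require Import structures.
From mathcomp Require Import all_boot all_order all_fingroup all_algebra.
From mathcomp Require Import all_classical all_reals.

Set Implicit Arguments.
Unset Strict Implicit.
Unset Printing Implicit Defensive.

Import Order.TTheory GRing.Theory Num.Theory.

Local Open Scope classical_set_scope.
Local Open Scope ring_scope.

Section CoxeterCombinatorics.
Variables (W : finGroupType) (S : {set W}).

(* The presentation < S | (s t)^m(s,t) = 1 >, m(s,t) being the order of s t,
   expressed by its universal property among all groups; the case s = t says
   that generators are sent to elements of square 1. *)
Definition coxeter_system : Prop :=
  [/\ <<S>>%g = [set: W]%SET,
      forall s, s \in S -> #[s]%g = 2%N &
      forall (G : groupType) (f : W -> G),
        (forall s t, s \in S -> t \in S ->
           ((f s * f t) ^+ #[s * t] = 1)%g) ->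
        exists2 g : W -> G, {morph g : x y / (x * y)%g} &
                            forall s, s \in S -> g s = f s].

Definition has_word (w : W) (k : nat) : bool :=
  [exists t : k.-tuple W, all (mem S) t && ((\prod_(x <- t) x)%g == w)].

(* Only meaningful when w lies in the subgroup generated by S. *)
Definition cox_length (w : W) : nat :=
  if pselect (exists k, has_word w k) is left h then ex_minn h else 0%N.

Definition weak_le (u v : W) : Prop :=
  exists2 v', v = (u * v')%g &
              cox_length v = (cox_length u + cox_length v')%N.

(* A Coxeter element is given together with a reduced expression, i.e. as a
   word using every element of S exactly once. *)
Definition coxeter_word (c : seq W) : Prop := uniq c /\ c =i S.

Variable c : seq W.

(* The k-th letter (from 0) of the infinite word c c c ... *)
Definition letter (k : nat) : W := nth 1%g c (k %% size c).

Definition reduced_subword (w : W) (p : seq nat) : Prop :=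
  [/\ sorted ltn p, (\prod_(k <- p) letter k)%g = w & size p = cox_length w].

Definition sorting_word (w : W) (p : seq nat) : Prop :=
  reduced_subword w p /\
  forall q, reduced_subword w q -> ((p : seqlexi nat) <= (q : seqlexi nat))%O.

(* The letters of the subword p in the i-th copy of c, i.e. K_(i+1). It is
   empty past the last factor of the c-factorization, so the nesting condition
   below may range over all i. *)
Definition c_factor (p : seq nat) (i : nat) : {set W} :=
  finset (fun s => has (fun k => (k %/ size c == i)%N && (letter k == s)) p).

Definition c_sortable (w : W) : Prop :=
  exists2 p, sorting_word w p & forall i, c_factor p i.+1 \subset c_factor p i.

(* pi_down w u : u is the greatest c-sortable element below w. *)
Definition pi_down (w u : W) : Prop :=
  [/\ c_sortable u, weak_le u w &
      forall u', c_sortable u' -> weak_le u' w -> weak_le u' u].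

Definition c_singleton (w : W) : Prop := [set w' | pi_down w' w] = [set w].

End CoxeterCombinatorics.

Section Polytopes.
Variables (R : realType) (V : vectType R) (dot : {dot V for @idfun R}).

Definition hull (A : set V) : set V :=
  [set x | exists (k : nat) (p : 'I_k -> V) (l : 'I_k -> R),
     [/\ forall i, A (p i), forall i, 0 <= l i, \sum_i l i = 1 &
         x = \sum_i l i *: p i]].

Definition polytope (P : set V) : Prop :=
  exists2 A : set V, finite_set A & P = hull A.

(* Both P (u = 0, b = 0) and the empty set (u = 0, b = 1) are faces of P. *)
Definition face (P F : set V) : Prop :=
  exists (u : V) (b : R),
    P `<=` [set x | dot u x <= b] /\ F = P `&` [set x | dot u x = b].

Definition vertices (P : set V) : set V := [set x | face P [set x]].

(* A is nonempty and the direction U of its affine hull has dimension d. *)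
Definition has_dim (A : set V) (d : nat) : Prop :=
  A !=set0 /\
  exists U : {vspace V},
    [/\ forall x y, A x -> A y -> x - y \in U,
        forall U' : {vspace V},
          (forall x y, A x -> A y -> x - y \in U') -> (U <= U')%VS &
        \dim U = d].

Definition facet (P F : set V) : Prop :=
  face P F /\ exists d, has_dim P d.+1 /\ has_dim F d.

Definition simple_polytope (P : set V) (n : nat) : Prop :=
  [/\ polytope P, has_dim P n &
      forall x, vertices P x -> ([set F | facet P F /\ F x] #= `I_n)%card].

Definition normal_cone (P F : set V) : set V :=
  [set u | forall x y, F x -> P y -> dot u y <= dot u x].

Definition normal_fan (P : set V) : set (set V) :=
  [set N | exists F, [/\ face P F, F !=set0 & N = normal_cone P F]].

Definition fan_rays (Fan : set (set V)) : set (set V) :=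
  [set rho | Fan rho /\ has_dim rho 1].

Definition euclidean_interior (A : set V) : set V :=
  [set x | exists2 e : R, 0 < e &
     forall y, dot (y - x) (y - x) < e ^+ 2 -> A y].

End Polytopes.

Section ReflectionGroup.
Variables (R : realType) (V : vectType R) (dot : {dot V for @idfun R}).
Variables (W : finGroupType) (S : {set W}) (act : W -> 'End(V)).

Definition reflection (b x : V) : V := x - (2 * dot x b / dot b b) *: b.

Record essential_reflection_action : Prop := EssentialReflectionAction {
  act_one : act 1%g = \1%VF;
  act_mul : forall u w, act (u * w)%g = (act u \o act w)%VF;
  act_faithful : injective act;
  act_reflection : forall s, s \in S ->
    exists2 b, b != 0 & act s =1 reflection b;
  act_essential : forall x, (forall w, act w x = x) -> x = 0
}.

Record root_system (Phi : set V) : Prop := RootSystem {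
  root_finite : finite_set Phi;
  root_neq0 : ~ Phi 0;
  root_reduced : forall b (r : R), Phi b ->
    (Phi (r *: b) <-> r = 1 \/ r = -1);
  root_stable : forall w b, Phi b -> Phi (act w b);
  root_reflection : forall b, Phi b -> exists w, act w =1 reflection b
}.

Record simple_roots (Phi : set V) (alpha : W -> V) : Prop := SimpleRoots {
  simple_root : forall s, s \in S -> Phi (alpha s);
  simple_basis : basis_of fullv [seq alpha s | s <- enum S];
  simple_sign : forall b, Phi b ->
    exists2 k : W -> R, forall s, 0 <= k s &
      b = \sum_(s in S) k s *: alpha s \/
      b = - \sum_(s in S) k s *: alpha s;
  simple_reflection : forall s, s \in S -> act s =1 reflection (alpha s)
}.

Definition fundamental_weights (alpha v : W -> V) : Prop :=
  forall s t, s \in S -> t \in S -> dot (v s) (alpha t) = (s == t)%:R.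

Definition chamber (alpha : W -> V) : set V :=
  [set x | forall s, s \in S -> 0 <= dot x (alpha s)].

Definition fund_ray (v : W -> V) (s : W) : set V :=
  [set t *: v s | t in [set t : R | 0 <= t]].

Definition cambrian_cone (alpha : W -> V) (c : seq W) (w : W) : set V :=
  \bigcup_(w' in [set w' | pi_down S c w' w]) (act w' @` chamber alpha).

Definition cambrian_fan (alpha : W -> V) (c : seq W) : set (set V) :=
  [set F | exists w, [/\ c_sortable S c w,
                         face dot (cambrian_cone alpha c w) F & F !=set0]].

(* The half-space of a ray rho = w(rho_s) of the Coxeter fan; it does not depend
   on the choice of (w, s), and is empty if rho is not such a ray. *)
Definition halfspace (v : W -> V) (a : V) (rho : set V) : set V :=
  [set x | exists w s, [/\ s \in S, rho = act w @` fund_ray v s &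
                           dot x (act w (v s)) <= dot a (v s)]].

Definition associahedron (alpha v : W -> V) (c : seq W) (a : V) : set V :=
  \bigcap_(rho in fan_rays (cambrian_fan alpha c)) halfspace v a rho.

Definition permutahedron (a : V) : set V := hull (range (fun w => act w a)).

End ReflectionGroup.

(* Main.v *)
Require Import Defs.
From HB Require Import structures.
From mathcomp Require Import all_boot all_order all_fingroup all_algebra.
From mathcomp Require Import all_classical all_reals.
From mathcomp Require Import ring lra.

(* The right weak order is read off inversion sets, and the c-sortable elements are
   obtained by the greedy recursion [proj]: for [c = s c'], if [s <= w] then apply [s]
   and go on with [c' s], otherwise drop [s] for good. The same recursion [Run] produces
   the inner normals of the Cambrian cone of [w], together with labels of its rays: a
   ray is a fundamental weight or of the form [- E_c (b^vee, .)] for a positive root [b],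
   where [E_c] is the Euler form of [c].

   The sign of [E_c] on pairs of labels is preserved by the recursion. Hence the
   initial simple root [alpha_s] detects the coefficient of the weight [v_s] in a
   nonnegative combination of compatible rays. Peeling off weights along the rotations
   of [c], such combinations are unique, so the cones form a complete simplicial fan;
   since the Coxeter element fixes no vector, every ray is reached in this way. The skew
   part of [E_c] shows that the lower walls of a cone are walls of its minimal chamber,
   which makes [proj] order preserving.

   For polytopality, the heights are encoded by their defects at the exchanges
   [v_s -> s v_s] of the successive rotations of [c]; for the permutahedron these are the
   positive numbers [2 <a, alpha_s> / <alpha_s, alpha_s>]. By induction on the number of
   nonzero defects, the vertex attached to each cone satisfies all inequalities: above
   [s] one rotates, and below [s] one crosses the wall [alpha_s], on which all rays but
   [v_s] are nonpositive. The remaining inequality for [v_s] follows by summing the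
   displacements along a gallery from the identity. *)

Set Implicit Arguments.
Unset Strict Implicit.
Unset Printing Implicit Defensive.

Import Order.TTheory GRing.Theory Num.Theory.

Local Open Scope classical_set_scope.
Local Open Scope ring_scope.

(** Rotating [c] past its initial letter reproduces the problem of the heights for the same point
    [a], so an argument by rotation alone would never end. Cutting the list of defects off after
    finitely many letters gives an induction with a degenerate base: all inequalities are tight at
    [a] and all vertices coincide. The cut does no harm, because only finitely many labels occur and
    each of them becomes an initial weight after finitely many rotations; on these labels a long
    enough list yields the permutahedral heights. The recursion also drops letters, so the basic
    facts on [Run] and [proj] are proved for words in a subset of [S], with vectors confined to the
    span of the corresponding simple roots. Uniqueness of expansions and the study of heights only
    rotate the word; there [c] uses all of [S], so that labels are linear forms on the whole space
    and the Coxeter element has no fixed vector. *)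

Section Dot.
Variables (R : realType) (V : vectType R) (dot : {dot V for @idfun R}).

Lemma dotC x y : dot x y = dot y x.
Proof. by rewrite hermC expr0 mul1r. Qed.

Lemma dotDl x y z : dot (x + y) z = dot x z + dot y z.
Proof. exact: linearDl. Qed.

Lemma dotDr x y z : dot z (x + y) = dot z x + dot z y.
Proof. exact: linearDr. Qed.

Lemma dotZl k x y : dot (k *: x) y = k * dot x y.
Proof. exact: linearZl_LR. Qed.

Lemma dotZr k x y : dot x (k *: y) = k * dot x y.
Proof. exact: linearZr_LR. Qed.

Lemma dotNl x y : dot (- x) y = - dot x y.
Proof. by rewrite -scaleN1r dotZl mulN1r. Qed.

Lemma dotNr x y : dot x (- y) = - dot x y.
Proof. by rewrite dotC dotNl dotC. Qed.

Lemma dotBl x y z : dot (x - y) z = dot x z - dot y z.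
Proof. by rewrite dotDl dotNl. Qed.

Lemma dotBr x y z : dot z (x - y) = dot z x - dot z y.
Proof. by rewrite dotDr dotNr. Qed.

Lemma dot0l x : dot 0 x = 0.
Proof. by rewrite -(scale0r 0) dotZl mul0r. Qed.

Lemma dot0r x : dot x 0 = 0.
Proof. by rewrite dotC dot0l. Qed.

Lemma dot_suml I (r : seq I) (P : pred I) (F : I -> V) x :
  dot (\sum_(i <- r | P i) F i) x = \sum_(i <- r | P i) dot (F i) x.
Proof. by apply: (big_morph (dot^~ x)) => [y z|]; rewrite ?dotDl ?dot0l. Qed.

Lemma dot_sumr I (r : seq I) (P : pred I) (F : I -> V) x :
  dot x (\sum_(i <- r | P i) F i) = \sum_(i <- r | P i) dot x (F i).
Proof. by rewrite dotC dot_suml; apply: eq_bigr => i _; rewrite dotC. Qed.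

Lemma dot_gt0 x : x != 0 -> 0 < dot x x.
Proof. exact: neq0_dnorm_gt0. Qed.

Lemma dot_eq0 x : dot x x = 0 -> x = 0.
Proof.
by move=> x0; apply/eqP/negP => /negP /dot_gt0; rewrite x0 ltxx.
Qed.

End Dot.

(** * Spans, finite minima and convex hulls *)

Lemma span_map_sum (R : fieldType) (V : vectType R) (T : eqType)
    (f : T -> V) (l : seq T) x :
  uniq l -> x \in <<[seq f i | i <- l]>>%VS ->
  exists k : T -> R, x = \sum_(i <- l) k i *: f i.
Proof.
elim: l x => [|i l IH] x /= => [_|/andP[il ul]].
  by rewrite span_nil memv0 => /eqP ->; exists (fun=> 0); rewrite big_nil.
rewrite span_cons => /memv_addP[y /vlineP[a ->]] [z /(IH _ ul)[k ->] ->].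
exists (fun j => if j == i then a else k j); rewrite big_cons eqxx.
congr (_ + _); apply: eq_big_seq => j jl.
by case: eqP il => // <-; rewrite jl.
Qed.

Lemma dot_ext (R : realType) (V : vectType R) (dot : {dot V for @idfun R}) x y :
  (forall z, dot x z = dot y z) -> x = y.
Proof.
move=> h; apply/eqP; rewrite -subr_eq0; apply/eqP/(dot_eq0 (dot := dot)).
by rewrite dotBl h subrr.
Qed.

Lemma span_dot0 (R : realType) (V : vectType R) (dot : {dot V for @idfun R}) r
    (X : seq V) y :
  (forall x, x \in X -> dot r x = 0) -> y \in <<X>>%VS -> dot r y = 0.
Proof.
elim: X y => [|x X IH] y h; first by rewrite span_nil memv0 => /eqP ->; rewrite dot0r.
rewrite span_cons => /memv_addP[_ /vlineP[k ->]] [z zX ->].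
rewrite dotDr dotZr h ?mem_head // mulr0 add0r IH // => t tX.
by rewrite h // inE tX orbT.
Qed.

Lemma small_eps (R : realType) (T : eqType) (s : seq T) (Q : T -> R -> Prop) :
  (forall x, x \in s -> exists2 e, 0 < e & forall e', 0 < e' -> e' <= e -> Q x e') ->
  exists2 e, 0 < e & forall x, x \in s -> Q x e.
Proof.
suff H : (forall x, x \in s -> exists2 e, 0 < e & forall e', 0 < e' -> e' <= e -> Q x e') ->
  exists2 e, 0 < e & forall x e', x \in s -> 0 < e' -> e' <= e -> Q x e'.
  by move=> /H[e e0 h]; exists e => // x xs; apply: h.
elim: s => [_|x s IH h]; first by exists 1.
have [|e e0 he] := IH; first by move=> y ys; apply: h; rewrite inE ys orbT.
have [e1 e10 he1] := h x (mem_head _ _).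
exists (Num.min e e1) => [|y e']; first by rewrite lt_min e0.
rewrite inE le_min => /orP[/eqP ->|ys] e'0 /andP[e'e e'e1]; first exact: he1.
exact: he.
Qed.

Lemma min_seq (R : realType) (T : eqType) (s : seq T) (f : T -> R) x0 : x0 \in s ->
  exists2 x, x \in s & forall y, y \in s -> f x <= f y.
Proof.
elim: s x0 => // x s IH x0 _; case: s IH => [|y s] IH.
  by exists x; rewrite ?mem_head // => y; rewrite inE => /eqP ->.
have [z zs hz] := IH y (mem_head _ _).
case: (leP (f x) (f z)) => [xz|/ltW zx].
  exists x; rewrite ?mem_head // => t; rewrite inE => /orP[/eqP ->//|/hz].
  exact: le_trans.
exists z; first by rewrite inE zs orbT.
by move=> t; rewrite inE => /orP[/eqP ->//|/hz].
Qed.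

Lemma count_lt (T : eqType) (p q : pred T) (s : seq T) x :
  (forall y, y \in s -> p y -> q y) -> x \in s -> q x -> ~~ p x ->
  (count p s < count q s)%N.
Proof.
elim: s => // y s IH pq; rewrite inE => /orP[/eqP <-|xs] qx px /=.
  rewrite qx (negPf px) add0n add1n ltnS; elim: s {IH} pq => //= z s IH pq.
  rewrite leq_add //.
    case: (boolP (p z)) => // pz; rewrite (pq z) ?inE ?eqxx ?orbT //.
  by apply: IH => t; rewrite inE => /orP[/eqP ->|ts] pt; apply: pq; rewrite // !inE ?eqxx ?ts ?orbT.
rewrite -addnS leq_add //; last by apply: IH => // z zs; apply: pq; rewrite inE zs orbT.
by case: (boolP (p y)) => // py; rewrite pq ?mem_head.
Qed.

Lemma uniq_map_eq (T1 T2 : eqType) (f : T1 -> T2) (s : seq T1) x y :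
  uniq (map f s) -> x \in s -> y \in s -> f x = f y -> x = y.
Proof.
elim: s => //= z s IH /andP[fz us]; rewrite !inE.
move=> /orP[/eqP ->|xs] /orP[/eqP ->|ys] // fE; last exact: IH.
  by case/negP: fz; rewrite fE map_f.
by case/negP: fz; rewrite -fE map_f.
Qed.

Lemma has_dim_unique (R : realType) (V : vectType R) (A : set V) d d' :
  has_dim A d -> has_dim A d' -> d = d'.
Proof.
move=> [_ [U [U1 U2 <-]]] [_ [U' [U'1 U'2 <-]]].
by apply/eqP; rewrite eqn_leq !dimvS ?U2 ?U'2.
Qed.

Lemma hull_in (R : realType) (V : vectType R) (A : set V) x : A x -> hull A x.
Proof.
move=> Ax; exists 1%N, (fun=> x), (fun=> 1).
by split=> //; rewrite big_ord1 // scale1r.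
Qed.

Lemma hull_max (R : realType) (V : vectType R) (dot : {dot V for @idfun R})
    (A : set V) u b x :
  (forall y, A y -> dot u y <= b) -> hull A x -> dot u x <= b.
Proof.
move=> ub [k [p [l [pA l0 l1 ->]]]]; rewrite dot_sumr -[leRHS]mul1r -l1 mulr_suml.
by apply: ler_sum => j _; rewrite dotZr ler_wpM2l // ub.
Qed.

(** A point with positive weight in a convex combination that attains the bound attains it too. The
    second half of the conclusion shows that an exposed point of a hull is itself a generator. *)
Lemma hull_max_eq (R : realType) (V : vectType R) (dot : {dot V for @idfun R})
    (A : set V) u b x z :
  (forall y, A y -> dot u y <= b) -> (forall y, A y -> dot u y = b -> y = z) ->
  hull A x -> dot u x = b -> x = z /\ A z.
Proof.
move=> ub ue [k [p [l [pA l0 l1 ->]]]] xb.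
have E j : l j * (b - dot u (p j)) = 0.
  have : \sum_i l i * (b - dot u (p i)) = 0.
    under eq_bigr do rewrite mulrBr.
    rewrite sumrB -mulr_suml l1 mul1r -{1}xb dot_sumr.
    by apply/eqP; rewrite subr_eq0; apply/eqP; apply: eq_bigr => i _; rewrite dotZr.
  move/eqP; rewrite psumr_eq0 => [/allP/(_ j)|i _]; last first.
    by rewrite mulr_ge0 // subr_ge0 ub.
  by rewrite mem_index_enum => /(_ isT)/eqP.
have pz j : l j *: p j = l j *: z.
  move/eqP: (E j); rewrite mulf_eq0 => /orP[/eqP ->|]; first by rewrite !scale0r.
  by rewrite subr_eq0 eq_sym => /eqP/(ue _ (pA j)) ->.
split; first by under eq_bigr do rewrite pz; rewrite -scaler_suml l1 scale1r.
have [j lj] : exists j, l j != 0.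
  apply/existsP; apply: contraTT isT => /existsPn h; have := oner_neq0 R.
  by rewrite -l1 big1 ?eqxx // => j _; apply/eqP/negPn/h.
by have := pz j => /(scalerI lj) <-.
Qed.

(* A complete simplicial fan with heights on its rays. Cone [i] is given by the list
   [cl i] of the pairs (inner facet normal, label of the opposite ray); the
   generators [rv] of the rays and these normals are dual bases. *)
Section SimplicialNormalFan.
Variables (R : realType) (V : vectType R) (dot : {dot V for @idfun R}).
Variables (I : finType) (L : eqType) (cl : I -> seq (V * L)).
Variables (rv : L -> V) (ht : L -> R) (n : nat).

(** The normals of a cone are dual to its ray generators, so this is the point at which the
    inequalities of all labels of cone [i] are tight. *)
Definition vert i := \sum_(e <- cl i) ht e.2 *: e.1.
Definition fan_cone i : set V := [set x | forall e, e \in cl i -> 0 <= dot x e.1].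
Definition height_polytope : set V :=
  [set x | forall i e, e \in cl i -> dot x (rv e.2) <= ht e.2].

Hypothesis expand : forall i x, x = \sum_(e <- cl i) dot (rv e.2) x *: e.1.
Hypothesis dual : forall i e e', e \in cl i -> e' \in cl i ->
  dot (rv e.2) e'.1 = (e.2 == e'.2)%:R.
Hypothesis cl_uniq : forall i, uniq [seq e.2 | e <- cl i].
Hypothesis complete : forall u, exists i, fan_cone i u.
Hypothesis cl_size : forall i, size (cl i) = n.
Hypothesis vert_le : forall i j e, e \in cl j -> dot (vert i) (rv e.2) <= ht e.2.
Hypothesis vert_lt : forall i j e, e \in cl j -> e.2 \notin [seq f.2 | f <- cl i] ->
  dot (vert i) (rv e.2) < ht e.2.

Local Notation P := height_polytope.

Let cl_eq i e e' : e \in cl i -> e' \in cl i -> e.2 = e'.2 -> e = e'.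
Proof. exact: uniq_map_eq. Qed.

Let uniq_cl i : uniq (cl i). Proof. exact: map_uniq (cl_uniq i). Qed.

Let dot_cl i x y : dot x y = \sum_(e <- cl i) dot x e.1 * dot y (rv e.2).
Proof.
rewrite [y in LHS](expand i) dot_sumr; apply: eq_bigr => e _.
by rewrite dotZr mulrC [dot y _]dotC.
Qed.

Let rexp i x : x = \sum_(e <- cl i) dot x e.1 *: rv e.2.
Proof.
apply: (dot_ext (dot := dot)) => y; rewrite (dot_cl i) dot_suml.
by apply: eq_bigr => e _; rewrite dotZl [dot y _]dotC.
Qed.

Let vert_rv i e : e \in cl i -> dot (vert i) (rv e.2) = ht e.2.
Proof.
move=> ei; rewrite dotC /vert dot_sumr (bigD1_seq e) //= dotZr (dual ei ei) eqxx mulr1.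
rewrite big1_seq ?addr0 // => f /andP[fe fi]; rewrite dotZr (dual ei fi).
case: eqP => [/(cl_eq ei fi) E|_]; last by rewrite mulr0.
by rewrite E eqxx in fe.
Qed.

Let vert_eq i x : (forall e, e \in cl i -> dot x (rv e.2) = ht e.2) -> x = vert i.
Proof.
by move=> h; rewrite (expand i x); apply: eq_big_seq => e /h <-; rewrite dotC.
Qed.

(** * Faces of the cones and of the polytope *)

Lemma vertP i : P (vert i). Proof. by move=> j e; apply: vert_le. Qed.

(** The face of cone [i] spanned by the rays with label in [A]. It turns out to be the normal cone
    of [subface i A]. *)
Definition subcone i (A : pred L) : set V :=
  [set x | fan_cone i x /\ forall e, e \in cl i -> ~~ A e.2 -> dot x e.1 = 0].

Definition subface i (A : pred L) : set V :=
  [set y | P y /\ forall e, e \in cl i -> A e.2 -> dot y (rv e.2) = ht e.2].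

Lemma rv_cone i e : e \in cl i -> fan_cone i (rv e.2).
Proof. by move=> ei f fi; rewrite (dual ei fi) ler0n. Qed.

Lemma cone_faceP i F : (face dot (fan_cone i) F /\ F !=set0) <-> exists A, F = subcone i A.
Proof.
split=> [[[u [b [ub ->]]] [x0 [x0c /= x0b]]]|[A ->]].
  (* A hyperplane supporting a cone at one of its points passes through the origin: the points
     [2 *: x0] and [0] give the two inequalities. *)
  have b0 : b = 0.
    apply/eqP; rewrite eq_le; apply/andP; split.
      have c2 : fan_cone i (2 *: x0) by move=> e ei; rewrite dotZl mulr_ge0 // x0c.
      by have := ub _ c2; rewrite /= dotZr x0b; lra.
    have c0 : fan_cone i 0 by move=> e ei; rewrite dot0l.
    by have := ub _ c0; rewrite /= dot0r.
  rewrite {}b0 in ub x0b *; have u0 e : e \in cl i -> dot u (rv e.2) <= 0.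
    by move=> /rv_cone/ub.
  exists (fun l => dot u (rv l) == 0); apply/seteqP; split=> x [xc /= h]; split=> //.
    move=> e ei ne; move/eqP: h; rewrite dotC (dot_cl i) -oppr_eq0 -sumrN big_seq.
    rewrite psumr_eq0 => [/allP/(_ e ei)|f fi].
      by rewrite ei /= oppr_eq0 mulf_eq0 (negPf ne) orbF => /eqP.
    by rewrite oppr_ge0 mulr_ge0_le0 ?xc ?u0.
  rewrite dotC (dot_cl i) big1_seq // => e /andP[_ ei].
  by case: (eqVneq (dot u (rv e.2)) 0) => [->|/(h e ei) ->]; rewrite ?mulr0 ?mul0r.
split; last by exists 0; split=> [e ei|e ei _]; rewrite dot0l.
pose u := - \sum_(e <- cl i | ~~ A e.2) e.1.
have uE x : dot u x = - \sum_(e <- cl i | ~~ A e.2) dot x e.1.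
  by rewrite dotNl dot_suml; congr (- _); apply: eq_bigr => e _; rewrite dotC.
exists u, 0; split.
  move=> x xc /=; rewrite uE oppr_le0 big_seq_cond sumr_ge0 // => e /andP[ei _].
  exact: xc.
apply/seteqP; split=> x [xc h]; split=> //=.
  by rewrite uE big_seq_cond big1 ?oppr0 // => e /andP[ei ne]; apply: h.
move=> e ei ne; move/eqP: h; rewrite uE oppr_eq0 big_seq_cond.
rewrite psumr_eq0 => [/allP/(_ e ei)|f /andP[fi _]]; last exact: xc.
by rewrite ei ne => /eqP.
Qed.

(** Linear programming duality: [u] is the combination of the rays of its cone with the nonnegative
    coefficients [dot u e.1], and [vert i] attains the bound on each of these rays. *)
Lemma cone_max i u y : fan_cone i u -> P y -> dot u y <= dot u (vert i).
Proof.
move=> uc yP; rewrite !(dot_cl i u) big_seq [leRHS]big_seq; apply: ler_sum => e ei.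
by rewrite ler_wpM2l ?uc // vert_rv // (yP i).
Qed.

Lemma cone_max_eq i u y : fan_cone i u -> P y -> dot u y = dot u (vert i) <->
  (forall e, e \in cl i -> 0 < dot u e.1 -> dot y (rv e.2) = ht e.2).
Proof.
move=> uc yP; split=> [E e ei ue|h].
  have : \sum_(f <- cl i) dot u f.1 * (ht f.2 - dot y (rv f.2)) = 0.
    apply: etrans (_ : dot u (vert i) - dot u y = 0); last by rewrite E subrr.
    rewrite (dot_cl i u (vert i)) (dot_cl i u y) -sumrB.
    by apply: eq_big_seq => f fi; rewrite vert_rv // mulrBr.
  rewrite big_seq => /eqP; rewrite psumr_eq0 => [/allP/(_ e ei)|f fi].
    by rewrite ei /= mulf_eq0 gt_eqF //= subr_eq0 => /eqP.
  by rewrite mulr_ge0 ?uc // subr_ge0 (yP i).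
rewrite !(dot_cl i u); apply: eq_big_seq => e ei; rewrite vert_rv //.
have := uc e ei; rewrite le_eqVlt => /orP[/eqP <-|/(h e ei) ->//].
by rewrite !mul0r.
Qed.

(** A step against the normal [e.1] loosens the inequality of [e] and keeps the others of cone [i]
    tight; all the remaining ones are strict at the vertex by [vert_lt]. These steps are the edge
    directions at the vertex. *)
Lemma vert_near i e : e \in cl i -> exists2 eps, 0 < eps & P (vert i - eps *: e.1).
Proof.
move=> ei; pose AL := flatten [seq cl j | j <- enum I].
have [|eps e0 h] := @small_eps R _ AL
    (fun f eps => dot (vert i - eps *: e.1) (rv f.2) <= ht f.2).
  move=> f /flattenP[_ /mapP[j _ ->] fj].
  case: (boolP (f.2 \in [seq f.2 | f <- cl i])) => [/mapP[f' fi ->]|nf].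
    exists 1 => // eps e0 _; rewrite dotBl dotZl vert_rv // [dot e.1 _]dotC (dual fi ei).
    by rewrite gerBl mulr_ge0 ?ler0n // ltW.
  have s0 := vert_lt fj nf; set d := dot e.1 (rv f.2).
  (* The slack divided by a bound for the rate of change; the summand 1 keeps the denominator
     positive. *)
  exists ((ht f.2 - dot (vert i) (rv f.2)) / (1 + `|d|)).
    by rewrite divr_gt0 ?subr_gt0 // ltr_pwDl.
  move=> eps e0; rewrite ler_pdivlMr ?ltr_pwDl // dotBl dotZl -/d => le.
  have h : 0 <= eps * (`|d| + d).
    rewrite mulr_ge0 ?(ltW e0) //; have := ler_norm (- d); rewrite normrN; lra.
  by rewrite mulrDr in h; rewrite mulrDr mulr1 in le; lra.
exists eps => // j f fj; apply: h; apply/flattenP; exists (cl j) => //.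
by apply/mapP; exists j; rewrite ?mem_enum.
Qed.

Lemma max_cone i u : (forall y, P y -> dot u y <= dot u (vert i)) -> fan_cone i u.
Proof.
move=> h e ei; have [eps e0 pe] := vert_near ei.
have := h _ pe; rewrite dotBr dotZr gerBl pmulr_rge0 //.
Qed.

Lemma subface_near i A e : e \in cl i -> ~~ A e.2 ->
  exists2 eps, 0 < eps & subface i A (vert i - eps *: e.1).
Proof.
move=> ei ne; have [eps e0 pe] := vert_near ei; exists eps => //; split=> // f fi Af.
rewrite dotBl dotZl vert_rv // [dot e.1 _]dotC (dual fi ei).
by case: eqP ne => [<-|_]; rewrite ?Af // mulr0 subr0.
Qed.

Lemma subface_vert i A : subface i A (vert i).
Proof. by split=> [|e ei _]; [exact: vertP|exact: vert_rv]. Qed.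

Lemma normal_subface i A : normal_cone dot P (subface i A) = subcone i A.
Proof.
apply/seteqP; split=> u.
  move=> h; have uc : fan_cone i u.
    by apply: max_cone => y yP; apply: h => //; exact: subface_vert.
  split=> // e ei ne; have [eps e0 pe] := subface_near ei ne.
  apply/eqP; rewrite eq_le uc // andbT.
  by have := h _ _ pe (vertP i); rewrite dotBr dotZr lerBrDr gerDl pmulr_rle0.
move=> [uc u0] x y [xP xA] yP; rewrite (dot_cl i u x) (dot_cl i u y) big_seq [leRHS]big_seq.
apply: ler_sum => e ei; case: (boolP (A e.2)) => Ae; last by rewrite u0 // !mul0r.
by rewrite ler_wpM2l ?uc // xA // (yP i).
Qed.

Lemma face_at_vert i u b : P `<=` [set x | dot u x <= b] -> dot u (vert i) = b ->
  P `&` [set x | dot u x = b] =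
  subface i (fun l => has (fun e => (e.2 == l) && (0 < dot u e.1)) (cl i)).
Proof.
move=> ub ib; have uc : fan_cone i u by apply: max_cone => y /ub; rewrite ib.
apply/seteqP; split=> y [yP h]; split=> //.
  rewrite /= -ib in h; have {}h := (cone_max_eq uc yP).1 h.
  by move=> e ei /hasP[f fi /andP[/eqP fe uf]]; rewrite -fe; apply: h.
rewrite /= -ib; apply/(cone_max_eq uc yP) => e ei ue; apply: h => //.
by apply/hasP; exists e; rewrite ?eqxx.
Qed.

Lemma face_subface F : face dot P F -> F !=set0 -> exists i A, F = subface i A.
Proof.
move=> [u [b [ub ->]]] [x0 [x0P x0b]]; have [i uc] := complete u; exists i.
rewrite (face_at_vert (i := i) ub); first by eexists.
by apply/eqP; rewrite eq_le [X in X && _](ub _ (vertP i)) -x0b cone_max.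
Qed.

Lemma subface_face i A : face dot P (subface i A).
Proof.
pose u := \sum_(e <- cl i | A e.2) rv e.2.
have ue e : e \in cl i -> dot u e.1 = (A e.2)%:R.
  move=> ei; rewrite /u dot_suml big_mkcond (bigD1_seq e) //= (dual ei ei) eqxx.
  rewrite big1_seq ?addr0; first by case: (A e.2).
  move=> f /andP[fe fi]; case: ifP => // _; rewrite (dual fi ei).
  by case: eqP => // /(cl_eq fi ei) E; rewrite E eqxx in fe.
have uc : fan_cone i u by move=> e ei; rewrite ue // ler0n.
exists u, (dot u (vert i)); split; first by move=> y; exact: cone_max.
rewrite (face_at_vert (i := i)) //; last by move=> y; exact: cone_max.
apply/seteqP; split=> y [yP h]; split=> // e ei.
  move=> /hasP[f fi /andP[/eqP fe]]; rewrite ue // ltr0n lt0b => Af.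
  by apply: h; rewrite // -fe.
by move=> Ae; apply: h => //; apply/hasP; exists e; rewrite // eqxx ue // Ae ltr01.
Qed.

Lemma normal_fanE : normal_fan dot P =
  [set F | exists i, face dot (fan_cone i) F /\ F !=set0].
Proof.
apply/seteqP; split=> N /=.
  move=> [F [fF F0 ->]]; have [i [A ->]] := face_subface fF F0.
  by exists i; apply/cone_faceP; exists A; exact: normal_subface.
move=> [i /cone_faceP[A ->]]; exists (subface i A); split.
- exact: subface_face.
- by exists (vert i); exact: subface_vert.
- by rewrite normal_subface.
Qed.

Lemma verticesE : vertices dot P = range vert.
Proof.
apply/seteqP; split=> x /=.
  move=> fx; have [|i [A E]] := face_subface fx; first by exists x.
  by exists i => //; have := subface_vert i A; rewrite -E.
move=> [i _ <-]; rewrite /vertices /= (_ : [set vert i] = subface i xpredT).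
  exact: subface_face.
apply/seteqP; split=> y /= => [->|[yP h]]; first exact: subface_vert.
by apply: vert_eq => e ei; apply: h.
Qed.

Lemma free_sub i (s : seq (V * L)) : subseq s (cl i) -> free [seq e.1 | e <- s].
Proof.
elim: s => [_|e s IH sub]; first exact: nil_free.
have si f : f \in e :: s -> f \in cl i by apply: mem_subseq.
have us : uniq (e :: s) by apply: subseq_uniq sub (uniq_cl i).
rewrite /= free_cons IH ?andbT; last exact: subseq_trans (subseq_cons _ _) sub.
apply/negP => /(@span_dot0 _ _ dot (rv e.2)) h.
have ei := si e (mem_head _ _).
suff : dot (rv e.2) e.1 = 0 by rewrite (dual ei ei) eqxx => /eqP; rewrite oner_eq0.
apply: h => _ /mapP[f fs ->]; have fi : f \in cl i by apply: si; rewrite inE fs orbT.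
rewrite (dual ei fi); case: eqP => // /(cl_eq ei fi) E.
by move: us; rewrite /= E fs.
Qed.

Lemma free_sub_rv i (s : seq (V * L)) : subseq s (cl i) -> free [seq rv e.2 | e <- s].
Proof.
elim: s => [_|e s IH sub]; first exact: nil_free.
have si f : f \in e :: s -> f \in cl i by apply: mem_subseq.
have us : uniq (e :: s) by apply: subseq_uniq sub (uniq_cl i).
rewrite /= free_cons IH ?andbT; last exact: subseq_trans (subseq_cons _ _) sub.
apply/negP => /(@span_dot0 _ _ dot e.1) h; have ei := si e (mem_head _ _).
suff : dot e.1 (rv e.2) = 0 by rewrite dotC (dual ei ei) eqxx => /eqP; rewrite oner_eq0.
apply: h => _ /mapP[f fs ->]; have fi : f \in cl i by apply: si; rewrite inE fs orbT.
rewrite dotC (dual fi ei); case: eqP => // /(cl_eq fi ei) E.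
by move: us; rewrite /= -E fs.
Qed.

Lemma dim_subface i A : has_dim (subface i A) (count (predC A) [seq e.2 | e <- cl i]).
Proof.
split; first by exists (vert i); exact: subface_vert.
pose s := [seq e <- cl i | ~~ A e.2]; exists <<[seq e.1 | e <- s]>>%VS; split.
- move=> x y [_ xA] [_ yA]; rewrite (expand i (x - y)) big_seq memv_suml // => e ei.
  case: (boolP (A e.2)) => Ae; last first.
    by rewrite memvZ // memv_span // map_f // mem_filter Ae.
  by rewrite dotC dotBl xA // yA // subrr scale0r mem0v.
- move=> U' h; apply/span_subvP => _ /mapP[e + ->]; rewrite mem_filter => /andP[Ae ei].
  have [eps e0 pe] := subface_near ei Ae.
  have := h _ _ (subface_vert i A) pe; rewrite opprB addrC subrK => m.
  by rewrite -[e.1](scalerK (lt0r_neq0 e0)) memvZ.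
- have /eqP -> := free_sub (filter_subseq _ (cl i) : subseq s (cl i)).
  by rewrite size_map size_filter count_map.
Qed.

Lemma dim_subcone i A : has_dim (subcone i A) (count A [seq e.2 | e <- cl i]).
Proof.
have c0 : subcone i A 0 by split=> [e ei|e ei _]; rewrite dot0l.
split; first by exists 0.
pose s := [seq e <- cl i | A e.2]; exists <<[seq rv e.2 | e <- s]>>%VS; split.
- move=> x y [_ xA] [_ yA]; rewrite (rexp i (x - y)) big_seq memv_suml // => e ei.
  case: (boolP (A e.2)) => Ae.
    by rewrite memvZ // memv_span // (map_f (fun e => rv e.2)) // mem_filter Ae.
  by rewrite dotBl xA // yA // subrr scale0r mem0v.
- move=> U' h; apply/span_subvP => _ /mapP[e + ->]; rewrite mem_filter => /andP[Ae ei].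
  have ce : subcone i A (rv e.2).
    split=> [|f fi nf]; first exact: rv_cone.
    by rewrite (dual ei fi); case: eqP nf => // <-; rewrite Ae.
  by have := h _ _ ce c0; rewrite subr0.
- have /eqP -> := free_sub_rv (filter_subseq _ (cl i) : subseq s (cl i)).
  by rewrite size_map size_filter count_map.
Qed.

Let labels i : seq L := [seq e.2 | e <- cl i].

Lemma dim_polytope : has_dim P n.
Proof.
have [i _] := complete 0.
have -> : P = subface i pred0 by apply/seteqP; split=> y => [yP|[]].
have := dim_subface i pred0; rewrite (eq_count (a2 := xpredT)) // count_predT.
by rewrite size_map cl_size.
Qed.

Let count1 i (A : pred L) : count A (labels i) = 1%N ->
  exists2 e, e \in cl i & forall f, f \in cl i -> A f.2 = (f.2 == e.2).
Proof.
move=> c1; have : has A (labels i) by rewrite has_count c1.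
case/hasP => _ /mapP[e ei ->] Ae; exists e => // f fi.
case: eqP => [->//|/eqP fe]; apply/negbTE/negP => Af.
have u2 : uniq [:: f.2; e.2] by rewrite /= inE fe.
have := @uniq_leq_size _ [:: f.2; e.2] [seq l <- labels i | A l] u2.
rewrite size_filter c1 /= => h; suff : (1 < 1)%N by [].
apply: h => l; rewrite !inE mem_filter => /orP[]/eqP ->; first by rewrite Af map_f.
by rewrite Ae map_f.
Qed.

Lemma fan_raysE :
  fan_rays [set F | exists i, face dot (fan_cone i) F /\ F !=set0] =
  [set r | exists i, exists2 e, e \in cl i & r = [set t *: rv e.2 | t in [set t | 0 <= t]]].
Proof.
have rayE i e A : e \in cl i -> (forall f, f \in cl i -> A f.2 = (f.2 == e.2)) ->
    subcone i A = [set t *: rv e.2 | t in [set t | 0 <= t]].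
  move=> ei AE; apply/seteqP; split=> x /=.
    move=> [xc x0]; exists (dot x e.1); first exact: xc.
    rewrite [RHS](rexp i) (bigD1_seq e) //= big1_seq ?addr0 // => f /andP[fe fi].
    rewrite x0 ?scale0r // AE //; apply: contra fe => /eqP /(cl_eq fi ei) ->.
    by rewrite eqxx.
  move=> [t t0 <-]; split=> f fi.
    by rewrite dotZl mulr_ge0 // (rv_cone ei).
  by rewrite AE // => fe; rewrite dotZl (dual ei fi) eq_sym (negPf fe) mulr0.
apply/seteqP; split=> r /=.
  move=> [[i /cone_faceP[A ->]] d1]; have := has_dim_unique (dim_subcone i A) d1.
  by case/count1 => e ei AE; exists i, e => //; exact: rayE.
move=> [i [e ei ->]]; have E := rayE i e (pred1 e.2) ei (fun _ _ => erefl).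
split; first by exists i; apply/cone_faceP; exists (pred1 e.2).
have := dim_subcone i (pred1 e.2); rewrite E.
by rewrite (count_uniq_mem _ (cl_uniq i)) map_f.
Qed.

Lemma simple_height_polytope : polytope P -> simple_polytope dot P n.
Proof.
move=> pP; split=> //; first exact: dim_polytope.
move=> x; rewrite verticesE => -[i _ <-].
have sz : size (labels i) = n by rewrite size_map cl_size.
(* In dimension 0 there is no facet, since [facet] asks [P] to have dimension [d.+1]. Otherwise some
   entry [e0] exists and serves as the default of [nth]. *)
case: (posnP n) => [n0|n0].
  rewrite n0 (_ : mkset _ = set0) ?II0 //; apply/seteqP; split=> // F /= [[_ [d [dP _]]] _].
  by have := has_dim_unique dP dim_polytope; rewrite n0.
have [e0 e0i] : exists e, e \in cl i.
  by case: (cl i) (cl_size i) => [n00|e l]; [rewrite -n00 in n0|exists e; rewrite mem_head].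
pose Fk k := subface i (pred1 (nth e0 (cl i) k).2).
rewrite (_ : mkset _ = Fk @` `I_n).
  apply: inj_card_eq => k k'; rewrite !inE /= => kn k'n E.
  have ki : nth e0 (cl i) k \in cl i by rewrite mem_nth // cl_size.
  have ki' : nth e0 (cl i) k' \in cl i by rewrite mem_nth // cl_size.
  apply/eqP; rewrite -(nth_uniq e0 _ _ (uniq_cl i)) ?cl_size //; apply/negPn/negP => kk.
  have ne : ~~ pred1 (nth e0 (cl i) k').2 (nth e0 (cl i) k).2.
    by apply: contra kk => /= /eqP/(cl_eq ki ki') ->.
  have [eps eps0] := subface_near ki ne; rewrite -/(Fk k') -E => -[_ /(_ _ ki)].
  rewrite /= eqxx => /(_ isT); rewrite dotBl dotZl vert_rv // [dot _ (rv _)]dotC.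
  rewrite (dual ki ki) eqxx mulr1 => /eqP; rewrite -subr_eq0 addrAC subrr add0r.
  by rewrite oppr_eq0 gt_eqF.
apply/seteqP; split=> F /=.
  move=> [[[u [b [ub FE]]] [d [dP dF]]] Fi].
  have ib : dot u (vert i) = b by move: Fi; rewrite FE => -[].
  rewrite (face_at_vert ub ib) in FE; set A := fun l => _ in FE.
  have nd := has_dim_unique dim_polytope dP.
  rewrite FE in dF; have := has_dim_unique (dim_subface i A) dF => cd.
  have := count_predC A (labels i); rewrite cd sz nd -addn1 addnC => /addnI.
  case/count1 => e ei AE; exists (index e (cl i)).
    by rewrite addn1 -nd -(cl_size i) index_mem.
  rewrite /Fk nth_index // FE; apply/seteqP; split=> y [yP h]; split=> // f fi fA.
    by apply: h; rewrite //= -AE.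
  by apply: h; rewrite // AE.
move=> [k kn <-]; have ki : nth e0 (cl i) k \in cl i by rewrite mem_nth // cl_size.
split; last exact: subface_vert.
split; first exact: subface_face.
exists n.-1; rewrite prednK //; split; first exact: dim_polytope.
have := dim_subface i (pred1 (nth e0 (cl i) k).2).
have := count_predC (pred1 (nth e0 (cl i) k).2) (labels i).
rewrite (count_uniq_mem _ (cl_uniq i)) map_f // sz => <-.
by rewrite add1n.
Qed.

(** * The polytope as the hull of its vertices *)

Definition barycentric x := exists l : I -> R,
  [/\ forall i, 0 <= l i, \sum_i l i = 1 & x = \sum_i l i *: vert i].

Lemma barycentric_hull x : barycentric x -> hull (range vert) x.
Proof.
move=> [l [l0 l1 ->]].
exists #|I|, (fun j => vert (enum_val j)), (fun j => l (enum_val j)); split.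
- by move=> j; exists (enum_val j).
- by move=> j; apply: l0.
- by rewrite -(big_enum_val l) -l1; apply: eq_bigl.
- by rewrite -(big_enum_val (fun i => l i *: vert i)); apply: eq_bigl.
Qed.

Lemma barycentric_convex x y t : 0 <= t <= 1 -> barycentric x -> barycentric y ->
  barycentric (t *: x + (1 - t) *: y).
Proof.
move=> /andP[t0 t1] [l [l0 l1 ->]] [m [m0 m1 ->]].
exists (fun i => t * l i + (1 - t) * m i); split.
- by move=> i; rewrite addr_ge0 ?mulr_ge0 // subr_ge0.
- by rewrite big_split /= -!mulr_sumr l1 m1 !mulr1 addrC subrK.
- rewrite !scaler_sumr -big_split; apply: eq_bigr => i _.
  by rewrite /= !scalerA scalerDl.
Qed.

Lemma barycentric_vert i : barycentric (vert i).
Proof.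
exists (fun j => (j == i)%:R); split=> [j||]; first by rewrite ler0n.
  by rewrite (bigD1 i) //= eqxx big1 ?addr0 // => j /negPf ->.
rewrite (bigD1 i) //= eqxx scale1r big1 ?addr0 // => j /negPf ->.
by rewrite scale0r.
Qed.

Let AL := flatten [seq cl j | j <- enum I].

Let AL_mem i e : e \in cl i -> e \in AL.
Proof.
move=> ei; apply/flattenP; exists (cl i) => //.
by apply/mapP; exists i; rewrite ?mem_enum.
Qed.

Let PAL x : P x <-> forall e, e \in AL -> dot x (rv e.2) <= ht e.2.
Proof.
split=> h; first by move=> e /flattenP[_ /mapP[j _ ->]] ej; apply: (h j).
by move=> i e /AL_mem; apply: h.
Qed.

Let loose x (e : V * L) := dot x (rv e.2) != ht e.2.

Lemma polytope_step x d : P x -> d != 0 ->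
  (forall e, e \in AL -> ~~ loose x e -> dot d (rv e.2) = 0) ->
  exists t, [/\ 0 < t, P (x + t *: d) & (count (loose (x + t *: d)) AL < count (loose x) AL)%N].
Proof.
move=> xP d0 dt; have [i dc] := complete d.
(* The polytope is bounded because the fan is complete: if [d] were nonpositive on all rays of the
   cone containing it, then [dot d d <= 0]. *)
have [e ei de] : exists2 e, e \in cl i & 0 < dot d (rv e.2).
  apply: contrapT => h; have := dot_gt0 dot d0; rewrite (dot_cl i) ltNge big_seq.
  rewrite sumr_le0 // => e ei; rewrite mulr_ge0_le0 ?dc // leNgt.
  by apply/negP => de; apply: h; exists e.
pose C := [seq e <- AL | 0 < dot d (rv e.2)].
pose sl (e : V * L) := (ht e.2 - dot x (rv e.2)) / dot d (rv e.2).
have [|f + fm] := @min_seq R _ C sl e; first by rewrite mem_filter de (AL_mem ei).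
rewrite mem_filter => /andP[df fA].
have lf : loose x f.
  by case: (boolP (loose x f)) => // /(dt f fA) E; rewrite E ltxx in df.
have xf : dot x (rv f.2) < ht f.2.
  by rewrite lt_neqAle; apply/andP; split; [exact: lf|exact: (PAL x).1].
have xE t g : dot (x + t *: d) (rv g.2) = dot x (rv g.2) + t * dot d (rv g.2).
  by rewrite dotDl dotZl.
have slE g : 0 < dot d (rv g.2) -> sl g * dot d (rv g.2) = ht g.2 - dot x (rv g.2).
  by move=> dg; rewrite /sl divfK // gt_eqF.
have s0 : 0 < sl f by rewrite divr_gt0 // subr_gt0.
exists (sl f); split=> //.
  apply/PAL => g gA; rewrite xE; have [dg|dg] := ltP 0 (dot d (rv g.2)).
    rewrite -lerBrDl -slE // ler_wpM2r ?(ltW dg) //; apply: fm.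
    by rewrite mem_filter dg.
  rewrite -[leRHS]addr0 lerD ?(PAL x).1 //.
  by rewrite mulr_ge0_le0 // ltW.
apply: (@count_lt _ _ _ _ f) => // [g gA|].
  apply: contraNN => ng; have E : dot d (rv g.2) = 0 by apply: dt; rewrite ?negbK.
  by rewrite xE E mulr0 addr0.
by rewrite /loose negbK xE slE // addrC subrK.
Qed.

(** Induction on the number of loose inequalities: either [x] lies between two points with fewer
    loose ones, or it is determined by its tight ones and is a vertex. *)
Lemma polytope_barycentric x : P x -> barycentric x.
Proof.
have [m] := ubnP (count (loose x) AL); elim: m x => // m IH x cx xP.
case: (pselect (exists2 d, d != 0 &
    forall e, e \in AL -> ~~ loose x e -> dot d (rv e.2) = 0)) => [[d d0 dt]|nd].
  have [t [t0 tP tc]] := polytope_step xP d0 dt.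
  have [||t' [t'0 tP' tc']] := @polytope_step x (- d) xP; first by rewrite oppr_eq0.
    by move=> e eA le; rewrite dotNl dt // oppr0.
  have y1 := IH _ (leq_trans tc cx) tP; have y2 := IH _ (leq_trans tc' cx) tP'.
  have tt : 0 < t + t' by rewrite addr_gt0.
  pose q := t' / (t + t').
  have -> : x = q *: (x + t *: d) + (1 - q) *: (x + t' *: - d).
    rewrite !scalerDr !scalerA scalerN addrACA -scalerDl [q + _]addrC subrK scale1r.
    rewrite -scalerBl (_ : q * t - (1 - q) * t' = 0) ?scale0r ?addr0 //.
    by rewrite /q; field; rewrite gt_eqF.
  apply: barycentric_convex => //; rewrite divr_ge0 ?(ltW t'0) ?(ltW tt) //=.
  by rewrite ler_pdivrMr // mul1r lerDr ltW.
(* The sum of the tight rays attains its maximum at [x] and at the vertex of its cone; comparing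
   term by term, every inequality tight at [x] is tight at that vertex. *)
pose T := [seq e <- AL | ~~ loose x e]; pose u := \sum_(e <- T) rv e.2.
have [i uc] := complete u.
suff -> : x = vert i by exact: barycentric_vert.
apply/eqP; rewrite -subr_eq0; apply/negPn/negP => d0; apply: nd; exists (x - vert i) => //.
have uE y : dot u y = \sum_(e <- T) dot y (rv e.2).
  by rewrite /u dot_suml; apply: eq_bigr => e _; rewrite dotC.
have xT e : e \in T -> dot x (rv e.2) = ht e.2.
  by rewrite mem_filter negbK => /andP[/eqP].
have : \sum_(e <- T) (dot x (rv e.2) - dot (vert i) (rv e.2)) <= 0.
  by rewrite sumrB -!uE subr_le0 cone_max.
move=> le0 e eA le.
have eT : e \in T by rewrite mem_filter le.
have ge f : f \in T -> 0 <= dot x (rv f.2) - dot (vert i) (rv f.2).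
  move=> fT; rewrite xT // subr_ge0; have := PAL (vert i); move/iffLR => H.
  apply: H; first exact: vertP.
  by move: fT; rewrite mem_filter => /andP[].
rewrite dotBl; apply/eqP; rewrite eq_le ge // andbT; apply: le_trans le0.
rewrite (big_rem e) //= lerDl big_seq sumr_ge0 // => f /mem_rem fT.
exact: ge.
Qed.

Lemma height_polytopeE : P = hull (range vert).
Proof.
apply/seteqP; split=> x; first by move=> /polytope_barycentric/barycentric_hull.
move=> [k [p [l [pA l0 l1 ->]]]] i e ei; rewrite dot_suml -[leRHS]mul1r -l1 mulr_suml.
apply: ler_sum => j _; rewrite dotZl ler_wpM2l //.
by have [w _ <-] := pA j; exact: vert_le ei.
Qed.

Lemma polytope_height_polytope : polytope P.
Proof.
exists (range vert); last exact: height_polytopeE.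
by apply: finite_image; exact: finite_finset.
Qed.

End SimplicialNormalFan.
(** * Roots, length and weak order *)

Section Reflections.
Variables (W : finGroupType) (S : {set W}) (hWS : coxeter_system S).
Variables (R : realType) (V : vectType R) (dot : {dot V for @idfun R}).
Variables (act : W -> 'End(V)) (hact : essential_reflection_action dot S act).
Variables (Phi : set V) (hPhi : root_system dot act Phi).
Variables (alpha : W -> V) (halpha : simple_roots dot S act Phi alpha).
Variables (v : W -> V) (hv : fundamental_weights dot S alpha v).

Let nrm x := dot x x.

Lemma gen_ind (P : W -> Prop) :
  P 1%g -> (forall s w, s \in S -> P w -> P (s * w)%g) -> forall w, P w.
Proof.
move=> P1 PM w; have [gS _ _] := hWS.
have: w \in <<S>>%g by rewrite gS inE.
case/gen_prodgP => n [d dS ->].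
elim: (index_enum _) => [|i l IH].
  by rewrite big_nil.
by rewrite big_cons; apply: PM.
Qed.

Lemma mulss s : s \in S -> (s * s = 1)%g.
Proof.
by move=> sS; have [_ o2 _] := hWS; rewrite -(expg_order s) o2.
Qed.

Lemma invs s : s \in S -> (s^-1 = s)%g.
Proof. by move=> sS; apply/eqP; rewrite eq_invg_mul mulss. Qed.

Lemma mulsK s w : s \in S -> (s * (s * w) = w)%g.
Proof. by move=> sS; rewrite mulgA mulss // mul1g. Qed.

Lemma act1 x : act 1%g x = x.
Proof. by rewrite (act_one hact) id_lfunE. Qed.

Lemma actM u w x : act (u * w)%g x = act u (act w x).
Proof. by rewrite (act_mul hact) comp_lfunE. Qed.

Lemma actK w x : act (w^-1)%g (act w x) = x.
Proof. by rewrite -actM mulVg act1. Qed.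

Lemma actKV w x : act w (act (w^-1)%g x) = x.
Proof. by rewrite -actM mulgV act1. Qed.

Lemma act_s s x : s \in S ->
  act s x = x - (2 * dot x (alpha s) / nrm (alpha s)) *: alpha s.
Proof. by move=> sS; rewrite (simple_reflection halpha sS). Qed.

Lemma actsK s x : s \in S -> act s (act s x) = x.
Proof. by move=> sS; rewrite -actM mulss // act1. Qed.

Lemma rootA s : s \in S -> Phi (alpha s).
Proof. exact: (simple_root halpha). Qed.

Lemma root_n0 b : Phi b -> b != 0.
Proof. by move=> bP; apply/eqP => b0; apply: (root_neq0 hPhi); rewrite -b0. Qed.

Lemma nrm_gt0 b : Phi b -> 0 < nrm b.
Proof. by move=> bP; apply/dot_gt0/root_n0. Qed.

Lemma nrmA s : s \in S -> 0 < nrm (alpha s).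
Proof. by move=> sS; apply/nrm_gt0/rootA. Qed.

Lemma rootN b : Phi b -> Phi (- b).
Proof.
by move=> bP; rewrite -scaleN1r; apply/(root_reduced hPhi (-1) bP); right.
Qed.

Lemma root_act w b : Phi b -> Phi (act w b).
Proof. exact: (root_stable hPhi). Qed.

Lemma dot_act w x y : dot (act w x) (act w y) = dot x y.
Proof.
move: w x y; apply: gen_ind => [|s w sS IH] x y; first by rewrite !act1.
rewrite !actM -(IH x y); move: (act w x) (act w y) => {IH}x {}y.
rewrite !act_s // dotBl !dotBr !dotZl !dotZr [dot (alpha s) y]dotC.
have := nrmA sS; rewrite /nrm; move: (dot (alpha s) _) => n n0.
by field; rewrite gt_eqF.
Qed.

Lemma dot_actl w x y : dot (act w x) y = dot x (act (w^-1)%g y).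
Proof. by rewrite -(dot_act (w^-1)%g) actK. Qed.

Lemma dot_actr w x y : dot x (act w y) = dot (act (w^-1)%g x) y.
Proof. by rewrite -(dot_act (w^-1)%g) actK. Qed.

(** The coordinate of [x] at the simple root [alpha t], the weights being the dual basis. *)
Definition co t x := dot (v t) x.

Lemma coA t s : t \in S -> s \in S -> co t (alpha s) = (t == s)%:R.
Proof. exact: hv. Qed.

Lemma co_sum t (k : W -> R) : t \in S ->
  co t (\sum_(s in S) k s *: alpha s) = k t.
Proof.
move=> tS; rewrite /co dot_sumr (bigD1 t) //= dotZr hv // eqxx mulr1.
rewrite big1 ?addr0 // => s /andP[sS st].
by rewrite dotZr hv // eq_sym (negPf st) mulr0.
Qed.

Lemma coE x : x = \sum_(t in S) co t x *: alpha t.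
Proof.
have: x \in fullv by rewrite memvf.
rewrite -(span_basis (simple_basis halpha)) => /span_map_sum.
case=> [|k xE]; first exact: enum_uniq.
rewrite big_enum in xE.
rewrite [LHS]xE; apply: eq_bigr => t tS.
by rewrite [in RHS]xE co_sum.
Qed.

Lemma co_inj x y : (forall t, t \in S -> co t x = co t y) -> x = y.
Proof.
by move=> xy; rewrite (coE x) (coE y); apply: eq_bigr => t /xy ->.
Qed.

Lemma co_alpha t x : t \in S -> (forall q, q \in S -> q != t -> co q x = 0) ->
  x = co t x *: alpha t.
Proof.
move=> tS x0; apply: co_inj => q qS; rewrite [RHS]dotZr hv //.
by case: (eqVneq q t) => [->|qt]; rewrite ?mulr1 // mulr0 x0.
Qed.

Lemma dot_coE x y : dot x y = \sum_(t in S) co t y * dot x (alpha t).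
Proof.
by rewrite [y in LHS]coE dot_sumr; apply: eq_bigr => t _; rewrite dotZr.
Qed.

Lemma co_s t s x : s \in S -> t \in S -> t != s -> co t (act s x) = co t x.
Proof.
move=> sS tS ts; rewrite act_s // [LHS]dotBr dotZr hv //.
by rewrite (negPf ts) mulr0 subr0.
Qed.

Lemma act_sv s t : s \in S -> t \in S -> t != s -> act s (v t) = v t.
Proof.
by move=> sS tS ts; rewrite act_s // hv // (negPf ts) mulr0 mul0r scale0r subr0.
Qed.

Lemma actA s : s \in S -> act s (alpha s) = - alpha s.
Proof.
move=> sS; rewrite act_s // mulfK ?gt_eqF ?nrmA //.
by rewrite scaler_nat mulr2n opprD addrA subrr add0r.
Qed.

(** The coordinates of a root have a common sign, so a single negative one makes it a negative
    root. *)
Definition neg x := [exists t in S, co t x < 0].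

Lemma posP x : reflect (forall t, t \in S -> 0 <= co t x) (~~ neg x).
Proof.
apply: (iffP existsPn) => [h t tS|h t]; first by have:= h t; rewrite tS /= ltNge negbK.
by apply/negP => /andP[/h]; rewrite ltNge => ->.
Qed.

Lemma root_co b : Phi b ->
  (forall t, t \in S -> 0 <= co t b) \/ (forall t, t \in S -> co t b <= 0).
Proof.
move=> /(simple_sign halpha)[k k0 [->|->]]; [left|right] => t tS.
  by rewrite co_sum.
by rewrite [co _ _]dotNr [dot _ _]co_sum // oppr_le0.
Qed.

Lemma neg_le0 b : Phi b -> neg b -> forall t, t \in S -> co t b <= 0.
Proof.
move=> /root_co[h|h] // /existsP[t /andP[tS]].
by rewrite ltNge h.
Qed.

Lemma le0_neg b : Phi b -> (forall t, t \in S -> co t b <= 0) -> neg b.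
Proof.
move=> bP h; case: (boolP (neg b)) => // /posP h'.
have := root_n0 bP; rewrite (_ : b = 0) ?eqxx //.
apply: co_inj => t tS; rewrite [RHS]dot0r; apply/eqP.
by rewrite eq_le h // h'.
Qed.

Lemma negN b : Phi b -> neg (- b) = ~~ neg b.
Proof.
move=> bP; case: (boolP (neg b)) => nb /=; last first.
  apply: le0_neg; first exact: rootN.
  by move=> t tS; rewrite [co _ _]dotNr oppr_le0; move/posP: nb; apply.
apply/negbTE/posP => t tS; rewrite [co _ _]dotNr oppr_ge0.
exact: neg_le0.
Qed.

Lemma pos_co_gt0 b t : Phi b -> t \in S -> 0 < co t b -> ~~ neg b.
Proof.
by move=> bP tS h; apply: contraL h => /(neg_le0 bP)/(_ t tS); rewrite leNgt.
Qed.

Lemma pos_ex b : Phi b -> ~~ neg b -> exists2 t, t \in S & 0 < co t b.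
Proof.
move=> bP b0; case: (boolP [exists t in S, 0 < co t b]).
  by case/existsP => t /andP[tS tb]; exists t.
move/existsPn => h; move: b0; rewrite le0_neg // => t tS.
by have:= h t; rewrite tS /= -leNgt.
Qed.

Lemma posA s : s \in S -> ~~ neg (alpha s).
Proof.
move=> sS; apply: (@pos_co_gt0 _ s) => //; first exact: rootA.
by rewrite coA // eqxx.
Qed.

Lemma pos_simple b s : Phi b -> ~~ neg b -> s \in S ->
  (forall t, t \in S -> t != s -> co t b = 0) -> b = alpha s.
Proof.
move=> bP b0 sS h; have bE := co_alpha sS h.
move: (bP); rewrite bE => /(root_reduced hPhi _ (rootA sS)) [->|m1].
  by rewrite scale1r.
by move/posP: b0 => /(_ s sS); rewrite m1 ler0N1.
Qed.

Lemma root_refl b s : Phi b -> ~~ neg b -> s \in S -> neg (act s b) ->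
  b = alpha s.
Proof.
move=> bP b0 sS n; apply: pos_simple => // t tS ts.
apply/eqP; rewrite eq_le; move/posP: (b0) => -> //; rewrite andbT.
by rewrite -(co_s b sS tS ts) (neg_le0 _ n) //; exact: root_act.
Qed.

(** The root [act s (alpha t)] has coordinate 1 at [t], hence is positive; its coordinate at [s] is
    a negative multiple of the scalar product. *)
Lemma dotA_le0 s t : s \in S -> t \in S -> s != t -> dot (alpha s) (alpha t) <= 0.
Proof.
move=> sS tS st.
have P : ~~ neg (act s (alpha t)).
  apply: (@pos_co_gt0 _ t) => //; first by apply/root_act/rootA.
  by rewrite co_s // 1?eq_sym // coA // eqxx.
move/posP: P => /(_ s sS); rewrite act_s // [co _ _]dotBr dotZr.
rewrite !hv // eqxx (negPf st) mulr1 sub0r oppr_ge0.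
by rewrite pmulr_lle0 ?invr_gt0 ?nrmA // pmulr_rle0 // dotC.
Qed.

Lemma conj_refl s t g : s \in S -> t \in S ->
  act (g^-1)%g (alpha s) = alpha t -> (s * g = g * t)%g.
Proof.
move=> sS tS gst; apply: (act_faithful hact); apply/lfunP => x.
rewrite !actM (act_s _ sS) (act_s _ tS) linearB /=.
have -> : alpha s = act g (alpha t) by rewrite -gst actKV.
by rewrite /nrm !dot_act [act g (_ *: _)]linearZ.
Qed.

(** * Length and the exchange property *)

Local Notation len := (cox_length S).

Lemma has_wordP w k :
  reflect (exists l : seq W, [/\ all (mem S) l, (\prod_(x <- l) x)%g = w & size l = k])
          (has_word S w k).
Proof.
apply: (iffP existsP) => [[t /andP[tS /eqP tw]]|[l [lS lw /eqP lk]]].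
  by exists (tval t); rewrite size_tuple.
by exists (Tuple lk); rewrite /= lS lw eqxx.
Qed.

Lemma len_le l : all (mem S) l -> (len (\prod_(x <- l) x)%g <= size l)%N.
Proof.
move=> lS; rewrite /cox_length; case: pselect => [h|]; last first.
  by case; exists (size l); apply/has_wordP; exists l.
by case: ex_minnP => m _; apply; apply/has_wordP; exists l.
Qed.

Lemma len_word w :
  exists l : seq W, [/\ all (mem S) l, (\prod_(x <- l) x)%g = w & size l = len w].
Proof.
rewrite /cox_length; case: pselect => [h|]; last first.
  case; move: w; apply: gen_ind => [|s w sS [k /has_wordP[l [lS <- _]]]].
    by exists 0%N; apply/has_wordP; exists [::]; rewrite big_nil.
  exists (size l).+1; apply/has_wordP; exists (s :: l).
  by rewrite big_cons /= sS.
by case: ex_minnP => m /has_wordP.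
Qed.

Lemma len1 : len 1%g = 0%N.
Proof.
by apply/eqP; rewrite -leqn0; have := @len_le [::] isT; rewrite big_nil.
Qed.

Lemma len_eq0 w : len w = 0%N -> w = 1%g.
Proof.
by have [l [_ <- <-]] := len_word w => /size0nil ->; rewrite big_nil.
Qed.

(** The letters are applied one after the other. The first one that makes the root negative must
    meet its own simple root, the only positive root it can make negative. *)
Lemma root_becomes_simple l b : all (mem S) l -> Phi b -> ~~ neg b ->
  neg (act (\prod_(x <- l) x)^-1%g b) ->
  exists2 i, (i < size l)%N &
    act (\prod_(x <- take i l) x)^-1%g b = alpha (nth 1%g l i).
Proof.
elim: l b => [|t l IH] b /=; first by rewrite big_nil invg1 act1 => _ _ /negPf ->.
move=> /andP[tS lS] bP b0; rewrite big_cons invMg actM (invs tS) => n.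
case: (boolP (neg (act t b))) => [nt|pt].
  by exists 0%N; rewrite //= big_nil invg1 act1 (root_refl bP b0 tS nt).
have [i il iE] := IH _ lS (root_act t bP) pt n.
by exists i.+1; rewrite //= big_cons invMg actM (invs tS).
Qed.

Lemma exchange l s : all (mem S) l -> s \in S ->
  neg (act (\prod_(x <- l) x)^-1%g (alpha s)) ->
  exists2 i, (i < size l)%N &
    (s * \prod_(x <- l) x = \prod_(x <- take i l ++ drop i.+1 l) x)%g.
Proof.
move=> lS sS n; have [i il iE] := root_becomes_simple lS (rootA sS) (posA sS) n.
have iS : nth 1%g l i \in S by move/allP: lS; apply; rewrite mem_nth.
exists i => //; rewrite -[l in LHS](cat_take_drop i) !big_cat /=.
rewrite (drop_nth 1%g il) big_cons mulgA (conj_refl sS iS iE) -mulgA.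
by rewrite mulsK.
Qed.

(** Left descent, that is [s <= w] in weak order, stated on roots; [desc_len] links it to the
    length. *)
Definition desc s w := neg (act (w^-1)%g (alpha s)).

Lemma descs s w : s \in S -> desc s (s * w)%g = ~~ desc s w.
Proof.
move=> sS; rewrite /desc invMg actM (invs sS) actA // linearN negN //.
by apply/root_act/rootA.
Qed.

Lemma len_mul u w : (len (u * w)%g <= len u + len w)%N.
Proof.
have [l [lS <- <-]] := len_word u; have [l' [lS' <- <-]] := len_word w.
by rewrite -big_cat -size_cat len_le // all_cat lS lS'.
Qed.

Lemma len_s s : s \in S -> (len s <= 1)%N.
Proof.
by move=> sS; have := @len_le [:: s]; rewrite big_seq1 /= sS; apply.
Qed.

Lemma len_desc_lt s w : s \in S -> desc s w -> (len (s * w)%g < len w)%N.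
Proof.
move=> sS; have [l [lS <- <-]] := len_word w => /(exchange lS sS)[i il ->].
apply: leq_ltn_trans (len_le _) _.
  rewrite all_cat; apply/andP; split; apply/allP => x.
    by move/mem_take; apply: (allP lS).
  by move/mem_drop; apply: (allP lS).
rewrite size_cat size_drop size_takel ?(ltnW il) //.
by rewrite -ltn_subRL ltn_sub2l.
Qed.

Lemma len_desc s w : s \in S -> desc s w -> len w = (len (s * w)%g).+1.
Proof.
move=> sS d; apply/eqP; rewrite eqn_leq len_desc_lt // andbT.
by rewrite -[w in (len w <= _)%N](mulsK _ sS) (leq_trans (len_mul _ _)) //
  -addn1 addnC leq_add2l len_s.
Qed.

Lemma len_asc s w : s \in S -> ~~ desc s w -> len (s * w)%g = (len w).+1.
Proof.
by move=> sS; rewrite -descs // => /(len_desc sS) ->; rewrite mulsK.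
Qed.

Lemma desc_len s w : s \in S -> desc s w = (len (s * w)%g < len w)%N.
Proof.
move=> sS; case: (boolP (desc s w)) => [d|/(len_asc sS) ->].
  by rewrite len_desc_lt.
by rewrite ltnNge leqnSn.
Qed.

Lemma len_invg w : len (w^-1)%g = len w.
Proof.
suff h u : (len (u^-1)%g <= len u)%N.
  by apply/eqP; rewrite eqn_leq h -{1}[w]invgK h.
have [l [lS <- <-]] := len_word u.
have -> : ((\prod_(x <- l) x)^-1 = \prod_(x <- rev l) x)%g.
  elim: l lS => [|x l IH] /= => [_|/andP[xS lS]]; first by rewrite !big_nil invg1.
  by rewrite big_cons invMg IH // rev_cons -cats1 big_cat big_seq1 (invs xS).
by rewrite -(size_rev l) len_le // all_rev.
Qed.

Lemma neg_act_len w r : r \in S -> neg (act w (alpha r)) = (len (w * r)%g < len w)%N.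
Proof.
move=> rS; rewrite -[w in neg (act w _)]invgK [neg _](desc_len _ rS).
by rewrite -[len (r * _)%g]len_invg invMg invgK invs // len_invg.
Qed.

Lemma weyl_ind (P : W -> Prop) :
  P 1%g -> (forall s w, s \in S -> desc s w -> P (s * w)%g -> P w) ->
  forall w, P w.
Proof.
move=> P1 PM w; have [n] := ubnP (len w); elim: n w => // n IH w ln.
have [l [lS lw ls]] := len_word w.
case: l => [|s l] in lS lw ls; first by rewrite -lw big_nil.
move: lS => /= /andP[sS lS]; have d : desc s w.
  by rewrite desc_len // -ls -lw big_cons mulsK // ltnS len_le.
by apply: (PM s) => //; apply: IH; rewrite -ltnS -len_desc.
Qed.

Lemma weyl_ind_last (P : W -> Prop) :
  P 1%g -> (forall r w, r \in S -> ~~ neg (act w (alpha r)) -> P w -> P (w * r)%g) ->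
  forall w, P w.
Proof.
move=> P1 PM w; rewrite -[w]invgK; move: (w^-1)%g => {}w.
move: w; apply: weyl_ind => [|s w sS d IH]; first by rewrite invg1.
rewrite -[w](mulsK _ sS) invMg (invs sS); apply: PM => //.
by move: d; rewrite -[w in desc s w](mulsK _ sS) descs.
Qed.

(** * Inversions and weak order *)

Definition inversion w b := [/\ Phi b, ~~ neg b & neg (act (w^-1)%g b)].

Lemma inv_desc s w : s \in S -> desc s w -> inversion w (alpha s).
Proof. by move=> sS d; split; [exact: rootA | exact: posA | exact: d]. Qed.

Lemma inversion1 b : ~ inversion 1%g b.
Proof. by case=> _ /negPf; rewrite invg1 act1 => ->. Qed.

Lemma inversion_s s w b : s \in S -> ~~ desc s w ->
  inversion (s * w)%g b -> b = alpha s \/ inversion w (act s b).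
Proof.
move=> sS d [bP b0 n]; case: (boolP (neg (act s b))) => ns.
  by left; apply: root_refl.
right; split=> //; first exact: root_act.
by move: n; rewrite invMg actM (invs sS).
Qed.

Lemma inversion_up s w b : s \in S -> ~~ desc s w -> inversion w b ->
  inversion (s * w)%g (act s b).
Proof.
move=> sS d [bP b0 n]; split; first exact: root_act.
  apply/negP => ns; have bE := root_refl bP b0 sS ns.
  by move: d; rewrite /desc -bE n.
by rewrite invMg actM (invs sS) actsK.
Qed.

Lemma inversion_last w r b : r \in S -> ~~ neg (act w (alpha r)) ->
  inversion w b -> inversion (w * r)%g b.
Proof.
move=> rS p [bP b0 n]; split=> //; rewrite invMg actM (invs rS).
move: n; set b' := act _ b => n; have b'P : Phi b' by apply: root_act.
apply: contraNT p => q; have : - b' = alpha r.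
  apply: root_refl => //; first exact: rootN.
    by rewrite negN // n.
  by rewrite linearN /= negN //; exact: root_act.
by move=> <-; rewrite linearN /= actKV negN.
Qed.

(** Induction on a left descent [s] of [u]: either side of the equivalence makes [s] a descent of
    [w] as well, and multiplying both elements by [s] leads to a shorter [u]. *)
Lemma weak_inversion u w : weak_le S u w <-> (forall b, inversion u b -> inversion w b).
Proof.
split.
  move: u w; apply: weyl_ind => [|s u sS d IH] w; first by move=> _ b /inversion1.
  case=> w' -> lw b; rewrite -[u](mulsK _ sS) -mulgA.
  have du : ~~ desc s (s * u)%g by rewrite descs // negbK.
  have dw : ~~ desc s (s * u * w')%g.
    rewrite desc_len // -mulgA mulsK // -leqNgt lw (len_desc sS d) addSn.
    by rewrite mulgA (leq_trans (len_mul _ _)).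
  move=> /(inversion_s sS du)[->|ib].
    by apply: inv_desc => //; rewrite descs.
  rewrite -[b](actsK _ sS); apply: inversion_up => //.
  apply: IH ib; exists w' => //; apply/eqP; rewrite eqn_leq len_mul /=.
  rewrite -ltnS -(len_asc sS dw) -mulgA mulsK // lw (len_desc sS d).
  by rewrite addSn.
move: u w; apply: weyl_ind => [|s u sS d IH] w h.
  by exists w; rewrite ?mul1g ?len1.
have dw : desc s w by have [] := h _ (inv_desc sS d).
have du : ~~ desc s (s * u)%g by rewrite descs // negbK.
case: (IH (s * w)%g) => [b ib|w' wE lw].
  have := h _ (_ : inversion u (act s b)).
  case=> [|bP b0 n]; first by rewrite -[u](mulsK _ sS); apply: inversion_up.
  have [bP' b0' _] := ib; split=> //.
  by rewrite invMg actM (invs sS).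
exists w'; first by rewrite -[w](mulsK _ sS) wE mulgA mulsK.
by rewrite (len_desc sS dw) (len_desc sS d) lw.
Qed.

Lemma act_fix u x : (forall b, inversion u b -> dot x b = 0) -> act (u^-1)%g x = x.
Proof.
move: u x; apply: weyl_ind => [|s u sS d IH] x h; first by rewrite invg1 act1.
have sx : act s x = x by rewrite act_s // h ?mulr0 ?mul0r ?scale0r ?subr0 //; apply: inv_desc.
have := IH x; rewrite invMg actM (invs sS) sx; apply => b ib.
rewrite -sx dot_actl (invs sS); apply: h.
by rewrite -[u](mulsK _ sS); apply: inversion_up; rewrite ?descs ?negbK.
Qed.

Lemma no_inversion w : (forall s, s \in S -> ~~ desc s w) -> w = 1%g.
Proof.
by move: w; apply: weyl_ind => // s w sS d _ /(_ s sS); rewrite d.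
Qed.

(** * The fundamental chamber as a fundamental domain *)

Local Notation dom := (chamber dot S alpha).

Lemma dom_v t : t \in S -> dom (v t).
Proof. by move=> tS s sS; rewrite hv // ler0n. Qed.

Lemma dot_ge0 x y : dom x -> ~~ neg y -> 0 <= dot x y.
Proof.
move=> dx /posP y0; rewrite dot_coE; apply: sumr_ge0 => t tS.
by rewrite mulr_ge0 // ?y0 // dx.
Qed.

Lemma dom_le g x y : dom x -> dom y -> dot (act g x) y <= dot x y.
Proof.
move=> dx dy; move: g; apply: weyl_ind => [|s g sS d IH]; first by rewrite act1.
apply: le_trans IH; rewrite -[g in leLHS](mulsK _ sS) actM act_s // dotBl dotZl.
rewrite gerBl mulr_ge0 ?(dy s sS) 1?dotC ?dy // divr_ge0 ?(ltW (nrmA sS)) //.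
rewrite mulr_ge0 // dotC dot_actl dot_ge0 //.
  by move: d; rewrite -[g in desc s g](mulsK _ sS) descs.
Qed.

(** Testing [dom_le] for [g] and for its inverse against the weights bounds each coordinate from
    both sides. *)
Lemma fund_domain g x : dom x -> dom (act g x) -> act g x = x.
Proof.
move=> dx dy; apply: co_inj => t tS; apply/eqP; rewrite eq_le /co ![dot (v t) _]dotC.
rewrite dom_le //=; last exact: dom_v.
by rewrite -[x in leLHS](actK g) dom_le //; exact: dom_v.
Qed.

Definition rho := \sum_(t in S) v t.

Lemma rhoA s : s \in S -> dot rho (alpha s) = 1.
Proof.
move=> sS; rewrite /rho dot_suml (bigD1 s) //= hv // eqxx big1 ?addr0 //.
by move=> t /andP[tS ts]; rewrite hv // (negPf ts).
Qed.

Lemma rho_act s : s \in S -> act s rho = rho - (2 / nrm (alpha s)) *: alpha s.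
Proof. by move=> sS; rewrite act_s // rhoA // mulr1. Qed.

Lemma dom_rho : dom rho.
Proof. by move=> s sS; rewrite rhoA. Qed.

Lemma dot_rho_gt0 b : Phi b -> ~~ neg b -> 0 < dot rho b.
Proof.
move=> bP b0; have [t tS tb] := pos_ex bP b0.
rewrite dot_coE (bigD1 t) //= rhoA // mulr1 ltr_wpDr // sumr_ge0 // => s /andP[sS _].
by rewrite rhoA // mulr1; move/posP: b0; apply.
Qed.

(* The chamber is chosen so that it contains [x + eps e] for all small [eps > 0]. *)
Lemma chamber_near x e : exists g, dom (act (g^-1)%g x) /\
  forall d, Phi d -> 0 <= dot x d -> 0 < dot e d -> ~~ neg (act (g^-1)%g d).
Proof.
pose f g := dot x (act g rho).
(* A lexicographic maximum, of the pairing of [act g rho] with [x] and then with [e], takes the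
   place of a small [eps]. *)
case: (@arg_maxP _ _ W 1%g xpredT f isT) => g0 _ g0M.
pose P := [pred g | f g == f g0]; have Pg0 : P g0 by rewrite /= eqxx.
case: (@arg_maxP _ _ W g0 P (fun g => dot e (act g rho)) Pg0) => g /eqP gE gM.
have step s y : s \in S -> dot y (act (g * s)%g rho) =
    dot y (act g rho) - (2 / nrm (alpha s)) * dot y (act g (alpha s)).
  by move=> sS; rewrite actM rho_act // linearB linearZ /= dotBr dotZr.
have k0 s : s \in S -> 0 < 2 / nrm (alpha s) by move=> sS; rewrite divr_gt0 ?nrmA.
have xg s : s \in S -> 0 <= dot x (act g (alpha s)).
  move=> sS; have := g0M (g * s)%g isT; rewrite -gE /f step //.
  by rewrite /= gerBl pmulr_rge0 // k0.
have eg s : s \in S -> dot x (act g (alpha s)) = 0 -> 0 <= dot e (act g (alpha s)).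
  move=> sS xs; have := gM (g * s)%g; rewrite /= -gE /f step // xs mulr0 subr0 eqxx.
  by move=> /(_ isT); rewrite /= step // gerBl pmulr_rge0 // k0.
exists g; split=> [s sS|d dP xd ed]; first by rewrite -dot_actr xg.
apply/negP => n; have dE : d = \sum_(t in S) co t (act (g^-1)%g d) *: act g (alpha t).
  rewrite -[d in LHS](actKV g) [act (g^-1)%g d in LHS]coE linear_sum /=.
  by apply: eq_bigr => t _; rewrite linearZ.
have c0 := neg_le0 (root_act (g^-1)%g dP) n.
have z t : t \in S -> co t (act (g^-1)%g d) * dot x (act g (alpha t)) = 0.
  move: xd; rewrite {1}dE dot_sumr => xd tS.
  have h s : s \in S -> dot x (co s (act (g^-1)%g d) *: act g (alpha s)) <= 0.
    by move=> sS; rewrite dotZr mulr_le0_ge0 ?c0 ?xg.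
  have := xd; rewrite (bigD1 t) //= dotZr => {}xd; apply/eqP; rewrite eq_le.
  rewrite mulr_le0_ge0 ?c0 ?xg //=; apply: le_trans xd _.
  by rewrite gerDl sumr_le0 // => s /andP[sS _]; apply: h.
move: ed; rewrite {1}dE dot_sumr ltNge sumr_le0 // => t tS; rewrite dotZr.
move/eqP: (z t tS); rewrite mulf_eq0 => /orP[/eqP ->|/eqP xt]; first by rewrite mul0r.
by rewrite mulr_le0_ge0 ?c0 ?eg.
Qed.

Lemma chamber_cover x : exists g, dom (act (g^-1)%g x).
Proof. by have [g []] := chamber_near x 0; exists g. Qed.

(** * Words, the Euler form and rays *)

Definition supp (c : seq W) x := forall t, t \in S -> t \notin c -> co t x = 0.
Definition word (c : seq W) := uniq c && all (mem S) c.

(** A triangular half of the Gram matrix of the simple roots: the scalar product if the first root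
    precedes the second in [c], half of it on the diagonal, and 0 otherwise. The form and its
    transpose add up to [dot] on the span of the simple roots of [c]. *)
Fixpoint euler (c : seq W) (x y : V) : R :=
  if c is s :: c' then
    co s x * (co s y * nrm (alpha s) / 2
              + \sum_(t <- c') co t y * dot (alpha s) (alpha t)) + euler c' x y
  else 0.

Lemma word_cons s c : word (s :: c) = [&& s \in S, s \notin c & word c].
Proof. by rewrite /word /=; case: (s \in S) (s \in c) (uniq c) => [] [] []. Qed.

Lemma word_rot s c : word (rcons c s) = word (s :: c).
Proof. by rewrite /word rcons_uniq all_rcons. Qed.

Lemma supp_rot s c x : supp (rcons c s) x <-> supp (s :: c) x.
Proof. by split=> h t tS tc; apply: h; rewrite // ?mem_rcons // -?mem_rcons. Qed.

Lemma supp_cons s c x : supp c x -> supp (s :: c) x.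
Proof. by move=> h t tS; rewrite inE negb_or => /andP[_]; apply: h. Qed.

Lemma suppA s c : s \in S -> supp (s :: c) (alpha s).
Proof.
by move=> sS t tS; rewrite inE negb_or => /andP[ts _]; rewrite coA // (negPf ts).
Qed.

Lemma suppZ c k x : supp c x -> supp c (k *: x).
Proof. by move=> hx t tS tc; rewrite [LHS]dotZr [dot _ _]hx // mulr0. Qed.

Lemma supp_s s c x : s \in S -> supp (s :: c) x -> supp (s :: c) (act s x).
Proof.
move=> sS hx t tS tc; rewrite co_s ?hx //.
by move: tc; rewrite inE negb_or => /andP[].
Qed.

Lemma supp_dot c x y : word c -> supp c x ->
  dot y x = \sum_(t <- c) co t x * dot y (alpha t).
Proof.
case/andP => uc cS sx; rewrite dot_coE (bigID (mem c)) /= addrC big1 ?add0r; last first.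
  by move=> t /andP[tS tc]; rewrite sx // mul0r.
rewrite [RHS]big_uniq //=; apply: eq_bigl => t; rewrite andbC.
case: (boolP (t \in c)) => //= tc.
by move/allP: cS => /(_ t tc).
Qed.

Lemma eulerE_l c x x' y : (forall t, t \in c -> co t x = co t x') ->
  euler c x y = euler c x' y.
Proof.
elim: c => //= s c IH h; rewrite h ?mem_head // IH // => t tc.
by rewrite h // inE tc orbT.
Qed.

Lemma eulerE_r c x y y' : (forall t, t \in c -> co t y = co t y') ->
  euler c x y = euler c x y'.
Proof.
elim: c => //= s c IH h; rewrite h ?mem_head // IH //; last first.
  by move=> t tc; rewrite h // inE tc orbT.
by congr (_ * (_ + _) + _); apply: eq_big_seq => t tc; rewrite h // inE tc orbT.
Qed.

Lemma euler_rcons c s x y : euler (rcons c s) x y =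
  euler c x y + (\sum_(q <- c) co q x * dot (alpha q) (alpha s)) * co s y
  + co s x * co s y * nrm (alpha s) / 2.
Proof.
elim: c => [|q c IH] /=; first by rewrite !big_nil; ring.
by rewrite IH -cats1 big_cat big_seq1 big_cons /=; ring.
Qed.

Lemma euler0r c x y : (forall t, t \in c -> co t y = 0) -> euler c x y = 0.
Proof.
elim: c => //= s c IH h; rewrite h ?mem_head // big1_seq ?IH //; first by ring.
  by move=> t tc; rewrite h // inE tc orbT.
by move=> t /andP[_ tc]; rewrite h ?mul0r // inE tc orbT.
Qed.

(** The analogue of reflecting a quiver at a source: only the coordinate at [s] changes, and its new
    value trades the terms with [s] first for those with [s] last. *)
Lemma euler_shift s c x y : word (s :: c) -> supp (s :: c) x -> supp (s :: c) y ->
  euler (s :: c) (act s x) (act s y) = euler (rcons c s) x y.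
Proof.
move=> wc sx sy; have [sS sc wc'] := and3P (etrans (esym (word_cons s c)) wc).
have cs t : t \in c -> [/\ t \in S & t != s].
  move=> tc; split; last by apply: contraNneq sc => <-.
  by case/andP: wc' => _ /allP; apply.
rewrite euler_rcons /= (eulerE_l _ (x' := x)) ?(eulerE_r _ (y' := y)); last 2 first.
- by move=> t /cs[tS ts]; rewrite co_s.
- by move=> t /cs[tS ts]; rewrite co_s.
have -> : \sum_(t <- c) co t (act s y) * dot (alpha s) (alpha t)
        = \sum_(t <- c) co t y * dot (alpha s) (alpha t).
  by apply: eq_big_seq => t /cs[tS ts]; rewrite co_s.
have -> : \sum_(q <- c) co q x * dot (alpha q) (alpha s)
        = \sum_(t <- c) co t x * dot (alpha s) (alpha t).
  by apply: eq_bigr => t _; rewrite dotC.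
have E z : supp (s :: c) z -> co s (act s z) = - co s z -
    2 * (\sum_(t <- c) co t z * dot (alpha s) (alpha t)) / nrm (alpha s).
  move=> sz; rewrite act_s // [LHS]dotBr dotZr hv // eqxx mulr1
    [dot z _]dotC (supp_dot (alpha s) wc sz).
  rewrite big_cons -/(co s z) -/(nrm (alpha s)).
  have := nrmA sS; move: (nrm _) => n n0; field; by rewrite gt_eqF.
rewrite !E //; have := nrmA sS; move: (nrm _) => n n0; field; by rewrite gt_eqF.
Qed.

Lemma eulerDr c x y z : euler c x (y + z) = euler c x y + euler c x z.
Proof.
elim: c => [|s c IH] /=; first by rewrite addr0.
rewrite IH [co s (y + z)]dotDr -!/(co _ _).
have -> : \sum_(t <- c) co t (y + z) * dot (alpha s) (alpha t) =
   \sum_(t <- c) co t y * dot (alpha s) (alpha t)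
   + \sum_(t <- c) co t z * dot (alpha s) (alpha t).
  by rewrite -big_split; apply: eq_bigr => t _; rewrite [co _ (_ + _)]dotDr mulrDl.
by ring.
Qed.

Lemma eulerZr c x k y : euler c x (k *: y) = k * euler c x y.
Proof.
elim: c => [|s c IH] /=; first by rewrite mulr0.
rewrite IH [co s (k *: y)]dotZr -!/(co _ _).
have -> : \sum_(t <- c) co t (k *: y) * dot (alpha s) (alpha t) =
   k * \sum_(t <- c) co t y * dot (alpha s) (alpha t).
  by rewrite big_distrr; apply: eq_bigr => t _; rewrite [co _ (_ *: _)]dotZr /= mulrA.
by ring.
Qed.

Arguments euler : simpl never.

Lemma euler_cons s c x y : euler (s :: c) x y =
  co s x * (co s y * nrm (alpha s) / 2
            + \sum_(t <- c) co t y * dot (alpha s) (alpha t)) + euler c x y.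
Proof. by []. Qed.

(** * Labels and their linear forms *)

Local Notation label := (W + V)%type.

(* Rays of the Cambrian fan of [c] as linear forms on the span of the simple roots of
   [c]: [inl t] is the fundamental weight [v t], and [inr b] is [- E_c (b^vee, .)]. *)
Definition phi (c : seq W) (l : label) (y : V) : R :=
  match l with
  | inl t => co t y
  | inr b => - (2 / nrm b) * euler c b y
  end.

(* How a label changes when the initial letter [s] of [c] is moved to the end; [tau] is
   the inverse of [sig] on the labels that occur. *)
Definition sig s (l : label) : label :=
  match l with
  | inl t => if t == s then inr (alpha s) else inl t
  | inr b => inr (act s b)
  end.

Definition tau s (l : label) : label :=
  match l with
  | inl t => inl t
  | inr b => if b == alpha s then inl s else inr (act s b)
  end.

Definition valid (c : seq W) (l : label) : Prop :=
  match l with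
  | inl t => t \in c
  | inr b => [/\ Phi b, ~~ neg b & supp c b]
  end.

(** Compatibility in the sense of clusters. For two roots this is half of the condition, which is
    always imposed in both orders. *)
Definition comp (c : seq W) (l l' : label) : bool :=
  match l, l' with
  | inl _, inl _ => true
  | inl t, inr b => co t b == 0
  | inr b, inl t => co t b == 0
  | inr b, inr b' => 0 <= euler c b b'
  end.

Lemma phiD c l x y : phi c l (x + y) = phi c l x + phi c l y.
Proof. by case: l => [t|b] /=; rewrite ?[co _ _]dotDr // eulerDr mulrDr. Qed.

Lemma phiZ c l k x : phi c l (k *: x) = k * phi c l x.
Proof. by case: l => [t|b] /=; rewrite ?[co _ _]dotZr // eulerZr mulrCA. Qed.

Lemma phi0 c l : phi c l 0 = 0.
Proof. by rewrite -(scale0r 0) phiZ mul0r. Qed.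

Lemma phiN c l x : phi c l (- x) = - phi c l x.
Proof. by rewrite -scaleN1r phiZ mulN1r. Qed.

Lemma phiB c l x y : phi c l (x - y) = phi c l x - phi c l y.
Proof. by rewrite phiD phiN. Qed.

Lemma phi_sum c l I (r : seq I) (P : pred I) (F : I -> V) :
  phi c l (\sum_(i <- r | P i) F i) = \sum_(i <- r | P i) phi c l (F i).
Proof. by apply: big_morph => [x y|]; rewrite ?phiD ?phi0. Qed.

Lemma word_headS s c : word (s :: c) -> s \in S.
Proof. by rewrite word_cons => /and3P[]. Qed.

Lemma word_head_notin s c : word (s :: c) -> s \notin c.
Proof. by rewrite word_cons => /and3P[]. Qed.

Lemma word_tail s c : word (s :: c) -> word c.
Proof. by rewrite word_cons => /and3P[]. Qed.

Lemma wordS c t : word c -> t \in c -> t \in S.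
Proof. by case/andP => _ /allP; apply. Qed.

Lemma word_neq s c t : word (s :: c) -> t \in c -> t != s.
Proof. by move/word_head_notin => sc tc; apply: contraNneq sc => <-. Qed.

Lemma valid_rot s c l : valid (rcons c s) l <-> valid (s :: c) l.
Proof.
case: l => [t|b] /=; first by rewrite mem_rcons.
by split=> -[? ? /supp_rot].
Qed.

Lemma valid_cons s c l : valid c l -> valid (s :: c) l.
Proof.
case: l => [t|b] /= => [tc|[? ? /supp_cons]] //.
by rewrite inE tc orbT.
Qed.

Lemma euler0l c x y : (forall t, t \in c -> co t x = 0) -> euler c x y = 0.
Proof.
elim: c => //= s c IH h; rewrite euler_cons h ?mem_head // mul0r add0r IH // => t tc.
by rewrite h // inE tc orbT.
Qed.

(** Roots are covered by [euler_shift]. For [inl s], the letter [s] is last in [rcons c s], so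
    [euler] with [- alpha s] on the left reads off the coordinate at [s]; this is why the weight
    turns into the root [alpha s]. *)
Lemma phi_sig s c l y : word (s :: c) -> valid (s :: c) l -> supp (s :: c) y ->
  phi (s :: c) (sig s l) (act s y) = phi (rcons c s) l y.
Proof.
move=> wc; have sS := word_headS wc; case: l => [t|b] /= => [tc|[bP b0 sb]] sy.
  case: eqP => [->|/eqP ts]; last first.
    move: tc; rewrite inE (negPf ts) /= => tc.
    by rewrite co_s // (wordS wc) // inE tc orbT.
  rewrite /= -[X in euler _ X _](actsK _ sS) actA //.
  have sA : supp (s :: c) (- alpha s) by rewrite -scaleN1r; apply/suppZ/suppA.
  rewrite /phi euler_shift // euler_rcons euler0l ?big1_seq.
  - rewrite [co s (- _)]dotNr hv // eqxx /=.
    have := nrmA sS; move: (nrm _) => n n0; field; by rewrite gt_eqF.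
  - move=> q /andP[_ qc]; rewrite [co _ _]dotNr hv ?(negPf (word_neq wc qc)) //.
      by rewrite oppr0 mul0r.
    by rewrite (wordS wc) // inE qc orbT.
  - move=> q qc; rewrite [co _ _]dotNr hv ?(negPf (word_neq wc qc)) ?oppr0 //.
    by rewrite (wordS wc) // inE qc orbT.
rewrite euler_shift //.
by rewrite /nrm dot_act.
Qed.

Lemma phi_drop s c l y : word (s :: c) -> valid c l -> phi (s :: c) l y = phi c l y.
Proof.
move=> wc; case: l => [//|b] /= [_ _ sb].
by rewrite euler_cons (sb s) ?(word_headS wc) ?(word_head_notin wc) // mul0r add0r.
Qed.

Lemma phi_dropA s c l : word (s :: c) -> valid c l -> phi (s :: c) l (alpha s) = 0.
Proof.
move=> wc vl; have sS := word_headS wc; rewrite phi_drop //.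
have h t : t \in c -> co t (alpha s) = 0.
  move=> tc; rewrite coA ?(negPf (word_neq wc tc)) //.
  by rewrite (wordS wc) // inE tc orbT.
by case: l vl => [t /h//|b _] /=; rewrite euler0r ?mulr0.
Qed.

Lemma euler_headA s c b : word (s :: c) ->
  euler (s :: c) b (alpha s) = co s b * nrm (alpha s) / 2.
Proof.
move=> wc; have sS := word_headS wc.
have h t : t \in c -> co t (alpha s) = 0.
  move=> tc; rewrite coA ?(negPf (word_neq wc tc)) //.
  by rewrite (wordS wc) // inE tc orbT.
rewrite euler_cons euler0r // big1_seq; last by move=> t /andP[_ /h ->]; rewrite mul0r.
by rewrite coA // eqxx /=; ring.
Qed.

(** The letter [s] precedes all others, so [euler] with [alpha s] on the right reads off the
    coordinate at [s], up to a positive factor. *)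
Lemma phi_headA s c l : word (s :: c) -> valid (s :: c) l -> l != inl s ->
  phi (s :: c) l (alpha s) <= 0.
Proof.
move=> wc; have sS := word_headS wc; case: l => [t|b] /= => [tc ts|[bP b0 sb] _].
  have {}ts : t != s by apply: contraNneq ts => ->.
  by rewrite coA ?(wordS wc tc) ?(negPf ts).
rewrite euler_headA // mulNr oppr_le0.
rewrite mulr_ge0 ?divr_ge0 ?(ltW (nrm_gt0 bP)) //.
by rewrite mulr_ge0 ?(ltW (nrmA sS)) //; move/posP: b0; apply.
Qed.

Lemma euler_headAl s c y : word (s :: c) -> supp (s :: c) y ->
  euler (s :: c) (alpha s) (act s y) = - (co s y * nrm (alpha s) / 2).
Proof.
move=> wc sy; have sS := word_headS wc.
have := @phi_sig s c (inl s) y wc (mem_head _ _) sy; rewrite /= eqxx /= => <-.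
have := nrmA sS; move: (nrm _) (euler _ _ _) => n E n0; field; by rewrite gt_eqF.
Qed.

(* The first component of an entry is an inner normal of the cone, the second one labels
   the ray dual to it. The fuel [size c + len w] drops by one in both branches. *)
Fixpoint run n (c : seq W) w : seq (V * label) :=
  if n is n'.+1 then
    if c is s :: c' then
      if desc s w then
        [seq (act s e.1, sig s e.2) | e <- run n' (rcons c' s) (s * w)%g]
      else (alpha s, inl s) :: run n' c' w
    else [::]
  else [::].

Definition Run c w := run (size c + len w) c w.

Fixpoint projrec n (c : seq W) w : W :=
  if n is n'.+1 then
    if c is s :: c' then
      if desc s w then (s * projrec n' (rcons c' s) (s * w))%g
      else projrec n' c' w
    else 1%g
  else 1%g.

Definition proj c w := projrec (size c + len w) c w.

(** * The recursion and its invariants *)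

Lemma Run_nil w : Run [::] w = [::].
Proof. by rewrite /Run; case: (_ + _)%N. Qed.

Lemma proj_nil w : proj [::] w = 1%g.
Proof. by rewrite /proj; case: (_ + _)%N. Qed.

Lemma Run_desc s c w : s \in S -> desc s w ->
  Run (s :: c) w = [seq (act s e.1, sig s e.2) | e <- Run (rcons c s) (s * w)%g].
Proof.
by move=> sS d; rewrite /Run (len_desc sS d) size_rcons addnS /= d.
Qed.

Lemma Run_asc s c w : ~~ desc s w ->
  Run (s :: c) w = (alpha s, inl s) :: Run c w.
Proof. by move=> d; rewrite /Run /= (negPf d). Qed.

Lemma proj_desc s c w : s \in S -> desc s w ->
  proj (s :: c) w = (s * proj (rcons c s) (s * w))%g.
Proof.
by move=> sS d; rewrite /proj (len_desc sS d) size_rcons addnS /= d.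
Qed.

Lemma proj_asc s c w : ~~ desc s w -> proj (s :: c) w = proj c w.
Proof. by move=> d; rewrite /proj /= (negPf d). Qed.

Lemma run_ind (P : seq W -> W -> Prop) :
  (forall w, P [::] w) ->
  (forall s c w, word (s :: c) -> desc s w -> P (rcons c s) (s * w)%g -> P (s :: c) w) ->
  (forall s c w, word (s :: c) -> ~~ desc s w -> P c w -> P (s :: c) w) ->
  forall c w, word c -> P c w.
Proof.
move=> P0 Pd Pa c w; have [n] := ubnP (size c + len w)%N.
elim: n c w => // n IH [|s c] w ln wc; first exact: P0.
case: (boolP (desc s w)) => d; last by apply: Pa => //; apply: IH => //; exact: word_tail wc.
apply: Pd => //; apply: IH; last by rewrite word_rot.
by move: ln; rewrite (len_desc (word_headS wc) d) size_rcons /= addnS !ltnS.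
Qed.

(** The three clauses go through the recursion together: all of them are needed to exclude the label
    [inr (alpha s)], which applying [s] would make negative. *)
Definition run_ok c w := [/\
  forall e, e \in Run c w -> [/\ Phi e.1, supp c e.1, ~~ neg (act (w^-1)%g e.1) & valid c e.2],
  forall x, supp c x -> x = \sum_(e <- Run c w) phi c e.2 x *: e.1 &
  forall e e', e \in Run c w -> e' \in Run c w -> comp c e.2 e'.2].

(* If [inr (alpha s)] were a label, compatibility would make all the coordinates
   of [alpha s] in the cluster basis nonpositive. *)
Lemma run_excl s c w : word (s :: c) -> ~~ desc s w -> run_ok (rcons c s) w ->
  forall e, e \in Run (rcons c s) w -> e.2 <> inr (alpha s).
Proof.
move=> wc d [h1 h2 h3] e eR eA; have sS := word_headS wc.
have aP : Phi (act (w^-1)%g (alpha s)) by apply/root_act/rootA.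
suff : desc s w by rewrite (negPf d).
apply: le0_neg => // t tS; rewrite (h2 (alpha s)); last exact/supp_rot/suppA.
rewrite linear_sum /= [co _ _]dot_sumr big_seq sumr_le0 // => e' e'R.
have [eP es en ev] := h1 _ e'R.
rewrite linearZ dotZr mulr_le0_ge0 //; last by move/posP: en; apply.
have := h3 _ _ e'R eR; rewrite eA; case: e'.2 ev => [q|b] /= => [|[bP _ _] E].
  by rewrite mem_rcons => /(wordS wc) qS /eqP; rewrite coA // => ->.
by rewrite mulNr oppr_le0 mulr_ge0 // divr_ge0 // ltW // nrm_gt0.
Qed.

Lemma run_okP c w : word c -> run_ok c w.
Proof.
move: c w; apply: run_ind => [w|s c w wc d IH|s c w wc d [h1 h2 h3]].
- rewrite /run_ok Run_nil; split=> // x sx; rewrite big_nil; apply: co_inj => t tS.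
  by rewrite sx // [RHS]dot0r.
- have sS := word_headS wc; have ds : ~~ desc s (s * w)%g by rewrite descs // negbK.
  have ex := run_excl wc ds IH; case: IH => h1 h2 h3; rewrite /run_ok Run_desc //.
  have h1' e : e \in Run (rcons c s) (s * w)%g -> valid (s :: c) e.2 /\
      forall b, e.2 = inr b -> ~~ neg (act s b).
    move=> eR; have [_ _ _ /valid_rot ve] := h1 _ eR; split=> // b eb.
    move: ve; rewrite eb /= => -[bP b0 _]; apply/negP => n.
    by apply: (ex e eR); rewrite eb (root_refl bP b0 sS n).
  split.
  + move=> _ /mapP[e eR ->] /=; have [eP /supp_rot es en _] := h1 _ eR.
    have [ve ve'] := h1' e eR; split; [exact: root_act|exact: supp_s| |].
      by move: en; rewrite invMg actM (invs sS).
    case: e.2 ve ve' => [t|b] /= => [tc _|[bP b0 sb] /(_ b erefl) nb].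
      by case: ifP => //= _; split; [exact: rootA|exact: posA|exact: suppA].
    by split=> //; [exact: root_act|exact: supp_s].
  + move=> x sx; have sx' := supp_s sS sx.
    rewrite -[x in LHS](actsK _ sS) {1}(h2 (act s x)); last exact/supp_rot.
    rewrite linear_sum big_map; apply: eq_big_seq => e eR /=; rewrite linearZ /=.
    have [ve _] := h1' e eR; congr (_ *: _).
    by rewrite -[x in RHS](actsK _ sS) phi_sig.
  + move=> _ _ /mapP[e eR ->] /mapP[e' e'R ->] /=.
    have := h3 _ _ eR e'R; have := h3 _ _ e'R eR.
    have [ve pe] := h1' e eR; have [ve' pe'] := h1' e' e'R.
    have sE b b' : supp (s :: c) b -> supp (s :: c) b' ->
      euler (s :: c) (act s b) (act s b') = euler (rcons c s) b b' by apply: euler_shift.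
    have A0 b : supp (s :: c) b -> co s b = 0 -> euler (s :: c) (alpha s) (act s b) = 0.
      by move=> sb b0; rewrite euler_headAl // b0 !mul0r oppr0.
    case: e.2 e'.2 ve ve' pe pe' => [t|b] [t'|b'] /=.
    * move=> tc tc' _ _ _ _; case: eqP => [_|/eqP ts]; case: eqP => [_|/eqP ts'] //=.
      - by rewrite euler_headA // coA // eqxx mul1r divr_ge0 ?(ltW (nrmA sS)).
      - by rewrite coA ?(wordS wc tc') ?(negPf ts').
      - by rewrite coA ?(wordS wc tc) ?(negPf ts).
    * move=> tc [bP b0 sb] _ /(_ b' erefl) nb _ /eqP tb; case: eqP => [ts|/eqP ts] /=.
        by rewrite A0 // -ts.
      by rewrite co_s ?(wordS wc tc) ?tb.
    * move=> [bP b0 sb] tc /(_ b erefl) nb _ _ /eqP tb; case: eqP => [ts|/eqP ts] /=.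
        rewrite euler_headA // divr_ge0 // mulr_ge0 //.
          by move/posP: nb; apply.
        exact: ltW (nrmA sS).
      by rewrite co_s ?(wordS wc tc) ?tb.
    * by move=> [bP b0 sb] [bP' b0' sb'] _ _ _ E; rewrite sE.
- have sS := word_headS wc; have sc := word_head_notin wc.
  have co0 x : supp c x -> co s x = 0 by move=> sx; apply: sx.
  rewrite /run_ok Run_asc //; split.
  + move=> e; rewrite inE => /orP[/eqP -> /=|/h1[eP es en ev]].
      by split; [exact: rootA|exact: suppA|exact: d|rewrite mem_head].
    by split=> //; [exact: supp_cons|exact: valid_cons].
  + move=> x sx; rewrite big_cons /=.
    have sx' : supp c (x - co s x *: alpha s).
      move=> t tS tc; rewrite [LHS]dotBr dotZr hv //.
      case: (eqVneq t s) => [->|ts]; first by rewrite mulr1 subrr.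
      by rewrite mulr0 subr0; apply: sx; rewrite // inE negb_or ts.
    rewrite -[LHS](subrK (co s x *: alpha s)) addrC; congr (_ + _).
    rewrite [LHS]h2 //; apply: eq_big_seq => e eR; have [_ _ _ ve] := h1 _ eR.
    by rewrite -(phi_drop _ wc ve) phiB phiZ phi_dropA // mulr0 subr0.
  + move=> e e'; rewrite !inE => /orP[/eqP ->|eR] /orP[/eqP ->|e'R] //=.
    * have [_ _ _] := h1 _ e'R; case: e'.2 => //= b [_ _ sb].
      by rewrite co0.
    * have [_ _ _] := h1 _ eR; case: e.2 => //= b [_ _ sb].
      by rewrite co0.
    * have [_ _ _] := h1 _ eR; have [_ _ _] := h1 _ e'R; have := h3 _ _ eR e'R.
      case: e.2 e'.2 => [t|b] [t'|b'] //= E [_ _ sb'] [_ _ sb].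
      by rewrite euler_cons co0 // mul0r add0r.
Qed.

Lemma sigK s c l : s \in S -> valid c l -> tau s (sig s l) = l.
Proof.
move=> sS; case: l => [t|b] /= => [tc|[bP b0 sb]].
  by case: eqP => //= ->; rewrite eqxx.
rewrite actsK //; case: eqP => // sbA.
move: b0; rewrite -[b](actsK _ sS) sbA actA // negN ?posA //.
exact: rootA.
Qed.

Lemma tauK s c l : s \in S -> valid c l -> l != inl s -> sig s (tau s l) = l.
Proof.
move=> sS; case: l => [t|b] /= => [tc ts|[bP b0 sb] _].
  by case: eqP => // ts'; rewrite ts' eqxx in ts.
by case: eqP => [->|_] /=; rewrite ?eqxx // actsK.
Qed.

Lemma valid_tau s c l : word (s :: c) -> valid (s :: c) l -> valid (rcons c s) (tau s l).
Proof.
move=> wc; have sS := word_headS wc; case: l => [t|b] /= => [|[bP b0 sb]].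
  by rewrite mem_rcons.
case: eqP => [_|bs] /=; first by rewrite mem_rcons mem_head.
split; [exact: root_act | | exact/supp_rot/supp_s].
by apply/negP => /(root_refl bP b0 sS).
Qed.

Lemma phi_tau s c l y : word (s :: c) -> valid (s :: c) l -> l != inl s ->
  supp (s :: c) y -> phi (rcons c s) (tau s l) y = phi (s :: c) l (act s y).
Proof.
move=> wc vl ls sy; rewrite -phi_sig // ?(tauK (word_headS wc) vl) //.
by apply/valid_rot/valid_tau.
Qed.

Section RunFacts.
Variables (c : seq W) (w : W) (wc : word c).

Lemma Run_root e : e \in Run c w -> Phi e.1.
Proof. by have [h _ _] := run_okP w wc => /h[]. Qed.

Lemma Run_supp e : e \in Run c w -> supp c e.1.
Proof. by have [h _ _] := run_okP w wc => /h[]. Qed.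

Lemma Run_pos e : e \in Run c w -> ~~ neg (act (w^-1)%g e.1).
Proof. by have [h _ _] := run_okP w wc => /h[]. Qed.

Lemma Run_valid e : e \in Run c w -> valid c e.2.
Proof. by have [h _ _] := run_okP w wc => /h[]. Qed.

Lemma Run_expand x : supp c x -> x = \sum_(e <- Run c w) phi c e.2 x *: e.1.
Proof. by have [_ h _] := run_okP w wc => /h. Qed.

Lemma Run_comp e e' : e \in Run c w -> e' \in Run c w -> comp c e.2 e'.2.
Proof. by have [_ _ h] := run_okP w wc; apply: h. Qed.

Lemma cone_neg w' b : (forall e, e \in Run c w -> ~~ neg (act (w'^-1)%g e.1)) ->
  Phi b -> supp c b -> (forall e, e \in Run c w -> phi c e.2 b <= 0) ->
  neg (act (w'^-1)%g b).
Proof.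
move=> h bP sb b0; apply: le0_neg; first exact: root_act.
move=> t tS; rewrite (Run_expand sb) linear_sum [co _ _]dot_sumr big_seq.
apply: sumr_le0 => e eR; rewrite linearZ dotZr mulr_le0_ge0 ?b0 //.
by move/posP: (h e eR); apply.
Qed.

End RunFacts.

Lemma Run_desc_label s c w e : word (s :: c) -> desc s w ->
  e \in Run (s :: c) w -> e.2 != inl s.
Proof.
move=> wc d; rewrite Run_desc ?(word_headS wc) // => /mapP[[d' [t|b]] _ ->] //=.
by case: (eqVneq t s).
Qed.

Lemma Run_desc_le0 s c w e : word (s :: c) -> desc s w ->
  e \in Run (s :: c) w -> phi (s :: c) e.2 (alpha s) <= 0.
Proof.
move=> wc d eR; apply: phi_headA => //; first exact: Run_valid eR.
exact: Run_desc_label eR.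
Qed.

Lemma Run_uniq c w : word c -> uniq [seq e.2 | e <- Run c w].
Proof.
move: c w; apply: run_ind => [w|s c w wc d IH|s c w wc d IH].
- by rewrite Run_nil.
- have sS := word_headS wc; have wr : word (rcons c s) by rewrite word_rot.
  rewrite Run_desc // -map_comp /= (map_comp (sig s) (fun e => e.2)) map_inj_in_uniq //.
  move=> _ _ /mapP[e eR ->] /mapP[e' e'R ->] /(congr1 (tau s)).
  by rewrite (sigK sS (Run_valid wr eR)) (sigK sS (Run_valid wr e'R)).
- rewrite Run_asc //= IH andbT; apply/negP => /mapP[e eR ee].
  have := Run_valid (word_tail wc) eR; rewrite -ee /=.
  by rewrite (negPf (word_head_notin wc)).
Qed.

Lemma Run_dual c w e e' : word c -> e \in Run c w -> e' \in Run c w ->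
  phi c e.2 e'.1 = (e.2 == e'.2)%:R.
Proof.
move=> wc; move: c w wc e e'; apply: run_ind => [w|s c w wc d IH|s c w wc d IH] e e'.
- by rewrite Run_nil.
- have sS := word_headS wc; have wr : word (rcons c s) by rewrite word_rot.
  rewrite Run_desc // => /mapP[f fR ->] /mapP[f' fR' ->] /=.
  have vf := Run_valid wr fR; have vf' := Run_valid wr fR'.
  have sf := Run_supp wr fR'.
  rewrite phi_sig //; [|exact/valid_rot|exact/supp_rot].
  rewrite IH //; suff -> : (sig s f.2 == sig s f'.2) = (f.2 == f'.2) by [].
  apply/eqP/eqP => [/(congr1 (tau s))|->//].
  by rewrite (sigK sS vf) (sigK sS vf').
- have wt := word_tail wc; have sS := word_headS wc; have sc := word_head_notin wc.
  rewrite Run_asc // !inE => /orP[/eqP ->|eR] /orP[/eqP ->|e'R] /=.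
  + by rewrite coA // !eqxx.
  + rewrite (Run_supp wt e'R) //; case: eqP => // ee.
    by have := Run_valid wt e'R; rewrite -ee /= (negPf sc).
  + have ve := Run_valid wt eR; rewrite phi_dropA //; case: eqP => // ee.
    by move: ve; rewrite ee /= (negPf sc).
  + by rewrite phi_drop ?IH //; exact: Run_valid eR.
Qed.

Lemma size_Run c w : word c -> size (Run c w) = size c.
Proof.
move: c w; apply: run_ind => [w|s c w wc d IH|s c w wc d IH].
- by rewrite Run_nil.
- by rewrite Run_desc ?(word_headS wc) // size_map IH size_rcons.
- by rewrite Run_asc //= IH.
Qed.

(** The hypothesis places the chamber of [w'] in the cone of [w]. Both recursions then branch alike:
    at a descent [alpha s] is a nonpositive combination of the normals, at an ascent it is one of
    them. *)
Lemma Run_cone c w w' : word c ->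
  (forall e, e \in Run c w -> ~~ neg (act (w'^-1)%g e.1)) ->
  Run c w' = Run c w /\ proj c w' = proj c w.
Proof.
move=> wc; move: c w wc w'; apply: run_ind => [w|s c w wc d IH|s c w wc d IH] w' h.
- by rewrite !Run_nil !proj_nil.
- have sS := word_headS wc; have d' : desc s w'.
    apply: (cone_neg wc h); [exact: rootA|exact: suppA|].
    by move=> e; apply: Run_desc_le0.
  case: (IH (s * w')%g) => [e eR|RE pE]; last by rewrite !Run_desc ?proj_desc // RE pE.
  have := h (act s e.1, sig s e.2); rewrite Run_desc // invMg actM (invs sS); apply.
  by apply/mapP; exists e.
- have d' : ~~ desc s w' by apply: (h (alpha s, inl s)); rewrite Run_asc // mem_head.
  case: (IH w') => [e eR|RE pE]; last by rewrite !Run_asc ?proj_asc // RE pE.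
  by apply: h; rewrite Run_asc // inE eR orbT.
Qed.

Lemma proj_fix c w t : word c -> t \in S -> t \notin c -> act (proj c w) (v t) = v t.
Proof.
move=> wc tS; move: c w wc; apply: run_ind => [w|s c w wc d IH|s c w wc d IH] tc.
- by rewrite proj_nil act1.
- have sS := word_headS wc; rewrite proj_desc // actM IH ?mem_rcons //.
  by rewrite act_sv //; move: tc; rewrite inE negb_or => /andP[].
- by rewrite proj_asc // IH //; move: tc; rewrite inE negb_or => /andP[].
Qed.

Lemma proj_co c w t x : word c -> t \in S -> t \notin c ->
  co t (act (proj c w)^-1%g x) = co t x.
Proof. by move=> wc tS tc; rewrite /co dot_actr invgK proj_fix. Qed.

Lemma proj_supp c w b : word c -> inversion (proj c w) b -> supp c b.
Proof.
move=> wc [bP b0 n] t tS tc; apply/eqP; rewrite eq_le.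
move/posP: b0 => -> //; rewrite andbT -(proj_co w b wc tS tc).
by apply: neg_le0 => //; apply: root_act.
Qed.

(** Through [cone_neg], an inversion of [proj c w] becomes an inversion of every element whose
    chamber lies in the cone. *)
Lemma proj_inv_le0 c w b e : word c -> inversion (proj c w) b -> e \in Run c w ->
  phi c e.2 b <= 0.
Proof.
move=> wc; move: c w wc b e; apply: run_ind => [w|s c w wc d IH|s c w wc d IH] b e.
- by rewrite Run_nil.
- have sS := word_headS wc; have wr : word (rcons c s) by rewrite word_rot.
  rewrite proj_desc // => ib.
  (* Otherwise [alpha s] would be an inversion of the shorter projection and, by the induction
     hypothesis, of [s * w], from which [s] has just been removed. *)
  have ds : ~~ desc s (proj (rcons c s) (s * w)%g).
    apply/negP => d'; have i' := inv_desc sS d'.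
    suff : desc s (s * w)%g by rewrite descs // d.
    apply: (cone_neg wr); [by move=> e'; exact: Run_pos|exact: rootA| |].
      exact: proj_supp i'.
    by move=> e' e'R; exact: IH.
  move=> eR; case: (inversion_s sS ds ib) => [->|i']; first exact: Run_desc_le0 eR.
  move: eR; rewrite Run_desc // => /mapP[f fR ->] /=; rewrite -[b](actsK _ sS).
  rewrite phi_sig //; first exact: IH.
    by apply/valid_rot; exact: Run_valid fR.
  by apply/supp_rot; exact: proj_supp i'.
- have wt := word_tail wc; rewrite proj_asc // Run_asc // inE => ib /orP[/eqP ->|eR] /=.
    by rewrite (proj_supp wt ib) ?(word_headS wc) ?(word_head_notin wc).
  by rewrite phi_drop ?IH //; exact: Run_valid eR.
Qed.

Lemma proj_sub c w b : word c -> inversion (proj c w) b -> inversion w b.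
Proof.
move=> wc ib; have [bP b0 _] := ib; split=> //.
apply: (cone_neg wc) bP _ _; [by move=> e; exact: Run_pos|exact: proj_supp ib|].
by move=> e; exact: proj_inv_le0.
Qed.

Lemma proj_ndesc s c w : s \in S -> word c -> ~~ desc s w -> ~~ desc s (proj c w).
Proof.
by move=> sS wc; apply: contra => d; have [] := proj_sub wc (inv_desc sS d).
Qed.

Lemma proj_pos c w e : word c -> e \in Run c w -> ~~ neg (act (proj c w)^-1%g e.1).
Proof.
move=> wc; move: c w wc e; apply: run_ind => [w|s c w wc d IH|s c w wc d IH] e.
- by rewrite Run_nil.
- have sS := word_headS wc; rewrite Run_desc // proj_desc // => /mapP[f fR ->] /=.
  by rewrite invMg actM (invs sS) actsK // IH.
- have sS := word_headS wc; rewrite Run_asc // proj_asc // inE => /orP[/eqP ->|/IH//] /=.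
  apply: (@pos_co_gt0 _ s) => //; first exact/root_act/rootA.
  by rewrite proj_co ?(word_tail wc) ?(word_head_notin wc) // coA // eqxx.
Qed.

Lemma Run_proj c w : word c -> Run c (proj c w) = Run c w.
Proof. by move=> wc; have [] := Run_cone wc (fun e => @proj_pos c w e wc). Qed.

Lemma proj_proj c w : word c -> proj c (proj c w) = proj c w.
Proof. by move=> wc; have [] := Run_cone wc (fun e => @proj_pos c w e wc). Qed.

Definition eta c x y := euler c x y - euler c y x.

Lemma dotA_pos_le0 c s b : word (s :: c) -> ~~ neg b -> supp c b -> dot (alpha s) b <= 0.
Proof.
move=> wc b0 sb; rewrite (supp_dot _ (word_tail wc) sb) big_seq.
apply: sumr_le0 => t tc; have tS := wordS (word_tail wc) tc.
rewrite mulr_ge0_le0 ?dotA_le0 ?(word_headS wc) //; first by move/posP: b0; apply.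
by rewrite eq_sym (word_neq wc tc).
Qed.

(** When the normal [alpha s] is created, its [eta] with an inversion [b] equals their scalar
    product, which is nonpositive because [b] does not involve [s]. The hypothesis then forces
    orthogonality to all inversions, so the projection fixes [alpha s]. The other steps of the
    recursion preserve [eta]. *)
Lemma proj_simple c w e : word c -> e \in Run c w ->
  (forall b, inversion (proj c w) b -> 0 <= eta c e.1 b) ->
  exists2 r, r \in S & act (proj c w)^-1%g e.1 = alpha r.
Proof.
move=> wc; move: c w wc e; apply: run_ind => [w|s c w wc d IH|s c w wc d IH] e.
- by rewrite Run_nil.
- have sS := word_headS wc; have wr : word (rcons c s) by rewrite word_rot.
  have ds : ~~ desc s (proj (rcons c s) (s * w)%g).
    by rewrite proj_ndesc // descs // negbK.
  rewrite Run_desc // proj_desc // => /mapP[f fR ->] /= h.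
  rewrite invMg actM (invs sS) actsK //; apply: IH => // b ib.
  have := h _ (inversion_up sS ds ib); have sb := proj_supp wr ib.
  have sf := Run_supp wr fR.
  by rewrite /eta !euler_shift //; exact/supp_rot.
- have sS := word_headS wc; have wt := word_tail wc; have sc := word_head_notin wc.
  rewrite Run_asc // proj_asc // inE => /orP[/eqP -> /=|eR] h.
    exists s => //; apply: act_fix => b ib; have [bP b0 _] := ib.
    have sb := proj_supp wt ib; apply/eqP; rewrite eq_le (dotA_pos_le0 wc) //=.
    have := h b ib; rewrite /eta (@euler_headA _ _ b) // (sb s) // !mul0r subr0.
    rewrite euler_cons (sb s) // coA // eqxx mul1r !mul0r add0r.
    rewrite -(supp_dot _ wt sb) euler0l ?addr0 // => t tc.
    by rewrite coA ?(negPf (word_neq wc tc)) // (wordS wt tc).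
  apply: IH => // b ib; have := h b ib; have sb := proj_supp wt ib.
  have se := Run_supp wt eR.
  by rewrite /eta !euler_cons (sb s) // (se s) // !mul0r !add0r.
Qed.

(** A normal turns negative only under a letter [s] whose simple root it is. As [s] is last in
    [rcons c s], [eta] of [alpha s] with a positive root is minus a sum of nonpositive terms, so
    [proj_simple] applies. *)
Lemma proj_lower c w e : word c -> e \in Run c w -> neg e.1 ->
  exists2 r, r \in S & act (proj c w)^-1%g e.1 = alpha r.
Proof.
move=> wc; move: c w wc e; apply: run_ind => [w|s c w wc d IH|s c w wc d IH] e.
- by rewrite Run_nil.
- have sS := word_headS wc; have wr : word (rcons c s) by rewrite word_rot.
  rewrite Run_desc // proj_desc // => /mapP[f fR ->] /= n.
  rewrite invMg actM (invs sS) actsK //.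
  case: (boolP (neg f.1)) => [|pf]; first exact: IH.
  have fE := root_refl (Run_root wr fR) pf sS n.
  apply: proj_simple => // b ib; have [_ b0 _] := ib; rewrite fE /eta !euler_rcons.
  have nA t : t \in c -> co t (alpha s) = 0.
    move=> tc; rewrite coA ?(negPf (word_neq wc tc)) //.
    exact: wordS (word_tail wc) tc.
  rewrite (@euler0l c (alpha s) b) // (@euler0r c b (alpha s)) //.
  have -> : \sum_(q <- c) co q (alpha s) * dot (alpha q) (alpha s) = 0.
    by rewrite big1_seq // => t /andP[_ tc]; rewrite nA ?mul0r.
  rewrite coA // eqxx /= subr_ge0 !add0r !mul0r add0r !mul1r !mulr1 gerDr.
  rewrite big_seq; apply: sumr_le0 => t tc; have tS := wordS (word_tail wc) tc.
  rewrite mulr_ge0_le0 ?dotA_le0 ?(word_neq wc tc) //.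
  by move/posP: b0; apply.
- rewrite Run_asc // proj_asc // inE => /orP[/eqP ->|eR]; last exact: IH.
  by rewrite /= (negPf (posA (word_headS wc))).
Qed.

(** * Labels along the rotations of the Coxeter element *)

Lemma coxeter_word_word c : coxeter_word S c -> word c.
Proof. by case=> uc cS; rewrite /word uc; apply/allP => s; rewrite cS. Qed.

Lemma coxeter_word_supp c x : coxeter_word S c -> supp c x.
Proof. by case=> _ cS t tS; rewrite cS tS. Qed.

Lemma coxeter_word_rot s c : coxeter_word S (s :: c) -> coxeter_word S (rcons c s).
Proof.
case=> uc cS; split; first by rewrite rcons_uniq.
by move=> t; rewrite mem_rcons cS.
Qed.

(* [life K c l]: the ray [l] becomes the initial weight within [K] rotations of [c]. *)
Fixpoint life K (c : seq W) (l : label) : bool :=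
  if K is K'.+1 then
    if c is s :: c' then (l == inl s) || life K' (rcons c' s) (tau s l) else false
  else false.

Lemma life_le K K' c l : (K <= K')%N -> life K c l -> life K' c l.
Proof.
elim: K K' c l => // K IH [//|K'] [//|s c] l KK' /= /orP[->//|h].
by rewrite (IH K') ?orbT.
Qed.

Lemma life_inl c t : t \in c -> exists K, life K c (inl t).
Proof.
have [n] := ubnP (index t c); elim: n c => // n IH [//|s c] /=.
case: (eqVneq s t) => [->|st]; first by exists 1%N; rewrite /= eqxx.
rewrite ltnS inE eq_sym (negPf st) /= => it tc.
case: (IH (rcons c s)) => [||K lK].
- by rewrite -cats1 index_cat tc.
- by rewrite mem_rcons inE tc orbT.
- by exists K.+1; rewrite /= lK orbT.
Qed.

Lemma life_step s c b : word (s :: c) -> Phi b -> ~~ neg b ->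
  (forall K, ~~ life K (s :: c) (inr b)) ->
  ~~ neg (act s b) /\ forall K, ~~ life K (rcons c s) (inr (act s b)).
Proof.
move=> wc bP b0 dead; have bs : b == alpha s = false.
  apply/negP => bs; have [|K lK] := @life_inl (rcons c s) s.
    by rewrite mem_rcons mem_head.
  by have := dead K.+1; rewrite /= bs lK.
split=> [|K]; last by have := dead K.+1; rewrite /= bs.
by apply/negP => /(root_refl bP b0 (word_headS wc))/eqP; rewrite bs.
Qed.

Lemma life_rot c1 c2 b : word (c1 ++ c2) -> Phi b -> ~~ neg b ->
  (forall K, ~~ life K (c1 ++ c2) (inr b)) ->
  ~~ neg (act (\prod_(s <- c1) s)^-1%g b) /\
  forall K, ~~ life K (c2 ++ c1) (inr (act (\prod_(s <- c1) s)^-1%g b)).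
Proof.
elim: c1 c2 b => [|s c1 IH] c2 b /= wc bP b0 dead.
  by rewrite big_nil invg1 act1 cats0.
have [p dead'] := life_step wc bP b0 dead.
rewrite rcons_cat in dead'; rewrite big_cons invMg actM (invs (word_headS wc)).
rewrite -cat_rcons; apply: IH => //; last exact: root_act.
by rewrite -rcons_cat word_rot.
Qed.

(** The coordinate at the first letter is changed by that letter only, so this letter fixes [z] by
    itself; the others follow in turn. *)
Lemma coxeter_elt_fix c z : word c -> act (\prod_(s <- c) s)^-1%g z = z ->
  forall s, s \in c -> act s z = z.
Proof.
elim: c z => // s c IH z wc; have sS := word_headS wc.
rewrite big_cons invMg actM (invs sS) => zE.
have P l x t : word l -> t \in S -> t \notin l ->
    co t (act (\prod_(s <- l) s)^-1%g x) = co t x.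
  elim: l x => [|q l IHl] x wl tS; first by rewrite big_nil invg1 act1.
  rewrite inE negb_or => /andP[tq tl]; have qS := word_headS wl.
  by rewrite big_cons invMg actM (invs qS) IHl ?(word_tail wl) // co_s.
have sz : act s z = z.
  apply: co_inj => t tS; case: (eqVneq t s) => [->|ts]; last by rewrite co_s.
  by rewrite -[in RHS]zE P ?(word_tail wc) // (word_head_notin wc).
rewrite sz in zE => t; rewrite inE => /orP[/eqP ->//|].
by apply: IH => //; exact: word_tail wc.
Qed.

(* A positive root that never becomes simple along the rotations of [c] would stay
   positive under all powers of the Coxeter element, which fixes no vector. *)
Lemma life_ex c l : coxeter_word S c -> valid c l -> exists K, life K c l.
Proof.
move=> cc; have wc := coxeter_word_word cc; case: l => [t|b] /= => [|[bP b0 _]].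
  exact: life_inl.
apply: contrapT => /forallNP dead.
have {}dead K : ~~ life K c (inr b) by apply/negP; apply: dead.
pose g := (\prod_(s <- c) s)^-1%g.
have it i : ~~ neg (act (g ^+ i)%g b) /\ forall K, ~~ life K c (inr (act (g ^+ i)%g b)).
  elim: i => [|i [p d]]; first by rewrite expg0 act1.
  have := @life_rot c [::] _ _ (root_act (g ^+ i)%g bP) p; rewrite cats0 expgS actM.
  by apply.
pose z := \sum_(i < #[g]%g) act (g ^+ i)%g b.
have gz : act g z = z.
  rewrite /z linear_sum /=; have := order_gt0 g; case E : #[g]%g => [//|n] _.
  rewrite big_ord_recr big_ord_recl /= addrC -actM -expgS -E expg_order expg0.
  by congr (_ + _); apply: eq_bigr => i _; rewrite -actM -expgS.
have z0 : z = 0.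
  apply: (act_essential hact); apply: gen_ind => [|s w sS IH]; first exact: act1.
  rewrite actM IH; apply: (coxeter_elt_fix wc gz).
  by case: cc => _ ->.
have [t tS tb] := pos_ex bP b0.
have : 0 < co t z.
  rewrite /z [co _ _]dot_sumr; have := order_gt0 g; case: #[g]%g => [//|n] _.
  rewrite big_ord_recl /= expg0 act1 ltr_wpDr // sumr_ge0 // => i _.
  by have [/posP p _] := it i.+1; apply: p.
by rewrite z0 [co _ _]dot0r ltxx.
Qed.

(** * Uniqueness of compatible expansions *)

Lemma comp_tau s c l l' : word (s :: c) -> valid (s :: c) l -> valid (s :: c) l' ->
  l != inl s -> l' != inl s -> comp (s :: c) l l' -> comp (s :: c) l' l ->
  comp (rcons c s) (tau s l) (tau s l').
Proof.
move=> wc; have sS := word_headS wc.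
(* Compatibility with the root [alpha s] becomes compatibility with the weight of [s]: the sign of
   [euler] bounds the coordinate of [act s b'] at [s] from above, positivity of that root from
   below. *)
have H b b' : b = alpha s -> Phi b' -> ~~ neg b' -> supp (s :: c) b' -> b' <> alpha s ->
    0 <= euler (s :: c) b b' -> co s (act s b') = 0.
  move=> -> bP b0 sb bs; rewrite -[b' in euler _ _ b'](actsK _ sS).
  rewrite euler_headAl ?oppr_ge0 //; last exact: supp_s.
  rewrite -mulrA pmulr_lle0 ?divr_gt0 ?nrmA // => h; apply/eqP; rewrite eq_le h /=.
  suff /posP : ~~ neg (act s b') by apply.
  by apply/negP => /(root_refl bP b0 sS).
case: l l' => [t|b] [t'|b'] //=.
- move=> tc [bP b0 sb] ts _ tb _; case: eqP => //= _.
  rewrite co_s ?(wordS wc tc) //.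
- move=> [bP b0 sb] tc _ ts tb _; case: eqP => //= _.
  rewrite co_s ?(wordS wc tc) //.
- move=> [bP b0 sb] [bP' b0' sb'] _ _ E E'.
  case: eqP => bs; case: eqP => bs' //=.
  + by rewrite (H b b').
  + by rewrite (H b' b).
  by rewrite -euler_shift ?actsK //; exact: supp_s.
Qed.

(** The bound [K] on the lives of the labels is the fuel for peeling them off. *)
Definition family K c (X : seq (R * label)) :=
  (forall e, e \in X -> [/\ 0 <= e.1, valid c e.2 & life K c e.2]) /\
  (forall e e', e \in X -> e' \in X -> comp c e.2 e'.2).

(* The coefficient of the initial weight is read off by pairing with the initial
   simple root, on which all the other compatible labels vanish. *)
Lemma family_head K s c X : word (s :: c) -> family K (s :: c) X ->
  \sum_(e <- X | e.2 == inl s) e.1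
  = Num.max 0 (\sum_(e <- X) e.1 * phi (s :: c) e.2 (alpha s)).
Proof.
move=> wc [hX cX]; have sS := word_headS wc.
rewrite [in RHS](bigID (fun e => e.2 == inl s)) /=.
rewrite [X in Num.max 0 (X + _)](eq_bigr (fun e => e.1)); last first.
  by move=> e /eqP ->; rewrite /= coA // eqxx mulr1.
case: (boolP (has (fun e => e.2 == inl s) X)) => [/hasP[e0 e0X /eqP e0s]|].
  rewrite [X in _ + X]big1_seq ?addr0 => [|e /andP[es eX]]; last first.
    have [_ ve _] := hX e eX; have := cX _ _ e0X eX; rewrite e0s.
    case: e.2 ve es => [t|b] /= => [tc ts _|_ _ /eqP b0].
      rewrite coA ?(wordS wc tc) //; case: eqP => [E|_]; last by rewrite mulr0.
      by rewrite E eqxx in ts.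
    by rewrite euler_headA // b0 !mul0r !mulr0.
  rewrite max_r // big_seq_cond sumr_ge0 // => e /andP[/hX[]//].
move/hasPn => nX; have -> : \sum_(e <- X | e.2 == inl s) e.1 = 0.
  by rewrite big1_seq // => e /andP[es /nX]; rewrite es.
rewrite add0r max_l // big_seq_cond sumr_le0 // => e /andP[eX es].
have [e0 ve _] := hX e eX.
by rewrite mulr_ge0_le0 // phi_headA.
Qed.

(** As [h] is arbitrary, the two combinations agree formally, label by label, and not only as linear
    forms. *)
Lemma family_unique K c X Y (h : label -> R) : coxeter_word S c ->
  family K c X -> family K c Y ->
  (forall y, \sum_(e <- X) e.1 * phi c e.2 y = \sum_(e <- Y) e.1 * phi c e.2 y) ->
  \sum_(e <- X) e.1 * h e.2 = \sum_(e <- Y) e.1 * h e.2.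
Proof.
elim: K c X Y h => [|K IH] c X Y h cc fX fY E.
  have nil Z : family 0 c Z -> Z = [::].
    by case: Z => // e Z [/(_ e (mem_head _ _))[]].
  by rewrite (nil _ fX) (nil _ fY).
case: c cc fX fY E => [|s c] cc fX fY E.
  have nil Z : family K.+1 [::] Z -> Z = [::].
    by case: Z => // e Z [/(_ e (mem_head _ _))[]].
  by rewrite (nil _ fX) (nil _ fY).
have wc := coxeter_word_word cc; have sS := word_headS wc.
have hd : \sum_(e <- X | e.2 == inl s) e.1 = \sum_(e <- Y | e.2 == inl s) e.1.
  by rewrite (family_head wc fX) (family_head wc fY) E.
have split f (Z : seq (R * label)) : \sum_(e <- Z) e.1 * f e.2 =
    (\sum_(e <- Z | e.2 == inl s) e.1) * f (inl s) +
    \sum_(e <- Z | e.2 != inl s) e.1 * f e.2.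
  rewrite (bigID (fun e => e.2 == inl s)) /= mulr_suml; congr (_ + _).
  by apply: eq_bigr => e /eqP ->.
pose T Z := [seq (e.1, tau s e.2) | e <- Z & e.2 != inl s] : seq (R * label).
have fT Z : family K.+1 (s :: c) Z -> family K (rcons c s) (T Z).
  move=> [h1 h2]; split.
    move=> _ /mapP[e + ->] /=; rewrite mem_filter => /andP[es eZ].
    have [e0 ve /=] := h1 e eZ; rewrite (negPf es) /= => le; split=> //.
    exact: valid_tau.
  move=> _ _ /mapP[e + ->] /mapP[e' + ->] /=.
  rewrite !mem_filter => /andP[es eZ] /andP[es' eZ'].
  have [_ ve _] := h1 e eZ; have [_ ve' _] := h1 e' eZ'.
  by apply: comp_tau; rewrite ?h2.
have hT Z f g : family K.+1 (s :: c) Z ->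
    (forall l, valid (s :: c) l -> l != inl s -> f l = g (tau s l)) ->
    \sum_(e <- Z | e.2 != inl s) e.1 * f e.2 = \sum_(e <- T Z) e.1 * g e.2.
  move=> [h1 _] fg; rewrite /T big_map big_filter /= big_seq_cond [RHS]big_seq_cond.
  by apply: eq_bigr => e /andP[eZ es]; have [_ ve _] := h1 e eZ; rewrite fg.
rewrite !split hd; congr (_ + _).
have htau l : valid (s :: c) l -> l != inl s -> h l = (h \o sig s) (tau s l).
  by move=> vl ls; rewrite /= (tauK sS vl ls).
rewrite (hT X h (h \o sig s)) // (hT Y h (h \o sig s)) //.
apply: (IH (rcons c s)); [exact: coxeter_word_rot|exact: fT|exact: fT|] => y.
have ptau l : valid (s :: c) l -> l != inl s ->
    phi (s :: c) l (act s y) = (phi (rcons c s))^~ y (tau s l).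
  move=> vl ls; rewrite phi_tau //.
  exact: coxeter_word_supp.
have := E (act s y); rewrite !(split (fun l => phi (s :: c) l (act s y))) hd.
move/addrI => E'.
have hX := hT X _ (fun l => phi (rcons c s) l y) fX ptau.
have hY := hT Y _ (fun l => phi (rcons c s) l y) fY ptau.
by rewrite /= in hX hY E'; rewrite -hX -hY.
Qed.

Lemma Run_life c w : coxeter_word S c ->
  exists K, forall e, e \in Run c w -> life K c e.2.
Proof.
move=> cc; have : forall e, e \in Run c w -> exists K, life K c e.2.
  by move=> e eR; apply: life_ex (Run_valid (coxeter_word_word cc) eR).
elim: (Run c w) => [_|e L IH hL]; first by exists 0%N.
case: IH => [e' e'L|K hK]; first by apply: hL; rewrite inE e'L orbT.
have [K' hK'] := hL e (mem_head _ _); exists (maxn K K') => e'.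
rewrite inE => /orP[/eqP ->|/hK h'].
  by apply: life_le hK'; rewrite leq_maxr.
by apply: life_le h'; rewrite leq_maxl.
Qed.

(** With an indicator as [h] this compares the labels of two cones that meet in [p]; with heights it
    says that [p] takes the same value at the vertices attached to them. *)
Lemma fan_unique c w w' p (h : label -> R) : coxeter_word S c ->
  (forall e, e \in Run c w -> 0 <= dot p e.1) ->
  (forall e, e \in Run c w' -> 0 <= dot p e.1) ->
  \sum_(e <- Run c w) dot p e.1 * h e.2 = \sum_(e <- Run c w') dot p e.1 * h e.2.
Proof.
move=> cc hp hp'; have wc := coxeter_word_word cc.
pose X u := [seq (dot p e.1, e.2) | e <- Run c u] : seq (R * label).
have [K1 h1] := Run_life w cc; have [K2 h2] := Run_life w' cc.
have fX u K' : (K' <= maxn K1 K2)%N -> (forall e, e \in Run c u -> life K' c e.2) ->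
    (forall e, e \in Run c u -> 0 <= dot p e.1) -> family (maxn K1 K2) c (X u).
  move=> KK hl h0; split.
    move=> _ /mapP[e eR ->] /=; split; [exact: h0|exact: Run_valid eR|].
    by apply: life_le KK _; apply: hl.
  by move=> _ _ /mapP[e eR ->] /mapP[e' eR' ->] /=; exact: Run_comp eR eR'.
have XE u f : \sum_(e <- X u) e.1 * f e.2 = \sum_(e <- Run c u) dot p e.1 * f e.2.
  by rewrite big_map.
rewrite -!XE; apply: (@family_unique (maxn K1 K2) c) => //.
- by apply: (fX w K1) => //; rewrite leq_maxl.
- by apply: (fX w' K2) => //; rewrite leq_maxr.
move=> y; rewrite !(XE _ (fun l => phi c l y)).
have D u : dot p y = \sum_(e <- Run c u) dot p e.1 * phi c e.2 y.
  rewrite [y in LHS](Run_expand u wc); last exact: coxeter_word_supp.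
  by rewrite dot_sumr; apply: eq_bigr => e _; rewrite dotZr mulrC.
by rewrite -(D w) -(D w').
Qed.

Lemma cone_label c w w' p e : coxeter_word S c ->
  (forall e, e \in Run c w -> 0 <= dot p e.1) ->
  (forall e, e \in Run c w' -> 0 <= dot p e.1) ->
  e \in Run c w -> 0 < dot p e.1 -> e.2 \in [seq f.2 | f <- Run c w'].
Proof.
move=> cc hp hp' eR pe; apply/negPn/negP => nl.
have := fan_unique (fun l => (l == e.2)%:R) cc hp hp'.
rewrite [RHS]big1_seq => [|f /andP[_ fR]]; last first.
  case: eqP => [fe|_]; last by rewrite mulr0.
  by case/negP: nl; apply/mapP; exists f.
apply/eqP; rewrite gt_eqF // (big_rem e) //= eqxx mulr1 ltr_wpDr //.
by rewrite big_seq sumr_ge0 // => f /mem_rem fR; rewrite mulr_ge0 ?hp.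
Qed.

(** * The projection preserves the weak order *)

Lemma Run_eq c w e e' : word c -> e \in Run c w -> e' \in Run c w ->
  e.2 = e'.2 -> e = e'.
Proof. by move=> /(Run_uniq w) u eR e'R; exact: uniq_map_eq u eR e'R. Qed.

Lemma act_rA w r : r \in S -> act (w * r)%g (alpha r) = - act w (alpha r).
Proof. by move=> rS; rewrite actM actA // linearN. Qed.

Lemma len_ascr w r : r \in S -> ~~ neg (act w (alpha r)) -> len (w * r)%g = (len w).+1.
Proof.
move=> rS p; apply/eqP; rewrite eqn_leq; apply/andP; split.
  by rewrite (leq_trans (len_mul _ _)) // -addn1 leq_add2l len_s.
have : neg (act (w * r)%g (alpha r)).
  by rewrite act_rA // negN //; exact/root_act/rootA.
by rewrite neg_act_len // -mulgA mulss // mulg1.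
Qed.

(** Only the crossing of a wall [beta] of the cone of [w] matters. On the other side [- beta] is a
    lower wall, hence a wall of the chamber of the new projection; an inversion lost in the crossing
    would have to equal [- beta], a negative root. *)
Lemma proj_cover c w r b : coxeter_word S c -> r \in S -> ~~ neg (act w (alpha r)) ->
  inversion (proj c w) b -> inversion (proj c (w * r)%g) b.
Proof.
move=> cc rS pr ib; have wc := coxeter_word_word cc.
pose beta := act w (alpha r); have betaP : Phi beta by exact/root_act/rootA.
have rinv x : act (w * r)^-1%g x = act r (act (w^-1)%g x) by rewrite invMg actM (invs rS).
case: (boolP (all (fun e => ~~ neg (act (w * r)^-1%g e.1)) (Run c w))) => [/allP h|].
  by have [_ ->] := Run_cone wc h.
case/allPn => e0 e0R /negPn n0.
have e0E : e0.1 = beta.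
  rewrite -[e0.1](actKV w); congr (act w _); apply: root_refl rS _.
  - exact: root_act (Run_root wc e0R).
  - exact: Run_pos e0R.
  - by rewrite -rinv.
have [e1 e1R e1E] : exists2 e1, e1 \in Run c (w * r)%g & e1.1 = - beta.
  case: (boolP (all (fun e => ~~ neg (act (w^-1)%g e.1)) (Run c (w * r)%g))).
    move/allP => h; have [RE _] := Run_cone wc h; rewrite RE in e0R.
    have := Run_pos wc e0R; rewrite rinv e0E actK actA //.
    by rewrite negN ?posA //; exact: rootA.
  case/allPn => e1 e1R /negPn n1; exists e1 => //.
  have p1 := Run_pos wc e1R; have P1 := root_act (w * r)^-1%g (Run_root wc e1R).
  have E : act (w * r)^-1%g e1.1 = alpha r.
    by apply: root_refl => //; rewrite rinv actsK.
  by rewrite -[e1.1](actKV (w * r)%g) E act_rA.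
(* [p] lies in the relative interior of the common wall of the chambers of [w] and [w * r]; it
   serves to compare the rays of the two cones. *)
pose q := \sum_(t in S | t != r) v t; pose p := act w q.
have qr : act r q = q.
  by rewrite /q linear_sum /=; apply: eq_bigr => t /andP[tS tr]; rewrite act_sv.
have pE u d : p = act u q -> dot p d = \sum_(t in S | t != r) co t (act (u^-1)%g d).
  by move=> ->; rewrite dot_actl /q dot_suml.
have pE' : p = act (w * r)%g q by rewrite actM qr.
have p0 u d : p = act u q -> ~~ neg (act (u^-1)%g d) -> 0 <= dot p d.
  by move=> /pE -> /posP h; apply: sumr_ge0 => t /andP[tS _]; apply: h.
have lab e : e \in Run c (w * r)%g -> e.2 != e1.2 ->
    e.2 \in [seq f.2 | f <- Run c w].
  move=> eR ne; apply: (@cone_label c (w * r)%g w p) => //.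
  - by move=> f fR; apply: (p0 (w * r)%g) => //; exact: Run_pos fR.
  - by move=> f fR; apply: (p0 w) => //; exact: Run_pos fR.
  have pos := Run_pos wc eR; rewrite lt_neqAle (p0 (w * r)%g) // andbT eq_sym.
  apply: contraNneq ne; rewrite (pE (w * r)%g) // => E0.
  have E : act (w * r)^-1%g e.1 = alpha r.
    apply: pos_simple => //; first exact: root_act (Run_root wc eR).
    move=> t tS tr; have /posP h := pos; apply/eqP; move/eqP: E0.
    rewrite psumr_eq0 => [/allP/(_ t)|s /andP[sS _]]; last exact: h.
    by rewrite mem_index_enum tS tr => /(_ isT).
  have ee : e.1 = e1.1 by rewrite e1E -[e.1](actKV (w * r)%g) E act_rA.
  have := Run_dual wc eR e1R; rewrite -ee (Run_dual wc eR eR) eqxx.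
  by case: eqP => // _ /eqP; rewrite oner_eq0.
have n1 : neg e1.1 by rewrite e1E negN.
have [s sS sE] := proj_lower wc e1R n1.
have [bP b0 _] := ib; split=> //; set u := proj c (w * r)%g in sE *.
case: (boolP (neg (act (u^-1)%g b))) => // pos; have sb : supp c b by exact: coxeter_word_supp.
(* On the rays shared with the old cone [b] is nonpositive, so the only normal that can contribute
   positively is [- beta]. *)
have uE : act (u^-1)%g b = alpha s.
  apply: pos_simple => //; first exact: root_act.
  move=> t tS ts; apply/eqP; rewrite eq_le; have /posP -> // := pos; rewrite andbT.
  rewrite (Run_expand (w * r)%g wc sb) linear_sum [co _ _]dot_sumr big_seq.
  apply: sumr_le0 => e eR; rewrite linearZ dotZr /=.
  case: (eqVneq e.2 e1.2) => [/(Run_eq wc eR e1R) ->|/(lab e eR)/mapP[f fR ->]].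
    by rewrite sE hv // (negPf ts) mulr0.
  rewrite mulr_le0_ge0 ?(proj_inv_le0 wc ib fR) //.
  by have /posP := proj_pos wc eR; apply.
have : b = e1.1 by rewrite -[b](actKV u) uE -sE actKV.
by move=> be; move: b0; rewrite be n1.
Qed.

Lemma proj_mono c u w b : coxeter_word S c -> weak_le S u w ->
  inversion (proj c u) b -> inversion (proj c w) b.
Proof.
move=> cc [w' -> lw] iu; move: w' lw; apply: weyl_ind_last.
  by rewrite mulg1.
move=> r w' rS p IH; rewrite mulgA (len_ascr rS p) => lw.
have l1 := len_mul u w'.
have pr : ~~ neg (act (u * w')%g (alpha r)) by rewrite neg_act_len // -leqNgt lw addnS ltnW // ltnS.
apply: proj_cover => //; apply: IH; apply/eqP; rewrite -eqSS -addnS -lw.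
by rewrite (len_ascr rS pr).
Qed.

Lemma sortable_le_proj c u w : coxeter_word S c -> proj c u = u -> weak_le S u w ->
  weak_le S u (proj c w).
Proof.
move=> cc uE uw; apply/weak_inversion => b; rewrite -{1}uE.
exact: proj_mono.
Qed.

Lemma proj_le c w : word c -> weak_le S (proj c w) w.
Proof. by move=> wc; apply/weak_inversion => b; exact: proj_sub. Qed.

Lemma weak_le_antisym u w : weak_le S u w -> weak_le S w u -> u = w.
Proof.
move=> [w' -> lw] [u' uE lu]; have w'0 : len w' = 0%N.
  move: lu; rewrite lw -addnA => /eqP.
  by rewrite -[X in X == _]addn0 eqn_add2l eq_sym addn_eq0 => /andP[/eqP].
by rewrite (len_eq0 w'0) mulg1.
Qed.

(** * Sorting words *)

Lemma letter_in c k : word c -> (0 < size c)%N -> letter c k \in S.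
Proof. by move=> wc n0; apply: (wordS wc); rewrite mem_nth // ltn_mod. Qed.

(** A letter recurs after exactly [size c] positions, so nested factors mean a set of positions
    closed under shifting back by one copy of [c]. *)
Lemma nestedE c p : word c ->
  (forall i, c_factor c p i.+1 \subset c_factor c p i) <->
  (forall k, k \in p -> (size c <= k)%N -> (k - size c)%N \in p).
Proof.
(* For the empty word, division by 0 puts every position into factor 0, and both sides hold. *)
case/andP=> uc _; have [n0|n0] := posnP (size c).
  rewrite n0; split=> [_ k|_ i]; first by rewrite subn0.
  by apply/fintype.subsetP => s; rewrite !inE => /hasP[k _]; rewrite n0 divn0.
have facP i s : (s \in c_factor c p i) = has (fun k => (k %/ size c == i)%N && (letter c k == s)) p.
  by rewrite inE.
split=> [h k kp nk|h i].
  have kE : (k = (k - size c) + size c)%N by rewrite subnK.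
  have := fintype.subsetP (h ((k - size c) %/ size c)%N) (letter c k); rewrite !facP.
  move=> H; have /H/hasP[j jp /andP[/eqP jk /eqP lj]] :
      has (fun j => (j %/ size c == ((k - size c) %/ size c).+1)%N && (letter c j == letter c k)) p.
    apply/hasP; exists k => //; rewrite eqxx andbT.
    by rewrite {1}kE divnDr ?dvdnn // divnn n0 addn1.
  suff -> : (k - size c = j)%N by [].
  rewrite (divn_eq j (size c)) (divn_eq (k - size c) (size c)) jk; congr (_ + _)%N.
  apply/eqP; rewrite -(nth_uniq 1%g _ _ uc) ?ltn_mod //; apply/eqP.
  by rewrite -[RHS]/(letter c j) lj /letter {2}kE modnDr.
apply/fintype.subsetP => s; rewrite !facP => /hasP[k kp /andP[/eqP ki /eqP ks]].
have nk : (size c <= k)%N by rewrite leqNgt; apply/negP => /divn_small; rewrite ki.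
have kE : (k = (k - size c) + size c)%N by rewrite subnK.
apply/hasP; exists (k - size c)%N; first exact: h.
rewrite -ks /letter {3}kE modnDr eqxx andbT.
by move: ki; rewrite {1}kE divnDr ?dvdnn // divnn n0 addn1 => -[->].
Qed.

Lemma letter_rot (s : W) c k : letter (s :: c) k.+1 = letter (rcons c s) k.
Proof.
rewrite /letter size_rcons /= modnS.
have := ltn_pmod k (ltn0Sn (size c)); set r := (k %% _)%N => rn.
have kE : (k.+1 = k %/ (size c).+1 * (size c).+1 + r.+1)%N.
  by rewrite addnS -divn_eq.
rewrite {1}kE dvdn_addr ?dvdn_mull // nth_rcons.
case: (eqVneq r (size c)) => [->|rc]; first by rewrite dvdnn ltnn.
have rc' : (r < size c)%N by rewrite ltn_neqAle rc -ltnS.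
by rewrite gtnNdvd // rc'.
Qed.

Lemma lexi_map (f : nat -> nat) (p q : seq nat) :
  (forall x y, (f x <= f y)%N = (x <= y)%N) ->
  ((map f p : seqlexi nat) <= (map f q : seqlexi nat))%O =
  ((p : seqlexi nat) <= (q : seqlexi nat))%O.
Proof.
move=> fm; elim: p q => [|x p IH] [|y q] //=.
by rewrite !lexi_cons !leEnat !fm IH.
Qed.

Lemma path0_succ p : path ltn 0 p -> p = map succn (map predn p).
Proof.
rewrite (path_sortedE ltn_trans) => /andP[/allP h _]; rewrite -map_comp.
by symmetry; apply: map_id_in => k /h; case: k.
Qed.

Lemma path0_map p : path ltn 0 (map succn p) = sorted ltn p.
Proof.
rewrite (path_sortedE ltn_trans) sorted_map; apply: andb_idl => _.
by apply/allP => _ /mapP[k _ ->].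
Qed.

Lemma reduced_head t l : all (mem S) (t :: l) ->
  size (t :: l) = len (\prod_(x <- t :: l) x)%g -> desc t (\prod_(x <- t :: l) x)%g.
Proof.
move=> /= /andP[tS lS] E; rewrite desc_len // -E big_cons mulsK // ltnS.
exact: len_le.
Qed.

Lemma reduced_notin s l : s \in S -> all (mem S) l ->
  size l = len (\prod_(x <- l) x)%g -> act (\prod_(x <- l) x)%g (v s) = v s ->
  s \notin l.
Proof.
move=> sS; elim: l => // t l IH lS E fx; have d := reduced_head lS E.
case/andP: lS => tS lS; rewrite inE negb_or; case: (eqVneq s t) => [st|st] /=.
  subst t; have := neg_le0 (root_act _ (rootA sS)) d sS.
  by rewrite [co _ _]dot_actr invgK fx hv // eqxx ler10.
apply: IH => //.
  apply/eqP; rewrite -eqSS -[X in X == _]/(size (t :: l)) E (len_desc tS d).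
  by rewrite big_cons mulsK.
by move: fx; rewrite big_cons actM => fx; rewrite -[LHS](actsK _ tS) fx act_sv.
Qed.

Lemma big_letters (c : seq W) p : (\prod_(k <- p) letter c k = \prod_(x <- map (letter c) p) x)%g.
Proof. by rewrite big_map. Qed.

Lemma letters_S c p : word c -> (0 < size c)%N -> all (mem S) (map (letter c) p).
Proof. by move=> wc n0; apply/allP => _ /mapP[k _ ->]; apply: letter_in. Qed.

Lemma reduced_rot s c w p : s \in S -> desc s w ->
  reduced_subword S (s :: c) w (0%N :: map succn p) <->
  reduced_subword S (rcons c s) (s * w)%g p.
Proof.
move=> sS d; rewrite /reduced_subword /= path0_map size_map (len_desc sS d).
rewrite big_cons big_map {1}/letter mod0n /=.
under eq_bigr do rewrite letter_rot.
split=> -[-> pE sE]; split=> //; first by rewrite -pE mulsK.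
- by case: sE.
- by rewrite pE mulsK.
- by rewrite sE.
Qed.

(** A word avoiding position 0 is not lexicographically first: the exchange property trades one of
    its letters for the initial [s]. *)
Lemma sorting_head s c w p : word (s :: c) -> desc s w ->
  sorting_word S (s :: c) w p -> exists p', p = 0%N :: map succn p'.
Proof.
move=> wc d [[so pE sE] pm]; have sS := word_headS wc.
case: p so pE sE pm => [|k p] /= so pE sE pm.
  by move: d; rewrite -pE big_nil /desc invg1 act1 (negPf (posA sS)).
case: k so pE sE pm => [|k] so pE sE pm; first by exists (map predn p); rewrite -path0_succ.
have := @exchange _ s (letters_S (k.+1 :: p) wc isT) sS.
rewrite -big_letters pE => /(_ d)[i]; rewrite size_map => il.
rewrite -map_take -map_drop -map_cat -big_letters => wE.
pose q := take i (k.+1 :: p) ++ drop i.+1 (k.+1 :: p).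
have sq : subseq q (k.+1 :: p).
  rewrite -[X in subseq _ X](cat_take_drop i) /q cat_subseq //.
  by rewrite [X in subseq _ X](drop_nth 0%N) // subseq_cons.
have := pm (0%N :: q); rewrite lexi_cons leEnat ltn0 /=.
suff h : reduced_subword S (s :: c) w (0%N :: q) by move/(_ h).
split.
- rewrite /= (path_sortedE ltn_trans) (subseq_sorted ltn_trans sq) // andbT.
  apply/allP => j /(mem_subseq sq); have := so; rewrite (path_sortedE ltn_trans).
  by case/andP => /allP h _; rewrite inE => /orP[/eqP ->//|/h]; apply: ltn_trans.
- by rewrite big_cons /letter mod0n /= -/(letter _) -wE mulsK.
- rewrite -sE /q /= size_cat size_takel ?size_drop; last exact: ltnW.
  by rewrite subnKC // -ltnS.
Qed.

Lemma sorting_rot s c w p : word (s :: c) -> desc s w ->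
  sorting_word S (s :: c) w (0%N :: map succn p) <-> sorting_word S (rcons c s) (s * w)%g p.
Proof.
move=> wc d; have sS := word_headS wc; rewrite /sorting_word reduced_rot //.
split=> -[h m]; split=> // q hq.
  have := m (0%N :: map succn q); rewrite reduced_rot // => /(_ hq).
  by rewrite lexi_cons lexx /= lexi_map.
case: q hq => [|k q] hq.
  by move: d; case: hq => _ <- _; rewrite big_nil /desc invg1 act1 (negPf (posA sS)).
rewrite lexi_cons leEnat leq0n /=; case: k hq => [|k] //= hq.
have [/= /path0_succ qE _ _] := hq; rewrite qE lexi_map //; apply: m.
by apply/(reduced_rot c _ sS d); rewrite -qE.
Qed.

Lemma c_sortable_desc s c w : word (s :: c) -> desc s w ->
  c_sortable S (s :: c) w <-> c_sortable S (rcons c s) (s * w)%g.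
Proof.
move=> wc d; have wr : word (rcons c s) by rewrite word_rot.
have N p : (forall i, c_factor (s :: c) (0%N :: map succn p) i.+1
                        \subset c_factor (s :: c) (0%N :: map succn p) i) <->
           (forall i, c_factor (rcons c s) p i.+1 \subset c_factor (rcons c s) p i).
  rewrite !nestedE // size_rcons /=; split=> h k.
    move=> kp nk; have H : k.+1 \in 0%N :: map succn p by rewrite inE map_f ?orbT.
    have := h _ H (leqW nk); rewrite subSn // inE /= mem_map //; exact: succn_inj.
  rewrite inE => /orP[/eqP -> //|/mapP[j jp -> {k}]]; rewrite ltnS leq_eqVlt.
  case/orP => [/eqP ->|nj]; first by rewrite subnn mem_head.
  by rewrite subSn // inE mem_map ?h ?orbT //; exact: succn_inj.
split=> -[p sp np].
  have [p' pE] := sorting_head wc d sp; rewrite pE in sp np.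
  by exists p'; [apply/(sorting_rot _ wc d)|apply/N].
by exists (0%N :: map succn p); [apply/(sorting_rot _ wc d)|apply/N].
Qed.

Section Insert.
Variables (s : W) (c : seq W) (wc : word (s :: c)) (n0 : (0 < size c)%N).
Local Notation n := (size c).

(* [f] maps the positions of [c c c ...] to those of [(s c)(s c)(s c) ...]. *)
Let f k := (k %/ n * n.+1 + (k %% n).+1)%N.
Let g k := (k %/ n.+1 * n + (k %% n.+1).-1)%N.

Let f_mod_lt k : ((k %% n).+1 < n.+1)%N.
Proof. by rewrite ltnS ltn_mod. Qed.

Let f_div k : (f k %/ n.+1 = k %/ n)%N.
Proof. by rewrite /f divnMDl // (divn_small (f_mod_lt k)) addn0. Qed.

Let f_mod k : (f k %% n.+1 = (k %% n).+1)%N.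
Proof. by rewrite /f modnMDl (modn_small (f_mod_lt k)). Qed.

Let fK k : g (f k) = k.
Proof. by rewrite /g f_div f_mod /= -divn_eq. Qed.

Let gK k : (0 < k %% n.+1)%N -> f (g k) = k.
Proof.
move=> k0; have kn : ((k %% n.+1).-1 < n)%N by rewrite -ltnS prednK // ltn_mod.
rewrite /f /g divnMDl // modnMDl (divn_small kn) (modn_small kn) addn0 prednK //.
by rewrite -divn_eq.
Qed.

Let f_lt x y : (x < y)%N -> (f x < f y)%N.
Proof.
move=> xy; have := leq_div2r n (ltnW xy); rewrite leq_eqVlt => /orP[/eqP E|E].
  rewrite /f E ltn_add2l ltnS; move: xy.
  by rewrite {1}(divn_eq x n) {1}(divn_eq y n) E ltn_add2l.
rewrite /f; have := ltn_pmod x n0 => xn.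
apply: (@leq_trans ((x %/ n).+1 * n.+1)%N).
  by rewrite mulSn addnC ltn_add2r ltnS.
by apply: leq_trans (leq_addr _ _); rewrite leq_pmul2r.
Qed.

Let f_le x y : (f x <= f y)%N = (x <= y)%N.
Proof.
case: (leqP x y) => [|/f_lt]; last by rewrite ltnNge => /negPf.
by rewrite leq_eqVlt => /orP[/eqP ->|/f_lt/ltnW ->//]; rewrite leqnn.
Qed.

Let f_inj : injective f. Proof. exact: can_inj fK. Qed.

Let f_letter k : letter (s :: c) (f k) = letter c k.
Proof. by rewrite /letter /= f_mod. Qed.

Let f_reduced w p : reduced_subword S (s :: c) w (map f p) <-> reduced_subword S c w p.
Proof.
rewrite /reduced_subword size_map big_map; under eq_bigr do rewrite f_letter.
have -> : sorted ltn (map f p) = sorted ltn p.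
  rewrite sorted_map; apply: eq_sorted => x y /=.
  by rewrite !ltnNge f_le.
by split=> -[].
Qed.

Let f_nested p : (forall i, c_factor (s :: c) (map f p) i.+1 \subset c_factor (s :: c) (map f p) i)
  <-> (forall i, c_factor c p i.+1 \subset c_factor c p i).
Proof.
rewrite !nestedE ?(word_tail wc) //=.
have fn k : (n.+1 <= f k)%N = (n <= k)%N by rewrite -(divn_gt0 _ n0) -[LHS]divn_gt0 // f_div.
have fs k : (n <= k)%N -> (f k - n.+1 = f (k - n))%N.
  move=> nk; rewrite -{1}(subnK nk) /f divnDr ?dvdnn // divnn n0 modnDr addn1 mulSn.
  by rewrite -addnA addKn.
split=> h k.
  by move=> kp nk; have := h (f k); rewrite map_f // fn nk fs // mem_map // => ->.
by case/mapP => j jp ->; rewrite fn => nj; rewrite fs // map_f // h.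
Qed.

Let no_multiple w q : act w (v s) = v s -> reduced_subword S (s :: c) w q ->
  q = map f (map g q).
Proof.
move=> fx [so qE sE]; have sS := word_headS wc.
have := @reduced_notin s _ sS (letters_S q wc isT).
rewrite -big_letters qE size_map => /(_ sE fx) ns; rewrite -map_comp.
symmetry; apply: map_id_in => k kq; apply: gK; rewrite lt0n; apply/negP => /eqP k0.
by case/negP: ns; apply/mapP; exists k; rewrite // /letter /= k0.
Qed.

(** In a nested word for [s :: c] any occurrence of [s] shifts back to position 0, which the ascent
    forbids. Conversely, a reduced word of an element fixing [v s] never uses [s]. Either way all
    positions come from [c] along [f]. *)
Lemma c_sortable_insert w : ~~ desc s w ->
  c_sortable S (s :: c) w <-> c_sortable S c w.
Proof.
move=> d; have sS := word_headS wc; have wt := word_tail wc.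
split=> -[p [rp mp] /nestedE np]; last first.
  have fx : act w (v s) = v s.
    have [_ <- _] := rp; elim: (p) => [|k q IH]; first by rewrite big_nil act1.
    have kc : letter c k \in c by rewrite mem_nth // ltn_mod.
    rewrite big_cons actM IH act_sv //; first exact: wordS wt kc.
    by rewrite eq_sym (word_neq wc kc).
  exists (map f p); last by apply/f_nested/nestedE => //; exact: np.
  split; first exact/f_reduced.
  by move=> q rq; move: (rq); rewrite (no_multiple fx rq) lexi_map // => /f_reduced; apply: mp.
have {}np := np wc; have [so pE sE] := rp.
have n0p : 0%N \notin p.
  apply/negP => p0; case: p so pE sE p0 {rp mp np} => // k p so pE sE.
  rewrite inE => /orP[/eqP k0|p0]; last first.
    by move: so; rewrite /= (path_sortedE ltn_trans) => /andP[/allP/(_ _ p0)].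
  have := @reduced_head (letter (s :: c) k) _ (letters_S (k :: p) wc isT).
  rewrite -/(map _ (k :: p)) -big_letters pE size_map => /(_ sE).
  by rewrite -k0 /letter mod0n /= (negPf d).
have nm k : k \in p -> (0 < k %% n.+1)%N.
  have [m] := ubnP k; elim: m k => // m IH k km kp.
  case: (leqP n.+1 k) => [nk|kn].
    have -> : (k %% n.+1 = (k - n.+1) %% n.+1)%N by rewrite -{1}(subnK nk) modnDr.
    apply: IH; last exact: np.
    by rewrite -ltnS; apply: leq_trans km; rewrite ltnS ltn_subrL (leq_trans _ nk).
  by rewrite modn_small // lt0n; apply: contraNneq n0p => <-.
have pf : p = map f (map g p).
  by rewrite -map_comp; symmetry; apply: map_id_in => k /nm; apply: gK.
exists (map g p).
  split; first by apply/f_reduced; rewrite -pf.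
  by move=> q /f_reduced/mp; rewrite {1}pf lexi_map.
by apply/f_nested; rewrite -pf; apply/nestedE.
Qed.

End Insert.

Lemma c_sortable_nil w : c_sortable S [::] w <-> w = 1%g.
Proof.
split=> [[p [[_ <- _] _] _]|->]; first by rewrite big1 // => k _; rewrite /letter nth_nil.
exists [::]; last by move=> i; apply/fintype.subsetP => s; rewrite inE.
by split=> [|q _]; [split; rewrite ?big_nil ?len1 | exact: lexi0s].
Qed.

(** The case of an empty remaining word, where the reindexing [f] would divide by 0. *)
Lemma c_sortable_seq1 s w : s \in S -> ~~ desc s w ->
  c_sortable S [:: s] w <-> w = 1%g.
Proof.
move=> sS d; have wc : word [:: s] by rewrite /word /= sS.
split=> [[p [[so pE sE] _] /nestedE np]|->]; last first.
  exists [::]; last by move=> i; apply/fintype.subsetP => t; rewrite inE.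
  by split=> [|q _]; [split; rewrite ?big_nil ?len1 | exact: lexi0s].
have n0p k : k \in p -> 0%N \in p.
  by elim: k => // k IH kp; apply: IH; have := np wc _ kp isT; rewrite subn1.
case: p so pE sE np n0p => [|k p] so pE sE np n0p; first by rewrite -pE big_nil.
have := @reduced_head (letter [:: s] k) _ (letters_S (k :: p) wc isT).
rewrite -/(map _ (k :: p)) -big_letters pE size_map => /(_ sE).
by rewrite /letter modn1 /= (negPf d).
Qed.

Lemma c_sortableE c w : word c -> c_sortable S c w <-> proj c w = w.
Proof.
move: c w; apply: run_ind => [w|s c w wc d IH|s c w wc d IH].
- by rewrite c_sortable_nil proj_nil; split.
- have sS := word_headS wc; rewrite c_sortable_desc // IH proj_desc //; split=> [->|{2}<-].
    by rewrite mulsK.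
  by rewrite mulsK.
- rewrite proj_asc // -IH; case: c wc {IH} => [|t c] wc; last exact: c_sortable_insert.
  by rewrite c_sortable_nil c_sortable_seq1 // (word_headS wc).
Qed.

Lemma pi_downE c w u : coxeter_word S c -> pi_down S c w u <-> proj c w = u.
Proof.
move=> cc; have wc := coxeter_word_word cc; split=> [[su uw um]|<-].
  apply: weak_le_antisym; last first.
    by apply: sortable_le_proj => //; apply/c_sortableE.
  apply: um; last exact: proj_le.
  by apply/c_sortableE => //; exact: proj_proj.
split; [by apply/c_sortableE => //; exact: proj_proj|exact: proj_le|].
by move=> u' /(c_sortableE _ wc) su' u'w; apply: sortable_le_proj.
Qed.

(** * Heights *)

Definition pt c w (h : label -> R) := \sum_(e <- Run c w) h e.2 *: e.1.

Lemma phi_pt c w h e : word c -> e \in Run c w -> phi c e.2 (pt c w h) = h e.2.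
Proof.
move=> wc eR; have ul := Run_uniq w wc.
rewrite /pt phi_sum (bigD1_seq e) //=; last exact: map_uniq ul.
rewrite phiZ (Run_dual wc eR eR) eqxx mulr1 big1_seq ?addr0 // => f /andP[fe fR].
rewrite phiZ (Run_dual wc eR fR); case: eqP => [E|_]; last by rewrite mulr0.
by rewrite (Run_eq wc eR fR E) eqxx in fe.
Qed.

Lemma dot_pt c w h p : dot p (pt c w h) = \sum_(e <- Run c w) dot p e.1 * h e.2.
Proof. by rewrite /pt dot_sumr; apply: eq_bigr => e _; rewrite dotZr mulrC. Qed.

Lemma pt_eq c w h h' : (forall e, e \in Run c w -> h e.2 = h' e.2) -> pt c w h = pt c w h'.
Proof. by move=> hh; apply: eq_big_seq => e /hh ->. Qed.

Lemma pt_phi c w x : word c -> supp c x -> pt c w (fun l => phi c l x) = x.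
Proof. by move=> wc sx; rewrite {2}(Run_expand w wc sx). Qed.

Lemma dot_expand c w p y : coxeter_word S c ->
  dot p y = \sum_(e <- Run c w) dot p e.1 * phi c e.2 y.
Proof.
move=> cc; have wc := coxeter_word_word cc.
by rewrite -[y in LHS](pt_phi w wc (coxeter_word_supp y cc)) dot_pt.
Qed.

(* The facet heights are encoded by the sequence [K] of their defects along the
   successive exchanges [v_s -> s v_s] of the rotations of [c]; when [K] runs out,
   the heights are those of the point [a]. *)
Fixpoint hgt (K : seq R) (c : seq W) (a : V) (l : label) : R :=
  match K, c, l with
  | k :: K', s :: c', inr _ =>
      hgt K' (rcons c' s) (act s (a - k *: alpha s)) (tau s l)
  | _, _, _ => phi c l a
  end.

Lemma hgt_inl K c a t : hgt K c a (inl t) = co t a.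
Proof. by case: K c => [|k K] [|s c]. Qed.

Lemma hgt_sig k K s c a l : word (s :: c) -> valid (s :: c) l ->
  hgt (k :: K) (s :: c) a (sig s l) = hgt K (rcons c s) (act s (a - k *: alpha s)) l.
Proof.
move=> wc vl; have sS := word_headS wc.
have h b : sig s l = inr b -> hgt (k :: K) (s :: c) a (sig s l) =
    hgt K (rcons c s) (act s (a - k *: alpha s)) l.
  by move=> E; rewrite -{2}(sigK sS vl) E.
case: l vl h => [t|b] /= => [tc|_] h; last exact: h.
case: eqP h => [_|/eqP ts] h; first exact: h.
rewrite hgt_inl /= co_s ?(wordS wc tc) // [co _ (_ - _)]dotBr dotZr.
by rewrite hv ?(wordS wc tc) // (negPf ts) mulr0 subr0.
Qed.

Lemma pt_desc k K s c a w : word (s :: c) -> desc s w ->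
  pt (s :: c) w (hgt (k :: K) (s :: c) a) =
  act s (pt (rcons c s) (s * w)%g (hgt K (rcons c s) (act s (a - k *: alpha s)))).
Proof.
move=> wc d; have sS := word_headS wc; have wr : word (rcons c s) by rewrite word_rot.
rewrite /pt Run_desc // big_map linear_sum; apply: eq_big_seq => e eR.
rewrite linearZ hgt_sig //; apply/valid_rot; exact: Run_valid eR.
Qed.

Lemma Run1 c e : word c -> e \in Run c 1%g -> exists t, e.2 = inl t.
Proof.
elim: c => [|s c IH] wc; first by rewrite Run_nil.
rewrite Run_asc; last by rewrite /desc invg1 act1 posA // (word_headS wc).
rewrite inE => /orP[/eqP ->|]; first by exists s.
by apply: IH; exact: word_tail wc.
Qed.

Lemma pt1 K c a : coxeter_word S c -> pt c 1%g (hgt K c a) = a.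
Proof.
move=> cc; have wc := coxeter_word_word cc.
rewrite -[RHS](pt_phi 1%g wc (coxeter_word_supp a cc)); apply: pt_eq => e eR.
by have [t ->] := Run1 wc eR; rewrite hgt_inl.
Qed.

Definition slack c (h : label -> R) :=
  forall w l, valid c l -> phi c l (pt c w h) <= h l.

Lemma slack_dot c h w w' p : coxeter_word S c -> slack c h ->
  (forall e, e \in Run c w -> 0 <= dot p e.1) ->
  dot p (pt c w' h) <= dot p (pt c w h).
Proof.
move=> cc sl hp; have wc := coxeter_word_word cc.
rewrite (dot_expand w _ _ cc) dot_pt big_seq [leRHS]big_seq; apply: ler_sum => e eR.
by rewrite ler_wpM2l ?hp // sl //; exact: Run_valid eR.
Qed.

Lemma dot_weight_ge0 u z t d : t \in S -> (act z (v t) = act u (v t)) ->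
  ~~ neg (act (u^-1)%g d) -> 0 <= dot (act z (v t)) d.
Proof. by move=> tS -> /posP h; rewrite dot_actl; apply: h. Qed.

(** The points [act z (v t)] with [t != r] lie in both cones, so by [fan_unique] they are orthogonal
    to the difference of the two vertices. The sign comes from [slack_dot] at [act z (v r)]. *)
Lemma slack_cover c h z r : coxeter_word S c -> slack c h -> r \in S ->
  exists2 lam, 0 <= lam & pt c z h - pt c (z * r)%g h = lam *: act z (alpha r).
Proof.
move=> cc sl rS; have wc := coxeter_word_word cc; set D := _ - _.
have Dt t : t \in S -> t != r -> dot (act z (v t)) D = 0.
  move=> tS tr; have E : act z (v t) = act (z * r)%g (v t) by rewrite actM (act_sv rS tS tr).
  apply/eqP; rewrite dotBr subr_eq0 !dot_pt; apply/eqP/fan_unique => // e eR.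
    by apply: (@dot_weight_ge0 z) => //; exact: Run_pos eR.
  by apply: (@dot_weight_ge0 (z * r)%g) => //; exact: Run_pos eR.
exists (dot (act z (v r)) D).
  rewrite dotBr subr_ge0; apply: slack_dot => // e eR.
  by apply: (@dot_weight_ge0 z) => //; exact: Run_pos eR.
rewrite -[LHS](actKV z) dot_actl -linearZ /=; congr (act z _).
by apply: co_alpha => // t tS tr; rewrite /co dot_actr invgK Dt.
Qed.

Lemma slack_gallery K c a z u : coxeter_word S c -> slack c (hgt K c a) ->
  (forall b, inversion z b -> 0 <= dot u b) -> 0 <= dot u (a - pt c z (hgt K c a)).
Proof.
move=> cc sl; move: z; apply: weyl_ind_last => [_|r z rS p IH hu].
  by rewrite pt1 // subrr dot0r.
have [lam lam0 E] := slack_cover z cc sl rS.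
rewrite -(subrK (pt c z (hgt K c a)) (pt _ (z * r)%g _)) -opprB E.
rewrite [- _ + _]addrC opprD opprK addrA dotDr dotZr addr_ge0 //.
  by apply: IH => b ib; apply: hu; apply: inversion_last.
rewrite mulr_ge0 // hu //; split=> //; first exact/root_act/rootA.
rewrite invMg actM actK (invs rS) actA // negN ?posA //; exact: rootA.
Qed.

(** Reflected by [s], the claim concerns a gallery from the identity to [s * w] in the fan of
    [rcons c s]. The gain of [k] over the required bound [co s a] makes the later crossing of the
    wall [alpha s] strict. *)
Lemma slack_head k K s c a w : coxeter_word S (s :: c) -> desc s w ->
  slack (rcons c s) (hgt K (rcons c s) (act s (a - k *: alpha s))) ->
  co s (pt (s :: c) w (hgt (k :: K) (s :: c) a)) <= co s a - k.
Proof.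
move=> cc d sl; have wc := coxeter_word_word cc; have sS := word_headS wc.
rewrite pt_desc //; set a' := act s _ in sl *; set x := pt _ _ _.
have -> : co s a - k = co s (act s a').
  by rewrite /a' actsK // [RHS]dotBr dotZr hv // eqxx mulr1.
rewrite -subr_ge0 -[X in 0 <= X]dotBr -linearB /= dot_actr (invs sS).
apply: slack_gallery => //; first exact: coxeter_word_rot.
have ds : ~~ desc s (s * w)%g by rewrite descs // negbK.
move=> b ib; have [_ /posP p _] := inversion_up sS ds ib.
by rewrite dot_actl (invs sS); apply: p.
Qed.

(** Longer-lived labels are left out, because with no defects left the heights are those of the
    point [a], where every inequality is tight. *)
Definition strict K c (h : label -> R) :=
  forall w l, valid c l -> life K c l -> l \notin [seq e.2 | e <- Run c w] ->
    phi c l (pt c w h) < h l.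

Definition rvec c l := \sum_(t in S) phi c l (alpha t) *: v t.

Lemma dot_rvec c l y : dot (rvec c l) y = phi c l y.
Proof.
rewrite /rvec dot_suml [y in RHS]coE phi_sum; apply: eq_bigr => t _.
by rewrite dotZl phiZ mulrC.
Qed.

(* For [w] not above [s], the wall [alpha s] of the cone of [w] is shared with the
   cone of some [w2] above [s]. *)
Lemma across_head s c w : coxeter_word S (s :: c) -> ~~ desc s w ->
  exists2 w2, desc s w2 & forall e, e \in Run (s :: c) w -> e.2 != inl s ->
    e.2 \in [seq f.2 | f <- Run (s :: c) w2].
Proof.
move=> cc d; have wc := coxeter_word_word cc; have sS := word_headS wc.
(* The sum of the rays other than [v s] lies in the relative interior of the wall, and [s] fixes
   it. *)
pose p := \sum_(e <- Run (s :: c) w | e.2 != inl s) rvec (s :: c) e.2.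
have eA : (alpha s, inl s) \in Run (s :: c) w by rewrite Run_asc // mem_head.
have ul := Run_uniq w wc.
have pE e : e \in Run (s :: c) w -> dot p e.1 = (e.2 != inl s)%:R.
  move=> eR; rewrite /p dot_suml.
  under eq_bigr do rewrite dot_rvec.
  rewrite big_seq_cond (eq_bigr (fun f => (f.2 == e.2)%:R)); last first.
    by move=> f /andP[fR _]; rewrite (Run_dual wc fR eR).
  rewrite -big_seq_cond big_mkcond (bigD1_seq e) //=; last exact: map_uniq ul.
  rewrite eqxx big1_seq ?addr0 => [|f /andP[fe fR]]; first by case: ifP.
  case: ifP => // _; case: eqP => // E.
  by rewrite (Run_eq wc fR eR E) eqxx in fe.
have pA : dot p (alpha s) = 0 by rewrite (pE _ eA) eqxx.
have sp : act s p = p by rewrite act_s // pA mulr0 mul0r scale0r subr0.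
(* If the chamber found around [p] is not above [s], its mirror image is, and it contains [p] as
   well. *)
have [w2 d2 dw2] : exists2 w2, desc s w2 & dom (act (w2^-1)%g p).
  have [g dg] := chamber_cover p; case: (boolP (desc s g)) => dsg; first by exists g.
  by exists (s * g)%g; rewrite ?descs // invMg actM (invs sS) sp.
exists w2 => // e eR es; apply: (@cone_label (s :: c) w w2 p) => //.
- by move=> f fR; rewrite pE.
- move=> f fR; rewrite -(actKV w2 p) dot_actl dot_ge0 //.
  by have := Run_pos wc fR.
by rewrite pE // es.
Qed.

Lemma slack_strict K c a : coxeter_word S c -> all (fun k => 0 < k) K ->
  slack c (hgt K c a) /\ strict (size K) c (hgt K c a).
Proof.
elim: K c a => [|k K IH] c a cc; have wc := coxeter_word_word cc.
  move=> _; split=> // w l vl.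
  by rewrite (_ : pt _ _ _ = a) //; apply: pt_phi => //; exact: coxeter_word_supp.
case/andP=> k0 K0; case: c cc wc => [|s c] cc wc.
  have no l : ~ valid [::] l.
    case: l => [//|b [bP b0 sb]]; have [t tS] := pos_ex bP b0.
    by rewrite sb // ltxx.
  by split=> w l /no.
have sS := word_headS wc; have cr := coxeter_word_rot cc.
have wr := coxeter_word_word cr.
pose a' := act s (a - k *: alpha s); have [sl st] := IH (rcons c s) a' cr K0.
set h := hgt (k :: K) (s :: c) a; set h' := hgt K (rcons c s) a' in sl st.
have hd w : desc s w -> co s (pt (s :: c) w h) <= co s a - k by move=> d; apply: slack_head.
have shift w l : desc s w -> valid (s :: c) l -> l != inl s ->
    phi (s :: c) l (pt (s :: c) w h) = phi (rcons c s) (tau s l) (pt (rcons c s) (s * w)%g h')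
    /\ h l = h' (tau s l).
  move=> d vl ls; split; last first.
    by rewrite -{1}(tauK sS vl ls) [LHS]hgt_sig //; apply/valid_rot/valid_tau.
  rewrite [pt (s :: c) _ _]pt_desc // phi_tau //.
  exact: coxeter_word_supp.
have dsc w l : desc s w -> valid (s :: c) l ->
    phi (s :: c) l (pt (s :: c) w h) <= h l /\
    (life (size K).+1 (s :: c) l -> l \notin [seq e.2 | e <- Run (s :: c) w] ->
     phi (s :: c) l (pt (s :: c) w h) < h l).
  move=> d vl; case: (eqVneq l (inl s)) => [->|ls].
    rewrite /h hgt_inl -/h /= ; have := hd w d => H; split=> [|_ _].
      by apply: le_trans H _; rewrite gerBl ltW.
    by apply: le_lt_trans H _; rewrite gtrBl.
  have [-> ->] := shift w l d vl ls; have vt := valid_tau wc vl; split; first exact: sl.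
  rewrite /= (negPf ls) /= => lf nl; apply: st => //.
  apply: contra nl => /mapP[e eR E]; apply/mapP; rewrite Run_desc //.
  exists (act s e.1, sig s e.2); first by apply/mapP; exists e.
  by rewrite /= -E (tauK sS vl ls).
have asc w l : ~~ desc s w -> valid (s :: c) l ->
    phi (s :: c) l (pt (s :: c) w h) <= h l /\
    (life (size K).+1 (s :: c) l -> l \notin [seq e.2 | e <- Run (s :: c) w] ->
     phi (s :: c) l (pt (s :: c) w h) < h l).
  move=> d vl; have eA : (alpha s, inl s) \in Run (s :: c) w by rewrite Run_asc // mem_head.
  case: (eqVneq l (inl s)) => [->|ls].
    rewrite (phi_pt h wc eA); split=> // _ /negP[].
    by apply/mapP; exists (alpha s, inl s).
  have [w2 d2 lab] := across_head cc d.
  set x := pt _ w h; set x2 := pt (s :: c) w2 h; pose lam := co s (x - x2).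
  (* Every label of the cone of [w] except [inl s] is shared, hence tight at both vertices; they can
     differ along [alpha s] only. *)
  have E : x - x2 = lam *: alpha s.
    rewrite [LHS](Run_expand w wc); last exact: coxeter_word_supp.
    rewrite (bigD1_seq _ eA) /=; last exact: map_uniq (Run_uniq w wc).
    rewrite big1_seq ?addr0 // => e /andP[ne eR].
    have es : e.2 != inl s by apply: contraNneq ne => /(Run_eq wc eR eA) ->.
    have /mapP[f fR ef] := lab e eR es.
    by rewrite phiB (phi_pt h wc eR) ef (phi_pt h wc fR) subrr scale0r.
  have lam0 : 0 < lam.
    rewrite /lam [co _ _]dotBr subr_gt0; apply: le_lt_trans (hd w2 d2) _.
    rewrite -/(co s x); have -> : co s x = h (inl s) by exact: (phi_pt h wc eA).
    by rewrite /h hgt_inl gtrBl.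
  have -> : x = x2 + lam *: alpha s by rewrite -E addrC subrK.
  have pA := phi_headA wc vl ls; have [le2 lt2] := dsc w2 l d2 vl.
  rewrite phiD phiZ; split; first by rewrite -[leRHS]addr0 lerD // mulr_ge0_le0 // ltW.
  move=> lf nl; have [pA0|pA0] := ltP (phi (s :: c) l (alpha s)) 0.
    by rewrite -[ltRHS]addr0 ler_ltD // pmulr_rlt0.
  have {pA0 pA} pA : phi (s :: c) l (alpha s) = 0 by apply/eqP; rewrite eq_le pA.
  rewrite pA mulr0 addr0; apply: lt2 => //; apply/negP => /mapP[f fR lE].
  (* If [l] is a label of [w2] but not of [w], its normal vanishes on all shared rays and is a
     multiple of [alpha s]. But [l] vanishes on [alpha s] and takes the value 1 on its normal. *)
  have fE : f.1 = co s f.1 *: alpha s.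
    rewrite [LHS](Run_expand w wc); last exact: coxeter_word_supp.
    rewrite (bigD1_seq _ eA) /=; last exact: map_uniq (Run_uniq w wc).
    rewrite big1_seq ?addr0 // => e /andP[ne eR].
    have es : e.2 != inl s by apply: contraNneq ne => /(Run_eq wc eR eA) ->.
    have /mapP[f' fR' ef] := lab e eR es.
    rewrite ef (Run_dual wc fR' fR); case: eqP => [E'|_]; last by rewrite scale0r.
    by case/negP: nl; apply/mapP; exists e; rewrite // lE ef E'.
  have := Run_dual wc fR fR; rewrite eqxx {1}fE phiZ -lE pA mulr0 => /eqP.
  by rewrite eq_sym oner_eq0.
split=> w l vl; case: (boolP (desc s w)) => d.
- by have [] := dsc w l d vl.
- by have [] := asc w l d vl.
- by move=> lf nl; have [_] := dsc w l d vl; apply.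
- by move=> lf nl; have [_] := asc w l d vl; apply.
Qed.


(** For this value of [k] the point [a - k *: alpha s] is [act s a], so every step of [hgt] returns
    to the same [a]. *)
Fixpoint defects n (c : seq W) (a : V) : seq R :=
  if n is n'.+1 then
    if c is s :: c' then
      2 * dot a (alpha s) / nrm (alpha s) :: defects n' (rcons c' s) a
    else [::]
  else [::].

(** * The heights of the permutahedron *)

Section Heights.
Variables (a : V) (a_gt0 : forall s, s \in S -> 0 < dot a (alpha s)).

Lemma defects_gt0 n c : word c -> all (fun k => 0 < k) (defects n c a).
Proof.
elim: n c => // n IH [//|s c] wc /=; have sS := word_headS wc.
by rewrite IH ?word_rot // andbT divr_gt0 ?nrmA // mulr_gt0 // a_gt0.
Qed.

Lemma size_defects n c : (0 < size c)%N -> size (defects n c a) = n.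
Proof.
by elim: n c => // n IH [//|s c] _ /=; rewrite IH // size_rcons.
Qed.

Lemma hgt_orbit n c l : coxeter_word S c -> valid c l -> life n c l ->
  exists g q, [/\ q \in S, rvec c l = act g (v q) & hgt (defects n c a) c a l = dot a (v q)].
Proof.
elim: n c l => // n IH [//|s c] l cc vl; have wc := coxeter_word_word cc.
have sS := word_headS wc; case: l vl => [t|b] vl.
  move=> _; exists 1%g, t; rewrite act1 hgt_inl /co dotC; split=> //.
    exact: wordS wc vl.
  by apply: (dot_ext (dot := dot)) => y; rewrite dot_rvec.
rewrite /life -/life => /orP[//|lf]; have vt := valid_tau wc vl.
have [g [q [qS gE hE]]] := IH _ _ (coxeter_word_rot cc) vt lf.
exists (s * g)%g, q; split=> //.
  apply: (dot_ext (dot := dot)) => y; rewrite dot_rvec actM -gE dot_actl (invs sS).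
  by rewrite dot_rvec phi_tau ?actsK //; exact: coxeter_word_supp.
by rewrite -hE /= -act_s // actsK.
Qed.

Lemma heights_exist c : coxeter_word S c -> exists h : label -> R,
  [/\ forall w e w', e \in Run c w -> phi c e.2 (pt c w' h) <= h e.2,
      forall w e w', e \in Run c w -> e.2 \notin [seq f.2 | f <- Run c w'] ->
        phi c e.2 (pt c w' h) < h e.2 &
      forall w e, e \in Run c w ->
        exists g q, [/\ q \in S, rvec c e.2 = act g (v q) & h e.2 = dot a (v q)]].
Proof.
move=> cc; have wc := coxeter_word_word cc.
(* The list of defects has its full length only for a nonempty word; in rank 0 there are no
   labels. *)
have [n0|n0] := posnP (size c).
  by exists (fun=> 0); split=> w e; have := size_Run w wc; rewrite n0 => /size0nil ->.
(* One list of defects long enough for the labels of all cones. *)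
have [f fl] := choice (fun w => Run_life w cc); pose N := \max_w f w.
have lN w e : e \in Run c w -> life N c e.2.
  by move=> eR; apply: life_le (fl w e eR); exact: leq_bigmax.
have [sl st] := @slack_strict (defects N c a) c a cc (defects_gt0 N wc).
exists (hgt (defects N c a) c a); split=> w e.
- by move=> w' eR; apply: sl; exact: Run_valid eR.
- move=> w' eR; apply: st; first exact: Run_valid eR.
  by rewrite size_defects // (lN w).
- move=> eR; apply: hgt_orbit => //; first exact: Run_valid eR.
  exact: lN eR.
Qed.

End Heights.

(** * The Cambrian fan and the associahedron *)

Section Associahedron.
Variables (c : seq W) (cc : coxeter_word S c).

Let wc : word c. Proof. exact: coxeter_word_word. Qed.

Lemma Run_complete u : exists w, fan_cone dot (Run c) w u.
Proof.
have [g dg] := chamber_cover u; exists g => e eR.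
rewrite -(actKV g u) dot_actl dot_ge0 //; exact: Run_pos eR.
Qed.

Lemma size_Run_card w : size (Run c w) = #|S|.
Proof.
rewrite size_Run //; case: cc => uc cS.
by rewrite -(eq_card cS); apply/esym/card_uniqP.
Qed.

Lemma cambrian_coneE w : proj c w = w ->
  cambrian_cone dot S act alpha c w = fan_cone dot (Run c) w.
Proof.
move=> pw; apply/seteqP; split=> x /=.
  move=> [w' /= /(pi_downE _ _ cc) pw'] [y yD <-] e eR; rewrite dot_actl dot_ge0 //.
  by move: eR; rewrite -pw' Run_proj //; exact: Run_pos.
(* [act w rho] is interior to the cone, so the chamber met on moving slightly from [x] towards it
   lies in the cone, even if [x] is on the boundary. *)
move=> xc; have [g [dg hg]] := chamber_near x (act w rho).
exists g; last by exists (act (g^-1)%g x); rewrite ?actKV.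
apply/pi_downE => //; rewrite -[RHS]pw; apply: (Run_cone wc _).2 => e eR.
apply: hg; [exact: Run_root eR|exact: xc|].
rewrite dot_actl dot_rho_gt0 //; first by apply: root_act; exact: Run_root eR.
exact: Run_pos eR.
Qed.

Lemma cambrian_fanE : cambrian_fan dot S act alpha c =
  [set F | exists w, face dot (fan_cone dot (Run c) w) F /\ F !=set0].
Proof.
apply/seteqP; split=> F /=.
  by move=> [w [/(c_sortableE _ wc) pw fF F0]]; exists w; rewrite -cambrian_coneE.
move=> [w [fF F0]]; exists (proj c w).
have pw := proj_proj w wc; split=> //; first exact/c_sortableE.
rewrite cambrian_coneE //; suff -> : fan_cone dot (Run c) (proj c w) = fan_cone dot (Run c) w by [].
by rewrite /fan_cone Run_proj.
Qed.

Variables (a : V) (a_gt0 : forall s, s \in S -> 0 < dot a (alpha s)).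
Variables (h : label -> R).
Hypothesis h_le : forall w e w', e \in Run c w -> phi c e.2 (pt c w' h) <= h e.2.
Hypothesis h_lt : forall w e w', e \in Run c w ->
  e.2 \notin [seq f.2 | f <- Run c w'] -> phi c e.2 (pt c w' h) < h e.2.
Hypothesis h_orbit : forall w e, e \in Run c w ->
  exists g q, [/\ q \in S, rvec c e.2 = act g (v q) & h e.2 = dot a (v q)].

Let expand w x : x = \sum_(e <- Run c w) dot (rvec c e.2) x *: e.1.
Proof.
rewrite {1}(Run_expand w wc (coxeter_word_supp x cc)).
by apply: eq_bigr => e _; rewrite dot_rvec.
Qed.

Let dual w e e' : e \in Run c w -> e' \in Run c w ->
  dot (rvec c e.2) e'.1 = (e.2 == e'.2)%:R.
Proof. by move=> eR e'R; rewrite dot_rvec (Run_dual wc eR e'R). Qed.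

Let labels_uniq w : uniq [seq e.2 | e <- Run c w]. Proof. exact: Run_uniq. Qed.

Let vert_le w w' e : e \in Run c w' -> dot (vert (Run c) h w) (rvec c e.2) <= h e.2.
Proof. by move=> eR; rewrite dotC dot_rvec; exact: h_le eR. Qed.

Let vert_lt w w' e : e \in Run c w' -> e.2 \notin [seq f.2 | f <- Run c w] ->
  dot (vert (Run c) h w) (rvec c e.2) < h e.2.
Proof. by move=> eR nl; rewrite dotC dot_rvec; exact: h_lt eR nl. Qed.

Local Notation Ass := (associahedron dot S act alpha v c a).
Local Notation P := (height_polytope dot (Run c) (rvec c) h).

Lemma associahedronE : Ass = P.
Proof.
have rays := fan_raysE expand dual labels_uniq.
apply/seteqP; split=> x.
  move=> hx w e eR; have [g [q [qS gE hE]]] := h_orbit eR.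
  have : fan_rays (cambrian_fan dot S act alpha c) (act g @` fund_ray v q).
    rewrite cambrian_fanE rays /=; exists w; exists e => //; rewrite gE.
    apply/seteqP; split=> y /=.
      by move=> [_ [t t0 <-] <-]; exists t => //; rewrite linearZ.
    by move=> [t t0 <-]; exists (t *: v q); [exists t|rewrite linearZ].
  move/hx => [w' [s [sS E xs]]]; rewrite gE hE.
  (* A ray determines its generator: [fund_domain] identifies [v q] with [t *: v s], and pairing
     with [alpha q] gives [s = q] and [t = 1]. *)
  suff [-> ->] : act g (v q) = act w' (v s) /\ q = s by [].
  have : (act g @` fund_ray v q) (act g (v q)).
    by exists (v q) => //; exists 1; rewrite /= ?scale1r ?ler01.
  rewrite E => -[_ [t /= t0 <-]]; rewrite linearZ /= => gq.
  have D : dom (t *: v s) by move=> r rS; rewrite dotZl mulr_ge0 // dom_v.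
  have F : act (g^-1 * w')%g (t *: v s) = v q by rewrite actM linearZ /= gq actK.
  have := fund_domain D; move/(_ (g^-1 * w')%g); rewrite F => /(_ (dom_v qS)) qs.
  have := congr1 (fun y => dot y (alpha q)) qs; rewrite dotZl !hv // eqxx.
  case: (eqVneq s q) => [sq|_]; last by rewrite mulr0 => /eqP; rewrite oner_eq0.
  by rewrite mulr1 => t1; rewrite -gq -t1 scale1r sq.
move=> xP r; rewrite cambrian_fanE rays /= => -[w [e eR ->]].
have [g [q [qS gE hE]]] := h_orbit eR; exists g, q; split=> //.
  rewrite gE; apply/seteqP; split=> y /=.
    by move=> [t t0 <-]; exists (t *: v q); [exists t|rewrite linearZ].
  by move=> [_ [t t0 <-] <-]; exists t => //; rewrite linearZ.
by rewrite -gE -hE; exact: xP eR.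
Qed.

Lemma associahedron_simple : simple_polytope dot Ass #|S|.
Proof.
rewrite associahedronE.
apply: (simple_height_polytope expand dual labels_uniq Run_complete size_Run_card vert_le vert_lt).
exact: (polytope_height_polytope expand dual labels_uniq Run_complete vert_le).
Qed.

Lemma associahedron_normal_fan : normal_fan dot Ass = cambrian_fan dot S act alpha c.
Proof.
rewrite associahedronE cambrian_fanE.
exact: (normal_fanE expand dual labels_uniq Run_complete vert_le vert_lt).
Qed.

Lemma dom_a : dom a. Proof. by move=> s sS; rewrite ltW // a_gt0. Qed.

Lemma orbit_in g : P (act g a).
Proof.
move=> w e eR; have [g' [q [qS -> ->]]] := h_orbit eR.
rewrite dot_actr -actM; apply: dom_le; first exact: dom_a.
exact: dom_v.
Qed.

Lemma orbit_rho_eq g : dot (act g a) rho = dot a rho -> act g a = a.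
Proof.
move=> E; have co0 t : t \in S -> 0 <= co t (a - act g a).
  move=> tS; rewrite /co dotC dotBl subr_ge0 dom_le //; first exact: dom_a.
  exact: dom_v.
have : \sum_(t in S) co t (a - act g a) = 0.
  by rewrite -dot_suml -/rho dotC dotBl E subrr.
move/eqP; rewrite psumr_eq0 // => /allP z; apply/esym/co_inj => t tS.
apply/eqP; rewrite -subr_eq0 -[X in X == _]dotBr.
by have := z t; rewrite mem_index_enum tS => /(_ isT).
Qed.

Lemma permutahedron_vertices :
  vertices dot (permutahedron act a) = range (fun w => act w a).
Proof.
apply/seteqP; split=> x /=.
  move=> [u [b [ub E]]].
  have [xH xb] : (permutahedron act a `&` [set y | dot u y = b]) x by rewrite -E.
  have [] := @hull_max_eq _ _ dot (range (fun w => act w a)) u b x x _ _ xH xb => //.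
    by move=> y yA; apply: ub; apply: hull_in.
  move=> y yA yb; have : [set x] y by rewrite E; split=> //; exact: hull_in.
  by [].
(* The orbit point [act w a] is exposed by [act w rho], since [rho] pairs with an orbit point other
   than [a] strictly less than with [a]. *)
move=> [w _ <-]; pose u := act w rho; pose b := dot a rho.
have ub y : range (fun w => act w a) y -> dot u y <= b.
  move=> [g _ <-]; rewrite /u dot_actl dotC -actM; apply: dom_le; first exact: dom_a.
  exact: dom_rho.
exists u, b; split=> [y|]; first exact: hull_max.
apply/seteqP; split=> y /=.
  move=> ->; split; first by apply: hull_in; exists w.
  by rewrite /u dot_act dotC.
move=> [yH yb]; apply: (hull_max_eq ub _ yH yb).1 => _ [g _ <-].
rewrite /u dot_actl dotC -actM => /orbit_rho_eq; rewrite actM => E.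
by rewrite -[LHS](actKV w) E.
Qed.

Lemma associahedron_vertices :
  vertices dot Ass `&` vertices dot (permutahedron act a)
  = [set act w a | w in [set w | c_singleton S c w]].
Proof.
rewrite permutahedron_vertices associahedronE.
rewrite (verticesE expand dual labels_uniq Run_complete vert_le vert_lt).
apply/seteqP; split=> x /=.
  move=> [[w' _ xE] [w _ wE]]; exists w => //=.
  (* All of the orbit of [a] lies in the associahedron, so comparing with the neighbours
     [act (w * s) a] confines the normal cone at the common vertex to the chamber of [w]. *)
  have inD u : fan_cone dot (Run c) w' u -> dom (act (w^-1)%g u).
    move=> uc s sS; rewrite -dot_actr.
    have := cone_max expand dual labels_uniq uc (orbit_in (w * s)%g).
    rewrite xE -wE actM (act_s _ sS) linearB /= [act w (_ *: _)]linearZ /= dotBr dotZr.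
    rewrite gerBl pmulr_rge0 //.
    by rewrite divr_gt0 ?nrmA // mulr_gt0 // a_gt0.
  have only g : Run c g = Run c w' -> g = w.
    move=> gE; have D : dom (act (w^-1)%g (act g rho)).
      apply: inD => e eR; rewrite dot_actl dot_ge0 //; first exact: dom_rho.
      by rewrite -gE in eR; exact: Run_pos eR.
    suff E : (w^-1 * g)%g = 1%g by rewrite -[g](mulKVg w) E mulg1.
    apply: no_inversion => s sS; rewrite /desc invMg invgK.
    have rP : Phi (act (g^-1 * w)%g (alpha s)) by exact/root_act/rootA.
    case: (boolP (neg _)) => // n; have := D s sS.
    have n' : ~~ neg (- act (g^-1 * w)%g (alpha s)) by rewrite negN // n.
    rewrite -dot_actr dot_actl -actM leNgt.
    by have := dot_rho_gt0 (rootN rP) n'; rewrite dotNr oppr_gt0 => ->.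
  have pw' : proj c w' = w by apply: only; rewrite Run_proj.
  rewrite /c_singleton; apply/seteqP; split=> g /=.
    move=> /(pi_downE _ _ cc) pg; apply: only.
    by rewrite -(Run_proj g wc) pg -pw' Run_proj.
  by move=> ->; apply/pi_downE => //; rewrite -{1}(only w').
move=> [w sw <-]; split; last by exists w.
have pE g : proj c g = w <-> g = w.
  by rewrite -pi_downE //; have := sw; rewrite /= /c_singleton => /seteqP[h1 h2]; split=> [/h1|/h2].
have pw : proj c w = w by apply/pE.
exists w => //; rewrite -[RHS](pt_phi w wc (coxeter_word_supp _ cc)); apply: pt_eq => e eR.
(* The cone of a singleton is a single chamber, so each of its rays is some [act w (v q)] and the
   height there is the value at [act w a]. *)
have : fan_cone dot (Run c) w (rvec c e.2) by exact: (rv_cone dual eR).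
rewrite -cambrian_coneE // => -[w' /= /(pi_downE _ _ cc)/pE -> [y yD yE]].
have [g [q [qS gE hE]]] := h_orbit eR.
have yq : act (w^-1 * g)%g (v q) = y by rewrite actM -gE -yE actK.
have := fund_domain (g := (w^-1 * g)%g) (dom_v qS); rewrite yq => /(_ yD) yv.
by rewrite hE -dot_rvec -yE yv dot_act dotC.
Qed.

End Associahedron.

Lemma interior_gt0 a : euclidean_interior dot dom a -> forall s, s \in S -> 0 < dot a (alpha s).
Proof.
move=> [e e0 h] s sS; have n0 := nrmA sS; set m := nrm (alpha s) in n0.
(* A move from [a] by [t] against [alpha s] stays within distance [e], whatever the squared norm
   [m]. *)
pose t := e / (1 + m); have t0 : 0 < t by rewrite divr_gt0 // addr_gt0.
have := h (a - t *: alpha s); rewrite addrAC subrr add0r dotNl dotNr opprK dotZl dotZr.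
rewrite -/(nrm _) -/m => H; have {H} /H : t * (t * m) < e ^+ 2.
  have -> : t * (t * m) = e ^+ 2 * (m / (1 + m) ^+ 2).
    by rewrite /t; field; rewrite gt_eqF // addr_gt0.
  rewrite -[ltRHS]mulr1 ltr_pM2l ?exprn_gt0 // ltr_pdivrMr ?exprn_gt0 ?addr_gt0 //.
  nra.
move=> /(_ s sS); rewrite dotBl dotZl -/(nrm _) -/m subr_ge0; apply: lt_le_trans.
by rewrite mulr_gt0.
Qed.

End Reflections.

Theorem theorem3p4
  (W : finGroupType) (S : {set W}) (hWS : coxeter_system S)
  (R : realType) (V : vectType R) (dot : {dot V for @idfun R})
  (act : W -> 'End(V)) (hact : essential_reflection_action dot S act)
  (Phi : set V) (hPhi : root_system dot act Phi)
  (alpha : W -> V) (halpha : simple_roots dot S act Phi alpha)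
  (v : W -> V) (hv : fundamental_weights dot S alpha v)
  (c : seq W) (hc : coxeter_word S c)
  (a : V) (ha : euclidean_interior dot (chamber dot S alpha) a) :
  (simple_polytope dot (associahedron dot S act alpha v c a) #|S| /\
   normal_fan dot (associahedron dot S act alpha v c a)
     = cambrian_fan dot S act alpha c) /\
  vertices dot (associahedron dot S act alpha v c a)
    `&` vertices dot (permutahedron act a)
    = [set act w a | w in [set w | c_singleton S c w]].
Proof.
have a0 := interior_gt0 hPhi halpha ha.
have [h [h1 h2 h3]] := heights_exist hWS hact hPhi halpha hv a0 hc.
split; first split.
- exact: (associahedron_simple hWS hact hPhi halpha hv hc h1 h2 h3).
- exact: (associahedron_normal_fan hWS hact hPhi halpha hv hc h1 h2 h3).
- exact: (associahedron_vertices hWS hact hPhi halpha hv hc a0 h1 h2 h3).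
Qed.
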